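(* Let $(\mathbf u,p,\mathbf w,\mathbf m,\mathbf h)$, with $\mathbf h=\nabla\varphi$, be a sufficiently smooth solution ($\mathbf u,\mathbf w,\mathbf m,\varphi\in C^2(\overline\Omega\times[0,t_F])$ and $p\in C^1(\overline\Omega\times[0,t_F])$) of the ferrohydrodynamics system described in the context, where either $\sigma=0$ and no boundary condition is imposed on $\mathbf m$, or $\sigma>0$ and $\mathbf m$ satisfies $\operatorname{curl}\mathbf m\times \mathbf n=0$ and $\operatorname{div}\mathbf m=0$ on $\Gamma\times(0,t_F)$. Then $$\mathscr E(t_F)+\int_0^{t_F}\mathscr D(s)\,ds\le \int_0^{t_F}\mathscr F(s)\,ds+\mathscr E(0),$$ where, with all norms being $L^2(\Omega)$ norms, $$\mathscr E(s)=\tfrac12\big(\|\mathbf u(s)\|^2+\jmath\|\mathbf w(s)\|^2+\mu_0\|\mathbf m(s)\|^2+\mu_0\|\mathbf h(s)\|^2\big),$$ $$\begin{aligned}\mathscr D(s)=\;&\nu\|\nabla\mathbf u(s)\|^2+c_1\|\nabla\mathbf w(s)\|^2+\sigma\mu_0\|\operatorname{curl}\mathbf m(s)\|^2+\sigma\mu_0\|\operatorname{div}\mathbf m(s)\|^2+\sigma\mu_0\|\operatorname{div}\mathbf h(s)\|^2+c_2\|\operatorname{div}\mathbf w(s)\|^2\\&+\nu_r\|\operatorname{curl}\mathbf u(s)-2\mathbf w(s)\|^2+\tfrac{\mu_0}{\mathscr T}\|\mathbf m(s)\|^2+\tfrac{\mu_0}{2\mathscr T}\big(\tfrac12+3\varkappa_0\big)\|\mathbf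 h(s)\|^2,\end{aligned}$$ $$\mathscr F(s)=\mathscr T\mu_0\|\partial_t\mathbf h_a(s)\|^2+\tfrac{\mu_0}{2\mathscr T}(1+\varkappa_0)\|\mathbf h_a(s)\|^2 .$$
   Context: $\Omega\subset\mathbb R^3$ is a bounded simply connected domain, a convex polyhedron, with boundary $\Gamma$ and outward unit normal $\mathbf n$; $t_F>0$. The material constants $\nu,\nu_r,\mu_0,\jmath,c_1,c_2,\sigma,\varkappa_0$ are nonnegative and $\mathscr T>0$. The applied field $\mathbf h_a=\mathbf h_a(x,t)$ is a given smooth vector field on $\overline\Omega\times[0,t_F]$ which is harmonic: $\operatorname{curl}\mathbf h_a=0$ and $\operatorname{div}\mathbf h_a=0$ for each $t$. The ferrohydrodynamics system (Rosensweig model) is, in $\Omega\times(0,t_F]$, $$\mathbf u_t+(\mathbf u\cdot\nabla)\mathbf u-(\nu+\nu_r)\Delta\mathbf u+\nabla p=2\nu_r\operatorname{curl}\mathbf w+\mu_0(\mathbf m\cdot\nabla)\mathbf h,\qquad \operatorname{div}\mathbf u=0,$$ $$\jmath\mathbf w_t+\jmath(\mathbf u\cdot\nabla)\mathbf w-c_1\Delta\mathbf w-c_2\nabla\operatorname{div}\mathbf w+4\nu_r\mathbf w=2\nu_r\operatorname{curl}\mathbf u+\mu_0\,\mathbf m\times\mathbf h,$$ $$\mathbf m_t+(\mathbf u\cdot\nabla)\mathbf m-\sigma\Delta\mathbf m=\mathbf w\times\mathbf m-\tfrac1{\mathscr T}(\mathbf m-\varkappa_0\mathbf h),$$ with initial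 conditions $\mathbf u|_{t=0}=\mathbf u_0$, $\mathbf w|_{t=0}=\mathbf w_0$, $\mathbf m|_{t=0}=\mathbf m_0$, boundary conditions $\mathbf u=0$, $\mathbf w=0$ on $\Gamma\times(0,t_F)$, and $\mathbf h=\nabla\varphi$ where, for each $t$, $\varphi$ solves $$-\Delta\varphi=\operatorname{div}\mathbf m\ \text{ in }\Omega,\qquad \frac{\partial\varphi}{\partial\mathbf n}=(\mathbf h_a-\mathbf m)\cdot\mathbf n\ \text{ on }\Gamma .$$ Here $((\mathbf a\cdot\nabla)\mathbf b)^j=\sum_i \mathbf a^i\partial_{x_i}\mathbf b^j$. *)

(* Defs.v *)
From HB Require Import structures.
From mathcomp Require Import all_boot all_order all_algebra.
From mathcomp Require Import all_classical all_reals all_analysis.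

Set Implicit Arguments.
Unset Strict Implicit.
Unset Printing Implicit Defensive.

Import Order.TTheory GRing.Theory Num.Theory.
Import numFieldNormedType.Exports.

Local Open Scope classical_set_scope.
Local Open Scope ring_scope.

Definition dot (R : realType) (a b : 'rV[R]_3) : R :=
  \sum_(i < 3) a 0 i * b 0 i.

(* ['I_3] is the ring Z/3, so [i + 1] and [i + 1 + 1] are the next two indices
   in cyclic order. *)
Definition cross (R : realType) (a b : 'rV[R]_3) : 'rV[R]_3 :=
  \row_(i < 3) (a 0 (i + 1) * b 0 (i + 1 + 1) - a 0 (i + 1 + 1) * b 0 (i + 1)).

(* The library norm on matrices is the sup norm, hence this one. *)
Definition enorm (R : realType) (m n : nat) (A : 'M[R]_(m, n)) : R :=
  Num.sqrt (\sum_i \sum_j A i j ^+ 2).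

(* Open convex polyhedra; such a set is convex, hence simply connected. *)
Definition convex_polyhedron (R : realType) (Om : set 'rV[R]_3) : Prop :=
  exists (N : nat) (a : 'I_N -> 'rV[R]_3) (b : 'I_N -> R),
    Om = [set x | forall i, dot (a i) x < b i].

Definition boundary (R : realType) (Om : set 'rV[R]_3) : set 'rV[R]_3 :=
  closure Om `\` interior Om.

(* Near [x] the set is the open half-space with unit outer normal [n] through
   [x]. On a polyhedron this holds exactly when [x] is in the relative interior
   of a facet; no normal exists on the edges and vertices. *)
Definition outward_unit_normal (R : realType) (Om : set 'rV[R]_3)
    (x n : 'rV[R]_3) : Prop :=
  enorm n = 1 /\ \forall y \near x, Om y <-> dot n (y - x) < 0.

Definition cylinder (R : realType) (Om : set 'rV[R]_3) (tF : R) :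
    set ('rV[R]_3 * R) :=
  [set z | Om z.1 /\ 0 < z.2 < tF].

Definition bx (R : realType) (i : 'I_3) : 'rV[R]_3 * R := (delta_mx 0 i, 0).

Definition bt (R : realType) : 'rV[R]_3 * R := (0, 1).

(* The derivative of [f] in direction [v], computed in the open set [Q] and
   extended by continuity to [closure Q]. It does not depend on the values of
   [f] outside [Q]. *)
Definition pd (R : realType) (Q : set ('rV[R]_3 * R)) (v : 'rV[R]_3 * R)
    (f : 'rV[R]_3 * R -> R) (z : 'rV[R]_3 * R) : R :=
  lim ('D_v f y @[y --> within Q (nbhs z)]).

(* [f] is in C^k(closure Q): its partial derivatives up to order [k] exist in
   the open set [Q] and extend continuously to [closure Q]. *)
Fixpoint Ck (R : realType) (Q : set ('rV[R]_3 * R)) (k : nat)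
    (f : 'rV[R]_3 * R -> R) {struct k} : Prop :=
  {within closure Q, continuous f} /\
  match k with
  | 0%N => True
  | k'.+1 => forall v, v = bt R \/ (exists i, v = bx R i) ->
      (forall z, Q z -> is_derive z v f (pd Q v f z)) /\ Ck Q k' (pd Q v f)
  end.

Definition component (R : realType) (b : 'rV[R]_3 * R -> 'rV[R]_3) (j : 'I_3)
    (z : 'rV[R]_3 * R) : R :=
  b z 0 j.

Definition vCk (R : realType) (Q : set ('rV[R]_3 * R)) (k : nat)
    (b : 'rV[R]_3 * R -> 'rV[R]_3) : Prop :=
  forall j, Ck Q k (component b j).

Definition dt (R : realType) (Q : set ('rV[R]_3 * R))
    (b : 'rV[R]_3 * R -> 'rV[R]_3) (z : 'rV[R]_3 * R) : 'rV[R]_3 :=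
  \row_j pd Q (bt R) (component b j) z.

Definition grad (R : realType) (Q : set ('rV[R]_3 * R))
    (f : 'rV[R]_3 * R -> R) (z : 'rV[R]_3 * R) : 'rV[R]_3 :=
  \row_i pd Q (bx R i) f z.

Definition vgrad (R : realType) (Q : set ('rV[R]_3 * R))
    (b : 'rV[R]_3 * R -> 'rV[R]_3) (z : 'rV[R]_3 * R) : 'M[R]_3 :=
  \matrix_(i, j) pd Q (bx R i) (component b j) z.

Definition div (R : realType) (Q : set ('rV[R]_3 * R))
    (b : 'rV[R]_3 * R -> 'rV[R]_3) (z : 'rV[R]_3 * R) : R :=
  \sum_(i < 3) pd Q (bx R i) (component b i) z.

Definition curl (R : realType) (Q : set ('rV[R]_3 * R))
    (b : 'rV[R]_3 * R -> 'rV[R]_3) (z : 'rV[R]_3 * R) : 'rV[R]_3 :=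
  \row_(i < 3) (pd Q (bx R (i + 1)) (component b (i + 1 + 1)) z
                - pd Q (bx R (i + 1 + 1)) (component b (i + 1)) z).

Definition lap (R : realType) (Q : set ('rV[R]_3 * R))
    (f : 'rV[R]_3 * R -> R) (z : 'rV[R]_3 * R) : R :=
  \sum_(i < 3) pd Q (bx R i) (pd Q (bx R i) f) z.

Definition vlap (R : realType) (Q : set ('rV[R]_3 * R))
    (b : 'rV[R]_3 * R -> 'rV[R]_3) (z : 'rV[R]_3 * R) : 'rV[R]_3 :=
  \row_j lap Q (component b j) z.

(* ((a . grad) b)^j = sum_i a^i d_i b^j *)
Definition adv (R : realType) (Q : set ('rV[R]_3 * R))
    (a b : 'rV[R]_3 * R -> 'rV[R]_3) (z : 'rV[R]_3 * R) : 'rV[R]_3 :=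
  \row_j \sum_(i < 3) a z 0 i * pd Q (bx R i) (component b j) z.

Definition row3 (R : realType) (p : R * R * R) : 'rV[R]_3 :=
  \row_(i < 3) [:: p.1.1; p.1.2; p.2]`_i.

(* The library has Lebesgue measure on [R] and products of two measures, so
   three-dimensional Lebesgue measure lives on [R * R * R]. *)
Definition vol (R : realType) :
    {measure set (measurableTypeR R * measurableTypeR R * measurableTypeR R)
     -> \bar R} :=
  ((@lebesgue_measure R \x @lebesgue_measure R) \x @lebesgue_measure R)%E.

Definition L2norm (R : realType) (Om : set 'rV[R]_3) (f : 'rV[R]_3 -> R) : R :=
  Num.sqrt (\int[vol R]_(p in @row3 R @^-1` Om) (f (row3 p)) ^+ 2).

Definition vL2norm (R : realType) (Om : set 'rV[R]_3) (m n : nat)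
    (F : 'rV[R]_3 -> 'M[R]_(m, n)) : R :=
  L2norm Om (fun x => enorm (F x)).

Definition energy (R : realType) (Om : set 'rV[R]_3) (jj mu0 : R)
    (u w m h : 'rV[R]_3 * R -> 'rV[R]_3) (s : R) : R :=
  2^-1 * (vL2norm Om (fun x => u (x, s)) ^+ 2
          + jj * vL2norm Om (fun x => w (x, s)) ^+ 2
          + mu0 * vL2norm Om (fun x => m (x, s)) ^+ 2
          + mu0 * vL2norm Om (fun x => h (x, s)) ^+ 2).

Definition dissipation (R : realType) (Om : set 'rV[R]_3)
    (Q : set ('rV[R]_3 * R)) (nu nur mu0 c1 c2 sigma kappa0 TT : R)
    (u w m h : 'rV[R]_3 * R -> 'rV[R]_3) (s : R) : R :=
  nu * vL2norm Om (fun x => vgrad Q u (x, s)) ^+ 2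
  + c1 * vL2norm Om (fun x => vgrad Q w (x, s)) ^+ 2
  + sigma * mu0 * vL2norm Om (fun x => curl Q m (x, s)) ^+ 2
  + sigma * mu0 * L2norm Om (fun x => div Q m (x, s)) ^+ 2
  + sigma * mu0 * L2norm Om (fun x => div Q h (x, s)) ^+ 2
  + c2 * L2norm Om (fun x => div Q w (x, s)) ^+ 2
  + nur * vL2norm Om (fun x => curl Q u (x, s) - 2 *: w (x, s)) ^+ 2
  + mu0 / TT * vL2norm Om (fun x => m (x, s)) ^+ 2
  + mu0 / (2 * TT) * (2^-1 + 3 * kappa0)
    * vL2norm Om (fun x => h (x, s)) ^+ 2.

Definition forcing (R : realType) (Om : set 'rV[R]_3)
    (Q : set ('rV[R]_3 * R)) (mu0 kappa0 TT : R)
    (ha : 'rV[R]_3 * R -> 'rV[R]_3) (s : R) : R :=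
  TT * mu0 * vL2norm Om (fun x => dt Q ha (x, s)) ^+ 2
  + mu0 / (2 * TT) * (1 + kappa0) * vL2norm Om (fun x => ha (x, s)) ^+ 2.

(* Main.v *)
(** Put [k = h + m - h_a]. It is divergence free and has no normal component on
    the facets, so it is orthogonal to the gradients [h] and [d_t h]. Testing the
    three evolution equations with [u], [w] and [mu0 (m - h)], and subtracting
    [mu0 k . h], whose mean is zero, from the energy density, makes the claim a
    pointwise inequality up to terms [div F] with [F . n = 0] on the facets.

    Such terms have zero mean: multiply [F] by a C^1 cutoff, which is [0] within
    distance of order [1/L] of the faces and [1] a little further inside. The
    divergence of the product integrates to zero by the fundamental theorem of
    calculus on lines parallel to an axis. The gradient of the cutoff is of order
    [L] on a strip of width [1/L] along each face, in the direction of the normal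
    of that face, where [F . n] tends to [0] on almost every line transversal to
    the face. *)
From HB Require Import structures.
Require Import Defs.
From mathcomp Require Import all_boot all_order all_algebra.
From mathcomp Require Import all_classical all_reals all_analysis.
From mathcomp Require Import measurable_realfun ring lra.
Import Order.TTheory GRing.Theory Num.Theory.
Import numFieldNormedType.Exports.
Local Open Scope classical_set_scope.
Local Open Scope ring_scope.
Set Implicit Arguments.
Unset Strict Implicit.

(** Testing with [m - h] makes the magnetic exchange cancel: the torque [m x h . w] against
    [w x m . h] pointwise, and the force [(m . grad) h . u] against [(u . grad) m . h] up to a
    mean-free term, because the gradient of [h] is symmetric. The time derivatives then leave
    [mu0 (d_t m + d_t h) . h], which the derivative of [- mu0 k . h] turns into
    [mu0 d_t h_a . h - mu0 k . d_t h]; so the elliptic problem is never differentiated in time.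
    Young's inequality for [d_t h_a . h] and [h_a . h] costs part of the [|h|^2] term, and the rest
    has the coefficient [mu0 / (2 TT) (1/2 + 3 kappa0)]. As [h] is only C^1, in the diffusion term
    every second derivative has to fall on [m]. The obstacle in the divergence theorem is that
    [F . n = 0] is known pointwise on open facets only, with no rate of decay near them and no
    normal on the edges. Hence the limit is taken by dominated convergence over lines, those that
    would hit an edge forming a null set. *)

(** * Open sets of R^3 and R^4 are measurable for the product sigma-algebra *)

Section MeasurableOpens.

(** The sigma-algebra on a product is generated by rectangles; a countable base of measurable sets
    is what makes the open sets measurable. [M] is left arbitrary, so that one statement serves all
    the products. *)
Definition measurable_basis {T : topologicalType} (M : set (set T)) :=
  exists B : nat -> set T, (forall n, M (B n)) /\
    forall U x, open U -> U x -> exists n, B n x /\ B n `<=` U.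

Lemma measurable_basisX (T1 T2 : topologicalType) (M1 : set (set T1))
    (M2 : set (set T2)) (M : set (set (T1 * T2)%type)) :
  (forall A B, M1 A -> M2 B -> M (A `*` B)) ->
  measurable_basis M1 -> measurable_basis M2 -> measurable_basis M.
Proof.
move=> MX [B1 [mB1 bB1]] [B2 [mB2 bB2]].
(* Pairs of indices are coded by one number; a number that codes no pair is given an arbitrary
   rectangle. *)
exists (fun n => if @unpickle (nat * nat)%type n is Some p
                 then B1 p.1 `*` B2 p.2 else B1 0%N `*` B2 0%N); split.
  move=> n; case: (unpickle n) => [p|].
    by apply: MX; [exact: mB1|exact: mB2].
  by apply: MX; [exact: mB1|exact: mB2].
move=> U [x y] oU Uxy; have [[V1 V2]/= [nV1 nV2] VU] := open_nbhs_nbhs (conj oU Uxy).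
have [n1 [Bx1 BV1]] := bB1 _ _ (open_interior V1) (nV1 : V1^° x).
have [n2 [Bx2 BV2]] := bB2 _ _ (open_interior V2) (nV2 : V2^° y).
exists (pickle (n1, n2)); rewrite pickleK /=; split=> //.
move=> [a b] [/= Ba Bb]; apply: VU; split => /=.
- exact: interior_subset (BV1 _ Ba).
- exact: interior_subset (BV2 _ Bb).
Qed.

Lemma measurable_basis_real (R : realType) :
  measurable_basis (fun A : set R => measurable A).
Proof.
pose I (p : rat * rat) : set R := `]ratr p.1, ratr p.2[%classic.
exists (fun n => if unpickle n is Some p then I p else set0); split.
  move=> n; case: (unpickle n) => [p|]; [exact: measurable_itv|exact: measurable0].
move=> U x oU Ux.
have /nbhs_ballP[e /= e0 eU] := open_nbhs_nbhs (conj oU Ux).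
have xe : x - e < x by rewrite ltrBlDr ltrDl.
have ex : x < x + e by rewrite ltrDl.
have [q1 q1i] := rat_in_itvoo xe.
have [q2 q2i] := rat_in_itvoo ex.
move: q1i q2i; rewrite !in_itv/= => /andP[eq1 q1x] /andP[xq2 q2e].
exists (pickle (q1, q2)); rewrite pickleK; split.
  by rewrite /I /= in_itv/= q1x xq2.
move=> y; rewrite /I /= in_itv/= => /andP[q1y yq2]; apply: eU.
rewrite /ball /= ltr_norml; apply/andP; split.
  by rewrite ltrBrDl -ltrBrDr opprK; apply: (lt_trans yq2); rewrite addrC; lra.
by rewrite ltrBlDr -ltrBlDl; apply: lt_trans q1y.
Qed.

Lemma measurable_basis_open (T : topologicalType) (M : set (set T)) :
  M set0 -> (forall F : (set T)^nat, (forall n, M (F n)) -> M (\bigcup_n F n)) ->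
  measurable_basis M -> forall U, open U -> M U.
Proof.
move=> M0 MU [B [mB bB]] U oU.
rewrite (_ : U = \bigcup_n (if `[< B n `<=` U >] then B n else set0)).
  by apply: MU => n; case: (asboolP _) => _; [exact: mB|exact: M0].
apply/seteqP; split => [x Ux|x [n _]].
  have [n [Bx BU]] := bB _ _ oU Ux; exists n => //.
  by rewrite asboolT.
by case: asboolP => // BU; exact: BU.
Qed.

Lemma measurable_basis3 (R : realType) :
  measurable_basis (fun A : set (R * R * R) => measurable A).
Proof.
apply: (measurable_basisX (M1 := fun A : set (R * R) => measurable A)).
- by move=> A B mA mB; exact (measurableX mA mB).
- apply: measurable_basisX; last exact: measurable_basis_real.
  + by move=> A B mA mB; exact (measurableX mA mB).
  + exact: measurable_basis_real.
- exact: measurable_basis_real.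
Qed.

Lemma open_measurable3 (R : realType) (U : set (R * R * R)) :
  open U -> measurable U.
Proof.
apply: (measurable_basis_open (M := fun A : set (R * R * R) => measurable A)).
- exact: measurable0.
- by move=> F mF; exact: bigcupT_measurable.
- exact: measurable_basis3.
Qed.

Lemma open_measurable4 (R : realType) (U : set (R * R * R * R)) :
  open U -> measurable U.
Proof.
apply: (measurable_basis_open (M := fun A : set (R * R * R * R) => measurable A)).
- exact: measurable0.
- by move=> F mF; exact: bigcupT_measurable.
- apply: (measurable_basisX (M1 := fun A : set (R * R * R) => measurable A)).
  + by move=> A B mA mB; exact (measurableX mA mB).
  + exact: measurable_basis3.
  + exact: measurable_basis_real.
Qed.

Lemma measurable_fun_continuous_in3 (R : realType) (D : set (R * R * R))
    (f : R * R * R -> R) :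
  measurable D -> {within D, continuous f} -> measurable_fun D f.
Proof.
move=> mD /continuousP cf; apply: (measurability _ (RGenOpens.measurableE R)).
move=> _ [_ [a [b ->] <-]].
have /open_subspaceP[V oV VD] := cf _ (@interval_open R (BRight a) (BLeft b) isT isT).
rewrite setIC -VD; apply: measurableI => //; exact: open_measurable3.
Qed.

Lemma measurable_fun_continuous_in4 (R : realType) (D : set (R * R * R * R))
    (f : R * R * R * R -> R) :
  measurable D -> {within D, continuous f} -> measurable_fun D f.
Proof.
move=> mD /continuousP cf; apply: (measurability _ (RGenOpens.measurableE R)).
move=> _ [_ [a [b ->] <-]].
have /open_subspaceP[V oV VD] := cf _ (@interval_open R (BRight a) (BLeft b) isT isT).
rewrite setIC -VD; apply: measurableI => //; exact: open_measurable4.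
Qed.

End MeasurableOpens.

(** * Directional derivatives and the symmetry of second derivatives *)

Section Derivatives.
Variables (R : realType) (V : normedModType R).
Implicit Types (f g : V -> R) (v w z : V).

(** Both sides have the same difference quotient, so one-variable calculus applies to directional
    derivatives in any normed space. *)
Lemma is_derive_lineP f v z d (r : R) :
  is_derive (r *: v + z) v f d <-> is_derive r 1 (fun r => f (r *: v + z)) d.
Proof.
have E : (fun h : R => h^-1 *: (((fun r => f (r *: v + z)) \o shift r) (h *: 1) -
    f (r *: v + z))) = (fun h => h^-1 *: ((f \o shift (r *: v + z)) (h *: v)
     - f (r *: v + z))).
  apply/funext => h /=; congr (_ *: (f _ - _)).
  by rewrite [h *: 1]mulr1 scalerDl addrA.
split=> -[df fE]; apply: DeriveDef.
- by rewrite /derivable E.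
- by rewrite /derive E.
- by rewrite /derivable -E.
- by rewrite /derive -E.
Qed.

Lemma is_derive_line f v z d (r : R) :
  is_derive (r *: v + z) v f d -> is_derive r 1 (fun r => f (r *: v + z)) d.
Proof. by move/is_derive_lineP. Qed.

Lemma is_derive_comp1 (g : R -> R) f v z d d' :
  is_derive z v f d -> is_derive (f z) 1 g d' ->
  is_derive z v (fun x => g (f x)) (d' * d).
Proof.
move=> df dg; have z0 : 0 *: v + z = z by rewrite scale0r add0r.
rewrite -[z in is_derive z]z0; apply/is_derive_lineP.
apply: is_derive1_comp; first by rewrite z0.
by apply: is_derive_line; rewrite z0.
Qed.

(** The mean value theorem is applied twice: in direction [v] to the increment of [f] along [w],
    then in direction [w] to [fv]. *)
Lemma second_difference f (fv fvw : V -> R) v w z (h : R) : 0 < h ->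
  (forall r s, 0 <= r <= h -> 0 <= s <= h ->
     is_derive (r *: v + (s *: w + z)) v f (fv (r *: v + (s *: w + z))) /\
     is_derive (r *: v + (s *: w + z)) w fv (fvw (r *: v + (s *: w + z)))) ->
  exists r s, [/\ 0 <= r <= h, 0 <= s <= h &
    f (h *: v + (h *: w + z)) - f (h *: w + z) - f (h *: v + z) + f z =
    h * h * fvw (r *: v + (s *: w + z))].
Proof.
move=> h0 H; have h0h : 0 <= h <= h by rewrite ltW/=.
have z0h : 0 <= (0:R) <= h by rewrite lexx ltW.
pose g r := f (r *: v + (h *: w + z)) - f (r *: v + (0 *: w + z)).
pose dg r := fv (r *: v + (h *: w + z)) - fv (r *: v + (0 *: w + z)).
have gd (r : R) : r \in `[0, h] -> is_derive r 1 g (dg r).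
  rewrite in_itv/= => rh; apply: is_deriveB; apply: is_derive_line.
    by have [] := H _ _ rh h0h.
  by have [] := H _ _ rh z0h.
have gc : {within `[0, h], continuous g}.
  by apply: derivable_within_continuous => x /gd[].
have goo (x : R) : x \in `]0, h[ -> is_derive x 1 g (dg x).
  by move=> xh; apply: gd; exact: subset_itv_oo_cc.
have [r rh gE] := MVT_segment (ltW h0) goo gc.
have rh' : 0 <= r <= h by rewrite in_itv/= in rh.
pose k s := fv (s *: w + (r *: v + z)).
pose dk s := fvw (s *: w + (r *: v + z)).
have kd (s : R) : s \in `[0, h] -> is_derive s 1 k (dk s).
  rewrite in_itv/= => sh; apply: is_derive_line.
  by rewrite /dk addrCA; have [] := H _ _ rh' sh.
have kc : {within `[0, h], continuous k}.
  by apply: derivable_within_continuous => x /kd[].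
have koo (x : R) : x \in `]0, h[ -> is_derive x 1 k (dk x).
  by move=> xh; apply: kd; exact: subset_itv_oo_cc.
have [s sh kE] := MVT_segment (ltW h0) koo kc.
exists r, s; split=> //.
have dgE : dg r = k h - k 0 by rewrite /dg /k !(addrCA (r *: v)).
move: gE; rewrite dgE kE /g !scale0r !add0r !subr0 /dk (addrCA (r *: v)) => gE.
rewrite [RHS]mulrC mulrA -gE.
lra.
Qed.

(** The second difference is symmetric in [v] and [w], so it equals [h * h] times a value of [fvw]
    and also [h * h] times a value of [fwv], at two points near [z]. Continuity at [z] then bounds
    the difference of the two values at [z] by any [e]. *)
Lemma schwarz f (fv fw fvw fwv : V -> R) v w z :
  (\forall y \near z, [/\ is_derive y v f (fv y), is_derive y w f (fw y),
     is_derive y w fv (fvw y) & is_derive y v fw (fwv y)]) ->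
  {for z, continuous fvw} -> {for z, continuous fwv} ->
  fvw z = fwv z.
Proof.
move=> H cvw cwv; apply/eqP; rewrite -subr_eq0 -normr_le0.
apply/ler_addgt0Pr => e e0; rewrite add0r.
have e2 : 0 < e / 2 by rewrite divr_gt0.
have /nbhs_ballP[d /= d0 dH] : \forall y \near z,
    [/\ [/\ is_derive y v f (fv y), is_derive y w f (fw y),
     is_derive y w fv (fvw y) & is_derive y v fw (fwv y)],
     `|fvw z - fvw y| < e / 2 & `|fwv z - fwv y| < e / 2].
  move: cvw cwv => /cvgrPdist_lt/(_ _ e2) cvw /cvgrPdist_lt/(_ _ e2) cwv.
  by near=> y; split; near: y.
(* With this step all the points used by [second_difference] lie within [d] of [z]; the [1] covers
   the case where [v] and [w] are both zero. *)
pose h := d / 2 / (1 + `|v| + `|w|).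
have vw0 : 0 < 1 + `|v| + `|w| by rewrite -addrA ltr_pwDl// addr_ge0.
have h0 : 0 < h by rewrite !divr_gt0.
have near_z r s : 0 <= r <= h -> 0 <= s <= h ->
    ball z d (r *: v + (s *: w + z)).
  move=> /andP[r0 rh] /andP[s0 sh]; rewrite -ball_normE /= addrA opprD addrCA subrr addr0.
  rewrite normrN (le_lt_trans (ler_normD _ _))// !normrZ !ger0_norm//.
  apply: (@le_lt_trans _ _ (h * (1 + `|v| + `|w|))); last first.
    by rewrite /h divfK ?gt_eqF// ltr_pdivrMr// ltr_pMr// ltr1n.
  rewrite !mulrDr lerD// ?ler_wpM2r// -[leLHS]add0r lerD// ?ler_wpM2r//.
  by rewrite mulr1 ltW.
have [r1 [s1 [r1h s1h E1]]] : exists r s, [/\ 0 <= r <= h, 0 <= s <= h &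
    f (h *: v + (h *: w + z)) - f (h *: w + z) - f (h *: v + z) + f z =
    h * h * fvw (r *: v + (s *: w + z))].
  apply: (second_difference (fv := fv)) => // r s rh sh.
  by have [[]] := dH _ (near_z _ _ rh sh).
have [r2 [s2 [r2h s2h E2]]] : exists r s, [/\ 0 <= r <= h, 0 <= s <= h &
    f (h *: w + (h *: v + z)) - f (h *: v + z) - f (h *: w + z) + f z =
    h * h * fwv (r *: w + (s *: v + z))].
  apply: (second_difference (fv := fw)) => // r s rh sh.
  by rewrite addrCA; have [[]] := dH _ (near_z _ _ sh rh).
have EE : fvw (r1 *: v + (s1 *: w + z)) = fwv (r2 *: w + (s2 *: v + z)).
  apply: (mulfI (x := h * h)); first by rewrite mulf_neq0// gt_eqF.
  by rewrite -E1 -E2 (addrCA (h *: v)); lra.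
have [_ A1 _] := dH _ (near_z _ _ r1h s1h).
have [_ _ A2] := dH _ (near_z _ _ s2h r2h).
rewrite addrCA -EE distrC in A2.
rewrite -[X in `|X|](subrKA (fvw (r1 *: v + (s1 *: w + z)))).
rewrite (le_trans (ler_normD _ _))//; lra.
Unshelve. all: by end_near. Qed.

End Derivatives.

(** * Continuity at a point of combinations of real functions *)

Section ContinuityOfRealFunctions.
Variables (R : realType) (T : topologicalType).
Implicit Types (f g : T -> R) (x : T).

Lemma cont_cst (c : R) x : continuous_at x (fun=> c : R).
Proof. exact: cvg_cst. Qed.

Lemma cont_add f g x : continuous_at x f -> continuous_at x g ->
  continuous_at x (fun y => f y + g y).
Proof. by move=> cf cg; exact: cvgD. Qed.

Lemma cont_opp f x : continuous_at x f -> continuous_at x (fun y => - f y).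
Proof. by move=> cf; exact: cvgN. Qed.

Lemma cont_mul f g x : continuous_at x f -> continuous_at x g ->
  continuous_at x (fun y => f y * g y).
Proof. by move=> cf cg; exact: cvgM. Qed.

Lemma cont_sum n (f : 'I_n -> T -> R) x : (forall i, continuous_at x (f i)) ->
  continuous_at x (fun y => \sum_i f i y).
Proof.
move=> cf; rewrite /continuous_at.
by apply: cvg_big => [|i _]; [exact: add_continuous|exact: cf].
Qed.

Lemma cont_comp f (g : R -> R) x : continuous_at x f -> continuous_at (f x) g ->
  continuous_at x (fun y => g (f y)).
Proof. by move=> cf cg; exact: (continuous_comp cf cg). Qed.

Lemma cont_near_eq f g x : (\forall y \near x, f y = g y) ->
  continuous_at x f -> continuous_at x g.
Proof.
move=> fg; rewrite /continuous_at -(nbhs_singleton fg).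
by apply: cvg_trans; exact: near_eq_cvg.
Qed.

End ContinuityOfRealFunctions.

(** * A C^1 cutoff adapted to a polyhedron *)

Section PositivePart.
Variable R : realType.
Implicit Types x : R.

Definition pos x : R := (x + `|x|) / 2.

Lemma pos_ge0 x : 0 <= pos x.
Proof. by rewrite /pos; have := ler_norm (- x); rewrite normrN; lra. Qed.

Lemma pos_id x : 0 <= x -> pos x = x.
Proof. by move=> x0; rewrite /pos ger0_norm//; lra. Qed.

Lemma pos_eq0 x : x <= 0 -> pos x = 0.
Proof. by move=> x0; rewrite /pos ler0_norm//; lra. Qed.

Lemma pos_le x y : 0 <= y -> x <= y -> pos x <= y.
Proof.
by move=> y0 xy; case: (leP 0 x) => [/pos_id ->//|/ltW/pos_eq0 ->].
Qed.

Lemma continuous_pos : continuous pos.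
Proof.
move=> x; apply: cont_mul; last exact: cont_cst.
by apply: cont_add; [exact: cvg_id|exact: norm_continuous].
Qed.

(** Squaring removes the corner of the positive part at [0]; the cutoff is built from such squares
    and is C^1 for this reason. *)
Lemma is_derive_pos_sqr x : is_derive x 1 (fun y => pos y ^+ 2) (2 * pos x).
Proof.
have [x0|x0|->] := ltgtP x 0.
- apply: (@near_eq_is_derive _ _ _ (cst 0)); last first.
    by rewrite pos_eq0 ?ltW// mulr0; exact: is_derive_cst.
  near=> y; rewrite /cst pos_eq0 ?expr0n//; near: y.
  by apply: (cvgr_le x) => //; exact: cvg_id.
- apply: (near_eq_is_derive (f := (id : R -> R) * id)); last first.
    have := is_deriveM (is_derive_id x 1) (is_derive_id x 1).
    by rewrite pos_id ?ltW// mulr_natl [x *: 1]mulr1.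
  near=> y; rewrite pos_id ?expr2//; near: y.
  by apply: (cvgr_ge x) => //; exact: cvg_id.
(* At [0] the difference quotient of the square equals [pos h], which tends to [0]. *)
- have cv : (fun h : R => h^-1 *: (((fun y => pos y ^+ 2) \o shift 0) (h *: 1)
      - pos 0 ^+ 2)) @ 0^' --> (0 : R).
    have : pos x @[x --> (0 : R)^'] --> (0 : R).
      apply: (@cvg_within_filter _ _ _ (nbhs (0:R))).
      by have := @continuous_pos 0; rewrite /continuous_at (pos_eq0 (lexx 0)).
    apply: cvg_trans; apply: near_eq_cvg.
    near=> h; rewrite /= addr0 [h *: 1]mulr1 (pos_eq0 (lexx 0)) expr0n subr0.
    have h0 : h != 0 by near: h; exact: nbhs_dnbhs_neq.
    rewrite /GRing.scale /=.
    have [hp|hn] := leP 0 h; first by rewrite pos_id// expr2 mulrA mulVf// mul1r.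
    by rewrite pos_eq0 ?ltW// expr0n mulr0.
  rewrite (pos_eq0 (lexx 0)) mulr0; apply: DeriveDef.
    by apply/cvg_ex; exists 0.
  exact: cvg_lim cv.
Unshelve. all: by end_near. Qed.

End PositivePart.

Section Cutoff.
Variables (R : realType) (N : nat) (a : 'I_N -> 'rV[R]_3) (b : 'I_N -> R).
Implicit Types (x v : 'rV[R]_3) (L : R).

Lemma dotD (c : 'rV[R]_3) x y : dot c (x + y) = dot c x + dot c y.
Proof.
by rewrite /dot -big_split; apply: eq_bigr => i _; rewrite mxE mulrDr.
Qed.

Lemma dotZ (c : 'rV[R]_3) (l : R) x : dot c (l *: x) = l * dot c x.
Proof.
by rewrite /dot mulr_sumr; apply: eq_bigr => i _; rewrite mxE mulrCA.
Qed.

Lemma dot_delta (c : 'rV[R]_3) k : dot c (delta_mx 0 k) = c 0 k.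
Proof.
rewrite /dot (bigD1 k)//= big1 ?addr0 => [|i ik]; rewrite mxE eqxx/=.
  by rewrite eqxx mulr1.
by rewrite (negbTE ik) mulr0.
Qed.

Lemma continuous_dot (c : 'rV[R]_3) : continuous (dot c).
Proof.
move=> x; apply: cont_sum => i.
by apply: cont_mul; [exact: cont_cst|exact: coord_continuous].
Qed.

Lemma is_derive_dot (c : 'rV[R]_3) x v : is_derive x v (dot c) (dot c v).
Proof.
have cv : (fun h : R => h^-1 *: ((dot c \o shift x) (h *: v) - dot c x)) @ 0^'
    --> dot c v.
  apply: cvg_near_cst; near=> h; rewrite /= dotD addrK dotZ.
  rewrite /GRing.scale/= mulrA mulVf ?mul1r//; near: h; exact: nbhs_dnbhs_neq.
apply: DeriveDef; first by apply/cvg_ex; exists (dot c v).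
exact: cvg_lim cv.
Unshelve. all: by end_near. Qed.

(** When [a i] is nonzero, this is the signed distance to the plane of face [i], positive inside,
    times the length of [a i], which is not normalized. *)
Definition slack i x : R := b i - dot (a i) x.

Lemma continuous_slack i : continuous (slack i).
Proof.
move=> x; apply: cont_add; first exact: cont_cst.
by apply: cont_opp; exact: continuous_dot.
Qed.

Definition excess L i x : R := pos (2 - L * slack i x).

Definition height L x : R := pos (1 - \sum_i excess L i x ^+ 2).

(** It is [0] once some [L * slack] is at most [1], and [1] where they are all at least [2]. Adding
    squares of positive parts, rather than taking a minimum over the faces, keeps it C^1 and makes
    its gradient a sum with one term per face, in the direction of [a i]. *)
Definition cutoff L x : R := height L x ^+ 2.

Definition dcutoff L v x : R :=
  - (2 * height L x * \sum_i 2 * excess L i x * (L * dot (a i) v)).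

Lemma is_derive_excess L i x v :
  is_derive x v (fun y => excess L i y ^+ 2)
    (2 * excess L i x * (L * dot (a i) v)).
Proof.
apply: (is_derive_comp1 (f := fun y => 2 - L * slack i y)
  (g := fun r => pos r ^+ 2)); last exact: is_derive_pos_sqr.
have -> : (fun y => 2 - L * slack i y) = (cst (2 - L * b i) + L *: dot (a i)).
  by apply/funext => y; rewrite /slack /= !fctE /GRing.scale /=; lra.
have H := is_derive_dot (a i) x v.
have H2 : is_derive x v (L *: dot (a i)) (L *: dot (a i) v) by apply: is_deriveZ.
have := is_deriveD (is_derive_cst (2 - L * b i) x v) H2.
by rewrite add0r.
Qed.

Lemma is_derive_cutoff L x v : is_derive x v (cutoff L) (dcutoff L v x).
Proof.
have H : is_derive x v (fun y => 1 - \sum_i excess L i y ^+ 2)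
   (- \sum_i 2 * excess L i x * (L * dot (a i) v)).
  have -> : (fun y => 1 - \sum_i excess L i y ^+ 2) =
     cst 1 - \sum_i (fun y => excess L i y ^+ 2).
    by apply/funext => y; rewrite !fctE fct_sumE.
  have := @is_derive_sum _ _ _ _ (fun i y => excess L i y ^+ 2) x v _
     (fun i => is_derive_excess L i x v).
  by move=> ?; apply: is_derive_eq; rewrite sub0r.
have := is_derive_comp1 (g := fun r => pos r ^+ 2) H (is_derive_pos_sqr _).
by rewrite /dcutoff -mulrN; exact.
Qed.

Lemma continuous_excess L i : continuous (excess L i).
Proof.
move=> x; apply: (cont_comp (g := @pos R)); last exact: continuous_pos.
apply: cont_add; [exact: cont_cst|apply: cont_opp].
by apply: cont_mul; [exact: cont_cst|exact: continuous_slack].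
Qed.

Lemma continuous_height L : continuous (height L).
Proof.
move=> x; apply: (cont_comp (g := @pos R)); last exact: continuous_pos.
apply: cont_add; [exact: cont_cst|apply: cont_opp].
by apply: cont_sum => i; apply: cont_mul; exact: continuous_excess.
Qed.

Lemma continuous_cutoff L : continuous (cutoff L).
Proof.
by move=> x; apply: cont_mul; exact: continuous_height.
Qed.

Lemma continuous_dcutoff L v : continuous (dcutoff L v).
Proof.
move=> x; apply: cont_opp; apply: cont_mul.
  by apply: cont_mul; [exact: cont_cst|exact: continuous_height].
apply: cont_sum => i; apply: cont_mul; last exact: cont_cst.
by apply: cont_mul; [exact: cont_cst|exact: continuous_excess].
Qed.

Lemma height_ge0 L x : 0 <= height L x. Proof. exact: pos_ge0. Qed.

Lemma height_le1 L x : height L x <= 1.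
Proof.
apply: pos_le => //; rewrite lerBlDr lerDl sumr_ge0// => i _.
exact: sqr_ge0.
Qed.

Lemma height_eq0 L i x : L * slack i x <= 1 -> height L x = 0.
Proof.
move=> sx; apply: pos_eq0; rewrite subr_le0 (bigD1 i)//= -[leLHS]addr0 lerD//.
  by rewrite /excess pos_id ?expr_ge1//; lra.
by apply: sumr_ge0 => j _; exact: sqr_ge0.
Qed.

Lemma height_eq1 L x : (forall i, 2 <= L * slack i x) -> height L x = 1.
Proof.
move=> sx; rewrite /height big1 ?subr0 ?pos_id// => i _.
by rewrite /excess pos_eq0 ?expr0n// subr_le0.
Qed.

Definition polyhedron : set 'rV[R]_3 := [set x | forall i, dot (a i) x < b i].

Lemma polyhedronE x : polyhedron x <-> forall i, 0 < slack i x.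
Proof. by split => H i; have := H i; rewrite /slack subr_gt0. Qed.

Lemma open_polyhedron : open polyhedron.
Proof.
rewrite openE => x /polyhedronE Ox; rewrite /interior.
have : \forall y \near x, forall i, 0 < slack i y.
  apply: (@filter_forall _ _ (fun i y => 0 < slack i y) (nbhs x)) => i.
  by have /cvgr_gt := @continuous_slack i x; exact.
by apply: filterS => y Hy; apply/polyhedronE.
Qed.

Section CutoffProduct.
Variables (L : R) (v : 'rV[R]_3) (F G : 'rV[R]_3 -> R).
Hypothesis L0 : 0 < L.
Hypothesis dF : forall x, polyhedron x -> is_derive x v F (G x).
Hypothesis cF : forall x, polyhedron x -> {for x, continuous F}.
Hypothesis cG : forall x, polyhedron x -> {for x, continuous G}.

(** [F] is controlled inside the polyhedron only. The cutoff vanishes around every point outside it,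
    boundary points included, so the extension by zero is differentiable along [v] everywhere, with
    a continuous derivative. *)
Definition cutF x : R := if `[< polyhedron x >] then cutoff L x * F x else 0.
Definition dcutF x : R := if `[< polyhedron x >]
  then cutoff L x * G x + dcutoff L v x * F x else 0.

(** Some slack is nonpositive at [x], hence below [L^-1] on a whole neighborhood, which forces
    [height] to vanish there. *)
Lemma near_notin_polyhedron x : ~ polyhedron x ->
  \forall y \near x, height L y = 0.
Proof.
move=> /polyhedronE/existsNP[i /negP]; rewrite -leNgt => si.
have : \forall y \near x, slack i y < L^-1.
  have /cvgr_lt := @continuous_slack i x; apply.
  by apply: (le_lt_trans si); rewrite invr_gt0.
apply: filterS => y sy; apply: (@height_eq0 _ i).
by rewrite mulrC -ler_pdivlMr// mul1r ltW.
Qed.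

Lemma near_cutF0 x : ~ polyhedron x -> \forall y \near x, cutF y = 0.
Proof.
move=> /near_notin_polyhedron; apply: filterS => y h0.
by rewrite /cutF /cutoff h0; case: ifP => // _; rewrite expr0n mul0r.
Qed.

Lemma near_dcutF0 x : ~ polyhedron x -> \forall y \near x, dcutF y = 0.
Proof.
move=> /near_notin_polyhedron; apply: filterS => y h0.
rewrite /dcutF /cutoff /dcutoff h0; case: ifP => // _.
by rewrite expr0n mul0r mulr0 mul0r oppr0 mul0r addr0.
Qed.

Lemma near_in_polyhedron x : polyhedron x -> \forall y \near x, polyhedron y.
Proof. by move=> Px; apply: open_nbhs_nbhs; split => //; exact: open_polyhedron. Qed.

Lemma is_derive_cutF x : is_derive x v cutF (dcutF x).
Proof.
have [Px|nPx] := pselect (polyhedron x).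
  apply: (@near_eq_is_derive _ _ _ (cutoff L * F)).
    apply: filterS (near_in_polyhedron Px) => y Py.
    by rewrite /cutF asboolT.
  have H1 := is_derive_cutoff L x v; have H2 := dF Px.
  apply: is_derive_eq; rewrite /dcutF asboolT// /GRing.scale /=; lra.
apply: (@near_eq_is_derive _ _ _ (cst 0)).
  by apply: filterS (near_cutF0 nPx) => y ->.
by rewrite /dcutF asboolF//; exact: is_derive_cst.
Qed.

Lemma continuous_dcutF : continuous dcutF.
Proof.
move=> x; have [Px|nPx] := pselect (polyhedron x).
  apply: (@cont_near_eq _ _ (fun y => cutoff L y * G y + dcutoff L v y * F y)).
    apply: filterS (near_in_polyhedron Px) => y Py.
    by rewrite /dcutF asboolT.
  apply: cont_add; apply: cont_mul.
  - exact: continuous_cutoff.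
  - exact: cG.
  - exact: continuous_dcutoff.
  - exact: cF.
apply: (@cont_near_eq _ _ (fun=> 0)); last exact: cont_cst.
by apply: filterS (near_dcutF0 nPx) => y ->.
Qed.

End CutoffProduct.
End Cutoff.

(** * Integration along lines parallel to the axes *)

Section Coordinates.
Variable R : realType.
Local Notation mR := (measurableTypeR R).

Lemma continuous_row (T : topologicalType) (f : T -> 'rV[R]_3) (x : T) :
  (forall i, continuous_at x (fun y => f y 0 i)) -> continuous_at x f.
Proof.
move=> cf; apply/cvg_ballP => e e0.
have : \forall y \near x, forall i, ball (f x 0 i) e (f y 0 i).
  apply: (@filter_forall _ _ (fun i y => ball (f x 0 i) e (f y 0 i)) (nbhs x)) => i.
  by have /cvg_ballP := cf i; exact.
by apply: filterS => y Hy; split => // i j; rewrite ord1.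
Qed.

Lemma continuous_row3 : continuous (@row3 R).
Proof.
move=> p; apply: continuous_row => i.
have -> : (fun y : R * R * R => row3 y 0 i) =
    (fun y => [:: y.1.1; y.1.2; y.2]`_i) by apply/funext => y; rewrite mxE.
case: i => [[|[|[|//]]] ?] /=.
- by apply: (cvg_comp fst fst); exact: cvg_fst.
- by apply: (cvg_comp fst snd); [exact: cvg_fst|exact: cvg_snd].
- exact: cvg_snd.
Qed.

Lemma bounded_polyhedron_coord (Om : set 'rV[R]_3) : bounded_set Om ->
  exists2 M : R, 0 < M & forall x, Om x -> forall i, `|x 0 i| < M.
Proof.
case=> B [Br BO]; exists (`|B| + 2) => [|x Ox i]; first by rewrite ltr_pwDr.
have H : `|x| <= `|B| + 1.
  by apply: BO Ox; rewrite (le_lt_trans (ler_norm B))// ltrDl.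
have : ball (0 : 'rV[R]_3) (`|B| + 2) x.
  rewrite mx_norm_ball /ball_ /= sub0r normrN; apply: (le_lt_trans H).
  by rewrite ltrD2l ltr1n.
by case=> _ /(_ 0 i); rewrite /ball /= mxE sub0r normrN.
Qed.

(** The variable along the line is separated from the other two coordinates, taken in cyclic order,
    so that the three axes share one argument. *)
Definition insert (k : 'I_3) (x : R) (p : R * R) : 'rV[R]_3 :=
  \row_i (if i == k then x else if i == k + 1 then p.1 else p.2).

Lemma insert_line k x p : insert k x p = x *: delta_mx 0 k + insert k 0 p.
Proof.
apply/rowP => i; rewrite !mxE eqxx /=; case: eqVneq => _.
  by rewrite mulr1 addr0.
by rewrite mulr0 add0r.
Qed.

Lemma continuous_insert k p : continuous (fun x => insert k x p).
Proof.
move=> x; apply: continuous_row => i.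
have -> : (fun y : R => insert k y p 0 i) = (fun y => if i == k then y else insert k 0 p 0 i).
  by apply/funext => y; rewrite !mxE; case: eqP.
by case: eqP => _; [exact: cvg_id|exact: cont_cst].
Qed.

(** The permutation through which [insert k] factors over [row3]; it carries measurability over to
    the slices. *)
Definition unrow3 (k : 'I_3) (q : R * R * R) : R * R * R :=
  match val k with
  | 0%N => (q.2, q.1.1, q.1.2)
  | 1%N => (q.1.2, q.2, q.1.1)
  | _ => q
  end.

Lemma insertE k x p : insert k x p = row3 (unrow3 k (p, x)).
Proof.
by apply/rowP => i; rewrite !mxE; case: p => y z; case: k => [[|[|[|//]]] ?];
  case: i => [[|[|[|//]]] ?].
Qed.

Lemma measurable_unrow3 k : measurable_fun [set: (mR * mR * mR)%type] (unrow3 k : _ -> (mR * mR * mR)%type).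
Proof.
have m11 : measurable_fun [set: (mR * mR * mR)%type] (fun q => q.1.1).
  by apply: measurableT_comp; exact: measurable_fst.
have m12 : measurable_fun [set: (mR * mR * mR)%type] (fun q => q.1.2).
  by apply: measurableT_comp; [exact: measurable_snd|exact: measurable_fst].
have m2 : measurable_fun [set: (mR * mR * mR)%type] (fun q => q.2) by exact: measurable_snd.
by case: k => [[|[|[|//]]] ?]; rewrite /unrow3 /=;
  [apply: measurable_fun_pair => //; exact: measurable_fun_pair
  |apply: measurable_fun_pair => //; exact: measurable_fun_pair
  |exact: measurable_id].
Qed.

End Coordinates.

Section Slicing.
Variable R : realType.
Local Notation la := (@lebesgue_measure R).
Local Notation mR := (measurableTypeR R).

(* The library equips [la \x la] with no canonical sigma-finite structure,
   because its instance for products of probability measures takes precedence. *)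
Definition area : set (mR * mR)%type -> \bar R := (la \x la)%E.

HB.instance Definition _ := Measure.on area.

Lemma sigma_finite_area : sigma_finite setT area.
Proof.
have /sigma_finiteP[F [TF ndF Foo]] := sigma_finiteT la.
exists (fun n => F n `*` F n).
  rewrite -setXTT TF predeqE => -[x y]; split.
    move=> [/= [n _ Fnx] [k _ Gky]]; exists (maxn n k) => //; split.
    - by move: x Fnx; exact/subsetPset/ndF/leq_maxl.
    - by move: y Gky; exact/subsetPset/ndF/leq_maxr.
  by move=> [n _ []/= ? ?]; split; exists n.
move=> k; have [? ?] := Foo k.
split; first exact: measurableX.
by rewrite /area product_measure1E// lte_mul_pinfty// ge0_fin_numE.
Qed.

HB.instance Definition _ :=
  Measure_isSigmaFinite.Build _ _ _ area sigma_finite_area.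

Local Open Scope ereal_scope.

Lemma measurable_insert (f : 'rV[R]_3 -> \bar R) k :
  measurable_fun [set: (mR * mR * mR)%type] (fun q => f (row3 q)) ->
  measurable_fun [set: (mR * mR * mR)%type] (fun q => f (insert k q.2 q.1)).
Proof.
move=> mf.
rewrite (_ : (fun q => _) = (fun q => f (row3 q)) \o unrow3 k).
  by apply: measurableT_comp => //; exact: measurable_unrow3.
by apply/funext => -[p x] /=; rewrite insertE.
Qed.

Lemma measurable_slice (f : 'rV[R]_3 -> \bar R) k :
  measurable_fun [set: (mR * mR * mR)%type] (fun q => f (row3 q)) -> (forall x, 0 <= f x) ->
  measurable_fun [set: (mR * mR)%type] (fun p => \int[la]_x f (insert k x p)).
Proof.
move=> mf f0.
exact: (measurable_fun_fubini_tonelli_F (m2 := la)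
  (fun q : R * R * R => f (insert k q.2 q.1)) (measurable_insert k mf)).
Qed.

Lemma measurable_slice1 (f : 'rV[R]_3 -> \bar R) k (p : R * R) :
  measurable_fun [set: (mR * mR * mR)%type] (fun q => f (row3 q)) ->
  measurable_fun [set: mR] (fun x => f (insert k x p)).
Proof.
move=> /(measurable_insert k) mf.
rewrite (_ : (fun x => _) = (fun q : mR * mR * mR => f (insert k q.2 q.1)) \o (pair p)).
  apply: measurableT_comp => //; exact: pair1_measurable.
by apply/funext.
Qed.

(** [vol] splits off the third coordinate, which is the wanted splitting for [k = 2]. For the other
    two axes both sides are expanded, in an order suited to [k], into the same threefold iterated
    integral. *)
Lemma slice_tonelli (f : 'rV[R]_3 -> \bar R) k :
  measurable_fun [set: (mR * mR * mR)%type] (fun q => f (row3 q)) -> (forall x, 0 <= f x) ->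
  \int[vol R]_q f (row3 q) = \int[area]_p \int[la]_x f (insert k x p).
Proof.
move=> mf f0; have mH := measurable_slice k mf f0.
have H0 p : 0 <= \int[la]_x f (insert k x p) by exact: integral_ge0.
have mx (z : R) : measurable_fun [set: (mR * mR)%type] (fun q => f (row3 (q, z))).
  rewrite (_ : (fun q => _) = (fun q => f (row3 q)) \o (fun q => (q, z))).
    by apply: measurableT_comp => //; exact: pair2_measurable.
  by apply/funext.
have f0' (q : R * R * R) : 0 <= f (row3 q) by exact: f0.
have V2 : \int[vol R]_q f (row3 q) = \int[la]_z \int[area]_q f (row3 (q, z)).
  exact (fubini_tonelli2 (m1 := area) (m2 := la)
    (fun q : R * R * R => f (row3 q)) mf f0').
have V1 : \int[vol R]_q f (row3 q) = \int[area]_q \int[la]_z f (row3 (q, z)).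
  exact (fubini_tonelli1 (m1 := area) (m2 := la)
    (fun q : R * R * R => f (row3 q)) mf f0').
have H1 : \int[area]_p \int[la]_x f (insert k x p) =
    \int[la]_y \int[la]_z \int[la]_x f (insert k x (y, z)).
  exact (fubini_tonelli1 (m1 := la) (m2 := la)
    (fun p : R * R => \int[la]_x f (insert k x p)) mH H0).
have H2 : \int[area]_p \int[la]_x f (insert k x p) =
    \int[la]_z \int[la]_y \int[la]_x f (insert k x (y, z)).
  exact (fubini_tonelli2 (m1 := la) (m2 := la)
    (fun p : R * R => \int[la]_x f (insert k x p)) mH H0).
have I1 z : \int[area]_q f (row3 (q, z)) = \int[la]_x \int[la]_y f (row3 (x, y, z)).
  exact (fubini_tonelli1 (m1 := la) (m2 := la)
    (fun q : R * R => f (row3 (q, z))) (mx z) (fun q => f0 _)).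
have I2 z : \int[area]_q f (row3 (q, z)) = \int[la]_y \int[la]_x f (row3 (x, y, z)).
  exact (fubini_tonelli2 (m1 := la) (m2 := la)
    (fun q : R * R => f (row3 (q, z))) (mx z) (fun q => f0 _)).
case: k mH H0 H1 H2 => [[|[|[|//]]] i] mH H0 H1 H2.
- rewrite V2 H2; apply: eq_integral => z _; rewrite I2; apply: eq_integral => y _.
  by apply: eq_integral => x _; rewrite insertE.
- rewrite V2 H1; apply: eq_integral => y _; rewrite I1; apply: eq_integral => z _.
  by apply: eq_integral => x _; rewrite insertE.
- rewrite V1; apply: eq_integral => p _.
  by apply: eq_integral => x _; rewrite insertE.
Qed.

(** The fundamental theorem of calculus on [[-M, M]] gives integral zero. The conclusion separates
    the positive and the negative part so that it can be integrated over all lines by Tonelli. *)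
Lemma integral_derivative_pos_neg (phi Phi : R -> R) (M : R) : (0 < M)%R ->
  continuous phi -> (forall x, is_derive x (1 : R)%R Phi (phi x)) ->
  (forall x, (M <= `|x|)%R -> phi x = 0%R /\ Phi x = 0%R) ->
  \int[la]_x (EFin \o phi)^\+ x = \int[la]_x (EFin \o phi)^\- x.
Proof.
move=> M0 cphi dPhi supp.
have cut (f : R -> \bar R) : (forall x, (M <= `|x|)%R -> f x = 0) ->
    \int[la]_x f x = \int[la]_(x in `[(- M)%R, M]) f x.
  move=> f0; rewrite [RHS]integral_mkcond; apply: eq_integral => x _.
  rewrite patchE; case: ifPn => // /negP; rewrite inE/= in_itv/= => Mx.
  apply: f0; rewrite leNgt; apply/negP => xM; apply: Mx.
  by move: xM; rewrite ltr_norml => /andP[/ltW-> /ltW->].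
have NMM : (- M < M)%R by rewrite gt0_cp.
have ci : la.-integrable `[(- M)%R, M] (EFin \o phi).
  apply: continuous_compact_integrable; first exact: segment_compact.
  exact: continuous_subspaceT.
have I0 : \int[la]_(x in `[(- M)%R, M]) (EFin \o phi) x = 0.
  rewrite (@continuous_FTC2 R phi Phi)//.
  - by have [_ ->] := supp M (ler_norm _);
      have [|_ ->] := supp (- M)%R; rewrite ?normrN ?ler_norm// sube0.
  - exact: continuous_subspaceT.
  - have cP : continuous Phi.
      move=> x; apply: differentiable_continuous; apply/derivable1_diffP.
      by case: (dPhi x).
    by split => [x _| |]; [case: (dPhi x)|apply: cvg_at_right_filter; exact: cP|
      apply: cvg_at_left_filter; exact: cP].
  - by move=> x _; rewrite derive1E; case: (dPhi x).
rewrite integralE in I0.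
have mI : measurable (`[(- M)%R, M]%classic : set mR) by exact: measurable_itv.
have Ip := integrable_pos_fin_num mI ci.
have In := integrable_neg_fin_num mI ci.
rewrite !cut.
- by move: I0 => /eqP; rewrite sube_eq// ?add0e ?fin_num_adde_defl// => /eqP.
- by move=> x /supp[px _]; rewrite funenegE /= px oppr0 maxxx.
- by move=> x /supp[px _]; rewrite funeposE /= px maxxx.
Qed.

Lemma Rintegral_slices0 (g : 'rV[R]_3 -> R) k :
  measurable_fun [set: (mR * mR * mR)%type] (fun q => g (row3 q)) ->
  (forall p, \int[la]_x (EFin \o (fun x => g (insert k x p)))^\+ x
           = \int[la]_x (EFin \o (fun x => g (insert k x p)))^\- x) ->
  (\int[vol R]_q g (row3 q) = 0)%R.
Proof.
move=> mg H; rewrite /Rintegral integralE.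
have mge : measurable_fun [set: (mR * mR * mR)%type] (fun q => (g (row3 q))%:E).
  exact/measurable_EFinP.
have pE q : (EFin \o g)^\+ (row3 q) = (fun q => (g (row3 q))%:E)^\+ q.
  by rewrite !funeposE.
have nE q : (EFin \o g)^\- (row3 q) = (fun q => (g (row3 q))%:E)^\- q.
  by rewrite !funenegE.
have mp : measurable_fun [set: (mR * mR * mR)%type] (fun q => (EFin \o g)^\+ (row3 q)).
  by rewrite (funext pE); exact: measurable_funepos.
have mn : measurable_fun [set: (mR * mR * mR)%type] (fun q => (EFin \o g)^\- (row3 q)).
  by rewrite (funext nE); exact: measurable_funeneg.
have E : \int[area]_p \int[la]_x (EFin \o g)^\+ (insert k x p) =
         \int[area]_p \int[la]_x (EFin \o g)^\- (insert k x p).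
  apply: eq_integral => p _.
  transitivity (\int[la]_x (EFin \o (fun x => g (insert k x p)))^\+ x).
    by apply: eq_integral => x _; rewrite !funeposE.
  by rewrite H; apply: eq_integral => x _; rewrite !funenegE.
have := slice_tonelli k mp (funepos_ge0 _); have := slice_tonelli k mn (funeneg_ge0 _).
rewrite (funext pE) (funext nE) E => -> ->.
(* If the common value of both parts is infinite, their difference is still infinite and [fine]
   sends it to [0]. *)
by case: (\int[area]_q _) => [r| |] //=; rewrite subrr.
Qed.

End Slicing.

(** * Derivatives of cut off functions integrate to zero *)

Section CutoffDivergence.
Variables (R : realType) (N : nat) (a : 'I_N -> 'rV[R]_3) (b : 'I_N -> R).
Let Om := polyhedron a b.
Hypothesis bO : bounded_set Om.

Lemma measurable_row3_continuous (g : 'rV[R]_3 -> R) : continuous g ->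
  measurable_fun [set: (measurableTypeR R * measurableTypeR R * measurableTypeR R)%type]
    (fun q => g (row3 q)).
Proof.
move=> cg; apply: (@measurable_fun_continuous_in3 R setT (fun q => g (row3 q))) => //.
apply: continuous_subspaceT => p; apply: continuous_comp; last exact: cg.
exact: continuous_row3.
Qed.

(** On each line parallel to axis [k] the integrand is the derivative of a function that vanishes
    outside [[-M, M]], where [M] bounds the coordinates on [Om]. *)
Lemma integral_dcutF (L : R) k (F G : 'rV[R]_3 -> R) : 0 < L ->
  (forall x, Om x -> is_derive x (delta_mx 0 k) F (G x)) ->
  (forall x, Om x -> {for x, continuous F}) ->
  (forall x, Om x -> {for x, continuous G}) ->
  \int[vol R]_q dcutF a b L (delta_mx 0 k) F G (row3 q) = 0.
Proof.
move=> L0 dF cF cG; have [M M0 OM] := bounded_polyhedron_coord bO.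
have cd := continuous_dcutF (v := delta_mx 0 k) L0 cF cG.
apply: (Rintegral_slices0 (k := k)); first exact: measurable_row3_continuous.
move=> p; apply: (integral_derivative_pos_neg
   (Phi := fun x => cutF a b L F (insert k x p)) M0).
- by move=> x; exact: (continuous_comp (@continuous_insert R k p x) (cd _)).
- move=> x; rewrite (_ : (fun x => _) =
    (fun x => cutF a b L F (x *: delta_mx 0 k + insert k 0 p))); last first.
    by apply/funext => y; rewrite insert_line.
  by rewrite [in dcutF _ _ _ _ _ _ _](insert_line k x p); apply: is_derive_line; exact: is_derive_cutF.
- move=> x Mx; have nO : ~ Om (insert k x p).
    by move=> /OM/(_ k); rewrite mxE eqxx ltNge Mx.
  by rewrite /dcutF /cutF asboolF.
Qed.

End CutoffDivergence.

(** * Boundedness and integrability on a bounded polyhedron *)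

Section BoundedPolyhedron.
Variables (R : realType) (N : nat) (a : 'I_N -> 'rV[R]_3) (b : 'I_N -> R).
Local Notation mR := (measurableTypeR R).
Local Notation la := (@lebesgue_measure R).
Let Om := polyhedron a b.
Hypothesis bO : bounded_set Om.

Lemma compact_closure_bounded (A : set 'rV[R]_3) : bounded_set A -> compact (closure A).
Proof.
case=> B [Br BA]; apply: bounded_closed_compact; last exact: closed_closure.
exists (`|B| + 2); split; first exact: num_real.
move=> x Bx y Ay; apply: le_trans (ltW Bx).
have [z [Az yz]] := Ay _ (nbhsx_ballx y 1 ltr01).
have z1 : `|z| <= `|B| + 1.
  by apply: BA Az; rewrite (le_lt_trans (ler_norm B))// ltrDl.
have yz1 : `|y - z| < 1 by move: yz; rewrite mx_norm_ball.
by rewrite -(subrK z y) (le_trans (ler_normD _ _))//; lra.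
Qed.

Lemma bounded_on_closure (f : 'rV[R]_3 -> R) : {within closure Om, continuous f} ->
  exists C, forall x, closure Om x -> `|f x| <= C.
Proof.
move=> cf; have := continuous_compact cf (compact_closure_bounded bO).
move=> /compact_bounded[C [Cr CK]]; exists (`|C| + 1) => x Ox.
apply: CK; first by rewrite (le_lt_trans (ler_norm C))// ltrDl.
by exists x.
Qed.

Lemma continuous_closure_in (f : 'rV[R]_3 -> R) : {within closure Om, continuous f} ->
  forall x, Om x -> {for x, continuous f}.
Proof.
move=> cf; have cO : {within Om, continuous f}.
  by apply: continuous_subspaceW cf; exact: subset_closure.
have := cO; rewrite continuous_open_subspace; last exact: open_polyhedron.
by move=> H x Ox; apply: H; rewrite inE.
Qed.

Lemma open_row3 (U : set 'rV[R]_3) : open U -> open (@row3 R @^-1` U).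
Proof.
by move=> oU; apply: open_comp => // x _; exact: continuous_row3.
Qed.

Lemma measurable_row3_open (U : set 'rV[R]_3) : open U ->
  measurable (@row3 R @^-1` U : set (mR * mR * mR)%type).
Proof. by move=> oU; exact: (open_measurable3 (open_row3 oU)). Qed.

Lemma measurable_fun_row3_open (U : set 'rV[R]_3) (f : 'rV[R]_3 -> R) : open U ->
  (forall x, U x -> {for x, continuous f}) ->
  measurable_fun (@row3 R @^-1` U : set (mR * mR * mR)%type) (fun q => f (row3 q)).
Proof.
move=> oU cf; apply: (@measurable_fun_continuous_in3 R _ (fun q => f (row3 q))).
  exact: measurable_row3_open.
apply: continuous_in_subspaceT => q; rewrite inE => Uq.
by apply: continuous_comp; [exact: continuous_row3|exact: cf].
Qed.

Lemma vol_finite : (vol R (@row3 R @^-1` Om) < +oo)%E.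
Proof.
have [M M0 OM] := bounded_polyhedron_coord bO.
pose I : set mR := `]- M, M[%classic.
have mI : measurable I by exact: measurable_itv.
have fI : (la I < +oo)%E.
  by rewrite /I lebesgue_measure_itv /=; case: ifPn => _; rewrite ?ltry// -EFinB ltry.
have mII : measurable (I `*` I) by exact: measurableX.
apply: (@le_lt_trans _ _ (vol R (I `*` I `*` I))).
  apply: le_measure; rewrite ?inE.
  - by apply: measurable_row3_open; exact: open_polyhedron.
  - exact: measurableX.
  - move=> [[x y] z] /= Ox; have H := OM _ Ox.
    have := H 0; have := H 1; have := H (1 + 1).
    by rewrite !mxE /= !ltr_norml /I /= !in_itv/= => -> -> ->.
have -> : vol R (I `*` I `*` I) = ((la I * la I) * la I)%E.
  transitivity (@area R (I `*` I) * la I)%E.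
    exact (@product_measure1E _ _ _ _ R (@area R) la _ _ mII mI).
  congr (_ * _)%E; exact (@product_measure1E _ _ _ _ R la la _ _ mI mI).
by rewrite lte_mul_pinfty ?mule_ge0// ?lte_mul_pinfty// ge0_fin_numE// ?mule_ge0// lte_mul_pinfty// ge0_fin_numE.
Qed.

Lemma integrable_polyhedron (f : 'rV[R]_3 -> R) C :
  (forall x, Om x -> {for x, continuous f}) -> (forall x, Om x -> `|f x| <= C) ->
  (vol R).-integrable (@row3 R @^-1` Om) (EFin \o (fun q => f (row3 q))).
Proof.
move=> cf fC; apply: measurable_bounded_integrable.
- by apply: measurable_row3_open; exact: open_polyhedron.
- exact: vol_finite.
- by apply: measurable_fun_row3_open => //; exact: open_polyhedron.
- exists C; split; first exact: num_real.
  by move=> x Cx q Oq; apply: le_trans (ltW Cx); exact: fC.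
Qed.

End BoundedPolyhedron.

Section Planes.
Variable R : realType.
Local Notation mR := (measurableTypeR R).

(** The zero set is either a point times [R], or has a single point in each vertical section. This
    discards the lines that meet two nonparallel face planes at the same point. *)
Lemma area_line0 (c be ga : R) : (be != 0) || (ga != 0) ->
  {ae @area R, forall p, c - be * p.1 - ga * p.2 != 0}.
Proof.
move=> bg; pose A : set (mR * mR)%type := [set p | c - be * p.1 - ga * p.2 = 0].
have mA : measurable A.
  have mf : measurable_fun [set: (mR * mR)%type] (fun p => c - be * p.1 - ga * p.2 : R).
    apply: measurable_funB; first apply: measurable_funB => //.
      by apply: measurable_funM => //; exact: measurable_fst.
    by apply: measurable_funM => //; exact: measurable_snd.
  have := mf measurableT [set 0] (measurable_set1 _); rewrite setTI; exact.
exists A; split => //; last by move=> p /negP; rewrite negbK => /eqP.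
have [g0|g0] := eqVneq ga 0.
  rewrite g0 eqxx orbF in bg.
  have -> : A = [set c / be] `*` setT.
    apply/seteqP; split => [[y z]|[y z]]; rewrite /A /= g0 mul0r subr0.
      by move=> /eqP; rewrite subr_eq0 => /eqP ->; rewrite mulrAC divff// mul1r.
    by move=> [-> _]; rewrite mulrC divfK// subrr.
  pose A1 : set mR := [set c / be].
  transitivity (@lebesgue_measure R A1 * @lebesgue_measure R setT)%E.
    exact (@product_measure1E _ _ _ _ R (@lebesgue_measure R) (@lebesgue_measure R)
      _ _ (measurable_set1 _) measurableT).
  (* In the extended reals [0 * +oo] is [0]. *)
  by rewrite /A1 lebesgue_measure_set1 mul0e.
rewrite /area /= /product_measure1; apply: integral0_eq => y _ /=.
have -> : xsection A y = [set (c - be * y) / ga].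
  apply/seteqP; split => z; rewrite /xsection /= inE /A /=.
    by move=> /eqP; rewrite subr_eq0 => /eqP ->; rewrite mulrAC divff// mul1r.
  by move=> ->; rewrite [ga * _]mulrC divfK// subrr.
exact: lebesgue_measure_set1.
Qed.

End Planes.

(** The expansion may start at any index, to match the cyclic [k + 1] and [k + 1 + 1] of curl and
    cross product. *)
Lemma sum_ord3 (V : nmodType) (k : 'I_3) (f : 'I_3 -> V) :
  \sum_l f l = f k + f (k + 1) + f (k + 1 + 1).
Proof.
have [x0 [x1 [x2 E]]] : exists x0 x1 x2, forall i, f i = [:: x0; x1; x2]`_i.
  exists (f 0), (f 1), (f (1 + 1)) => -[[|[|[|//]]] ?] /=; congr f; exact: val_inj.
rewrite !big_ord_recl big_ord0 addr0 !E.
case: k => [[|[|[|//]]] ?] /=; first by rewrite addrA.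
  by rewrite addrC.
by rewrite [RHS]addrAC [RHS]addrC (addrC x2).
Qed.

(** * The normal flux in a thin strip along one face *)

Section Strip.
Variables (R : realType) (N : nat) (a : 'I_N -> 'rV[R]_3) (b : 'I_N -> R).
Local Notation mR := (measurableTypeR R).
Local Notation la := (@lebesgue_measure R).
Let Om := polyhedron a b.
Hypothesis bO : bounded_set Om.
Variable F : 'I_3 -> 'rV[R]_3 -> R.
Hypothesis cF : forall k, {within closure Om, continuous (F k)}.
Hypothesis F0 : forall x n, boundary Om x -> outward_unit_normal Om x n ->
  \sum_k F k x * n 0 k = 0.
Variables (i : 'I_N) (k : 'I_3).
Hypothesis aik : a i 0 k != 0.

(** On face [i] this is the normal component of [F] times the length of [a i]. *)
Definition flux x : R := \sum_l a i 0 l * F l x.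

Definition strip (L : R) : set 'rV[R]_3 := Om `&` [set x | L * slack a b i x < 2].

(** Up to a constant, it bounds the contribution of face [i] to the product of [F] with the gradient
    of the cutoff. *)
Definition strip_flux (L : R) : 'rV[R]_3 -> R :=
  (fun x => L * `|flux x|) \_ (strip L).

(** The coordinate at which the line over [p] parallel to axis [k] meets the plane of face [i]. *)
Definition foot (p : R * R) : R := slack a b i (insert k 0 p) / a i 0 k.

Lemma slack_insert j x p :
  slack a b j (insert k x p) = slack a b j (insert k 0 p) - a j 0 k * x.
Proof.
by rewrite insert_line /slack dotD dotZ dot_delta; ring.
Qed.

Lemma slack_foot x p : slack a b i (insert k x p) = a i 0 k * (foot p - x).
Proof. by rewrite slack_insert /foot mulrBr mulrCA divff// mulr1. Qed.

Lemma flux_continuous_at x : Om x -> {for x, continuous flux}.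
Proof.
move=> Ox; apply: cont_sum => l; apply: cont_mul; first exact: cont_cst.
by apply: (continuous_closure_in (a := a) (b := b)).
Qed.

Lemma flux_within : {within closure Om, continuous flux}.
Proof.
apply/subspace_continuousP => x Ox; rewrite /flux.
apply: cvg_big => [|l _]; first exact: add_continuous.
apply: cvgMl_tmp; have /subspace_continuousP H := @cF l; exact: H.
Qed.

Lemma open_strip L : open (strip L).
Proof.
apply: openI; first exact: open_polyhedron.
apply: (@open_comp _ _ (fun x => L * slack a b i x) [set r | r < 2]); last exact: open_lt.
by move=> x _; apply: cont_mul; [exact: cont_cst|exact: continuous_slack].
Qed.

Lemma strip_flux_ge0 L x : 0 <= L -> 0 <= strip_flux L x.
Proof. by move=> L0; rewrite /strip_flux patchE; case: ifP => // _; rewrite mulr_ge0. Qed.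

Lemma measurable_strip_flux L :
  measurable_fun [set: (mR * mR * mR)%type] (fun q => (strip_flux L (row3 q))%:E).
Proof.
apply/measurable_EFinP.
rewrite (_ : (fun q => _) = (fun q => L * `|flux (row3 q)|) \_ (@row3 R @^-1` strip L)).
  apply/(measurable_restrictT _ _).1; first exact (measurable_row3_open (@open_strip L)).
  apply: (measurable_fun_row3_open (@open_strip L) (f := fun x => L * `|flux x|)).
  move=> x [Ox _]; apply: cont_mul; first exact: cont_cst.
  by apply: cont_comp; [exact: flux_continuous_at|exact: norm_continuous].
by apply/funext => q; rewrite /strip_flux !patchE.
Qed.

(** Writing [A] for the absolute value of [a i 0 k], the strip meets the line inside an interval of
    length [4 / (L * A)] centred at the foot. There the integrand is at most [L * d]: the width of
    the strip compensates the size of the gradient, and [L] disappears from the bound. *)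
Lemma strip_slice_le L p (d : R) : 0 < L -> 0 <= d ->
  (forall x, `|x - foot p| <= 2 / (L * `|a i 0 k|) -> Om (insert k x p) ->
     `|flux (insert k x p)| <= d) ->
  (\int[la]_x (strip_flux L (insert k x p))%:E <= (4 * d / `|a i 0 k|)%:E)%E.
Proof.
move=> L0 d0 H; set r := 2 / _ in H.
have A0 : 0 < `|a i 0 k| by rewrite normr_gt0.
have r0 : 0 < r by rewrite divr_gt0// mulr_gt0.
have mflux := measurable_slice1 (f := fun x => (strip_flux L x)%:E) k p (measurable_strip_flux L).
pose I : set mR := `[foot p - r, foot p + r]%classic.
have mI : measurable I by exact: measurable_itv.
have mI1 : measurable_fun [set: mR] (fun x => (\1_I x)%:E : \bar R).
  by apply/measurable_EFinP; exact: measurable_indic.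
apply: (@le_trans _ _ (\int[la]_x ((L * d) * \1_I x)%:E)%E).
  apply: ge0_le_integral => //.
  - by move=> x _; rewrite lee_fin strip_flux_ge0// ltW.
  - by apply/measurable_EFinP; apply: measurable_funM => //; exact: measurable_indic.
  - move=> x _; rewrite lee_fin /strip_flux patchE; case: ifPn; last first.
      by move=> _; rewrite mulr_ge0// mulr_ge0// ltW.
    rewrite inE => -[Ox /= sx].
    have xr : `|x - foot p| <= r.
      rewrite /r ler_pdivlMr ?mulr_gt0// mulrC -mulrA -normrM.
      have /polyhedronE/(_ i) := Ox; move: sx; rewrite slack_foot -normrN -mulrN opprB.
      move=> s2 s0; rewrite gtr0_norm ?ltW//.
    rewrite indicE mem_set ?mulr1 ?ler_wpM2l// ?(ltW L0)//; first exact: H.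
    by rewrite /I /= in_itv/=; move: xr; rewrite ler_norml => /andP[? ?]; apply/andP; split; lra.
under eq_integral do rewrite EFinM.
rewrite ge0_integralZl//; last by rewrite lee_fin mulr_ge0// ltW.
have laI : la I = (2 * r)%:E.
  rewrite /I lebesgue_measure_itv /= lte_fin ifT ?ltrD2l ?gt0_cp//.
  by rewrite -EFinB; congr EFin; lra.
have -> : (\int[la]_x (\1_I x)%:E = (2 * r)%:E)%E.
  by rewrite integral_indic// setIT; exact: laI.
rewrite -EFinM lee_fin /r le_eqVlt; apply/orP; left; apply/eqP.
by field; rewrite !gt_eqF.
Qed.

(** The ratio is read off at coordinate [k], where [a i] does not vanish. Several constraints may
    define the same plane, so comparing indices would not do. *)
Definition parallel j := [forall l, a j 0 l == a j 0 k / a i 0 k * a i 0 l].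

Lemma parallel_slack j x y : parallel j ->
  slack a b j x - slack a b j y =
  a j 0 k / a i 0 k * (slack a b i x - slack a b i y).
Proof.
move=> /forallP P; rewrite /slack.
have D z : dot (a j) z = a j 0 k / a i 0 k * dot (a i) z.
  by rewrite /dot mulr_sumr; apply: eq_bigr => l _; rewrite {1}(eqP (P l)) mulrA.
by rewrite !D; ring.
Qed.

(** The line over [p] crosses the plane of face [i] away from all the face planes that are
    transversal to it, hence away from edges and vertices. *)
Definition generic p := forall j, slack a b j (insert k (foot p) p) = 0 -> parallel j.

(** For [j] not parallel to [i], the slack of [j] at the foot is a nonconstant affine function of
    [p], whose zeros form a null line; there are finitely many such [j]. *)
Lemma ae_generic : {ae @area R, forall p, generic p}.
Proof.
suff H j : {ae @area R, forall p, slack a b j (insert k (foot p) p) = 0 -> parallel j}.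
  have FF : Filter (almost_everywhere (@area R)) by exact: ae_filter_ringOfSetsType.
  exact (@filter_forall (mR * mR)%type _ _ _ FF H).
have [pj|npj] := boolP (parallel j); first exact: aeW.
(* Eliminating coordinate [k] between the constraints [i] and [j] leaves the coefficients [c]; they
   vanish at [k], and not at both other indices since [j] is not parallel to [i]. *)
pose c l := a j 0 l - a j 0 k / a i 0 k * a i 0 l.
have ck : c k = 0 by rewrite /c divfK// subrr.
have sE p : slack a b j (insert k (foot p) p) =
    b j - a j 0 k / a i 0 k * b i - c (k + 1) * p.1 - c (k + 1 + 1) * p.2.
  rewrite slack_insert /foot /slack /dot /c {ck}.
  have i0 : insert k 0 p 0 k = 0 by rewrite mxE eqxx.
  have i1 : insert k 0 p 0 (k + 1) = p.1 by rewrite mxE; case: (k) => [[|[|[|//]]] ?].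
  have i2 : insert k 0 p 0 (k + 1 + 1) = p.2.
    by rewrite mxE; case: (k) => [[|[|[|//]]] ?].
  by rewrite !(sum_ord3 k) i0 i1 i2; field.
have : (c (k + 1) != 0) || (c (k + 1 + 1) != 0).
  apply: contraNT npj; rewrite negb_or !negbK => /andP[/eqP c1 /eqP c2].
  apply/forallP => l; rewrite -subr_eq0 -/(c l).
  suff : l \in [:: k; k + 1; k + 1 + 1] by rewrite !inE => /or3P[]/eqP ->; rewrite ?ck ?c1 ?c2.
  by case: (k) => [[|[|[|//]]] ?]; case: (l) => [[|[|[|//]]] ?].
move=> /(area_line0 (b j - a j 0 k / a i 0 k * b i)).
have FF : Filter (almost_everywhere (@area R)) by exact: ae_filter_ringOfSetsType.
by apply: (@filterS _ _ FF) => p; rewrite -sE => /eqP.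
Qed.

Lemma enorm_gt0 (v : 'rV[R]_3) l : v 0 l != 0 -> 0 < enorm v.
Proof.
move=> vl; rewrite /enorm sqrtr_gt0 big_ord1 (bigD1 l)//= ltr_pwDl//.
  by rewrite exprn_even_gt0.
by apply: sumr_ge0 => ? _; exact: sqr_ge0.
Qed.

Lemma enorm_normalized (v : 'rV[R]_3) : 0 < enorm v -> enorm ((enorm v)^-1 *: v) = 1.
Proof.
move=> v0; rewrite {1}/enorm big_ord1.
under eq_bigr do rewrite mxE exprMn.
rewrite -mulr_sumr sqrtrM ?sqr_ge0// sqrtr_sqr.
have -> : Num.sqrt (\sum_j v 0 j ^+ 2) = enorm v by rewrite /enorm big_ord1.
by rewrite gtr0_norm ?invr_gt0// mulVf// gt_eqF.
Qed.

(** Near [P] only constraints proportional to constraint [i] can fail, so [Om] is locally an open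
    half-space. Hence a unit outer normal exists at [P] and the hypothesis on [F] applies. *)
Lemma facet_flux0 P : Om !=set0 -> slack a b i P = 0 ->
  (forall j, 0 <= slack a b j P) -> (forall j, slack a b j P = 0 -> parallel j) ->
  closure Om P /\ flux P = 0.
Proof.
move=> [y0 /polyhedronE Oy0] si0 sge par.
(* At a point of [Om] both slacks are positive, so the ratio is positive: a parallel constraint
   active at [P] bounds [Om] on the same side as constraint [i]. *)
have lam0 j : slack a b j P = 0 -> 0 < a j 0 k / a i 0 k.
  move=> sj0; have := parallel_slack y0 P (par _ sj0).
  rewrite si0 sj0 !subr0 => E; have := Oy0 j; rewrite E.
  by rewrite pmulr_lgt0.
have nearOm : \forall y \near P, Om y <-> 0 < slack a b i y.
  have : \forall y \near P, forall j, 0 < slack a b j P -> 0 < slack a b j y.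
    apply: (@filter_forall _ _ (fun j y => 0 < slack a b j P -> 0 < slack a b j y) (nbhs P)) => j.
    have [sj|sj] := ltP 0 (slack a b j P); last by apply: filterE.
    have /cvgr_gt/(_ _ sj) := @continuous_slack _ _ a b j P.
    by apply: filterS => y ? _.
  apply: filterS => y Hy; split=> [/polyhedronE//|siy].
  apply/polyhedronE => j; have := sge j; rewrite le_eqVlt => /predU1P[sj0|]; last exact: Hy.
  have := parallel_slack y P (par _ (esym sj0)).
  by rewrite si0 -sj0 !subr0 => ->; rewrite mulr_gt0// lam0.
have e0 := enorm_gt0 aik.
pose n := (enorm (a i))^-1 *: a i.
have dn y : dot n (y - P) = - ((enorm (a i))^-1 * slack a b i y).
  have dc z : dot n z = (enorm (a i))^-1 * dot (a i) z.
    by rewrite /dot mulr_sumr; apply: eq_bigr => l _; rewrite mxE mulrA.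
  move: si0; rewrite dc dotD -scaleN1r dotZ /slack => s0.
  have -> : dot (a i) P = b i by lra.
  by rewrite -mulrN; congr (_ * _); lra.
have onP : outward_unit_normal Om P n.
  split; first exact: enorm_normalized.
  apply: filterS nearOm => y ->; rewrite dn oppr_lt0 pmulr_rgt0// invr_gt0//.
have cP : closure Om P.
  move=> B nB.
  (* [P] is approached from inside [Om] along the inner normal. *)
  have cl : (fun r : R => P + (- r) *: n) r @[r --> 0^'+] --> P.
    have : continuous_at (0 : R) (fun r : R => P + (- r) *: n).
      apply: continuous_row => l.
      rewrite (_ : (fun r => _) = (fun r : R => P 0 l + (- r) * n 0 l)).
        apply: cont_add; first exact: cont_cst.
        by apply: cont_mul; [apply: cont_opp; exact: cvg_id|exact: cont_cst].
      by apply/funext => r; rewrite !mxE.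
    by rewrite /continuous_at oppr0 scale0r addr0; exact: cvg_at_right_filter.
  have : \forall r \near (0:R)^'+, B (P + (- r) *: n) /\ (Om (P + (- r) *: n) <-> 0 < slack a b i (P + (- r) *: n)).
    by near=> r; split; near: r; [exact: (cl _ nB)|exact: (cl _ nearOm)].
  move=> H; have : \forall r \near (0:R)^'+, (Om `&` B) (P + (- r) *: n).
    near=> r; have [BP [_ OP]] : B (P + (- r) *: n) /\ (Om (P + (- r) *: n) <-> 0 < slack a b i (P + (- r) *: n)) by near: r.
    split => //; apply: OP.
    rewrite /slack dotD dotZ opprD addrA -/(slack a b i P) si0 sub0r mulNr opprK.
    apply: mulr_gt0; first by near: r; exact: nbhs_right_gt.
    rewrite dotZ; apply: mulr_gt0; first by rewrite invr_gt0.
    rewrite /dot (bigD1 k)//= ltr_pwDl//; first by rewrite -expr2 exprn_even_gt0.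
    by apply: sumr_ge0 => l _; rewrite -expr2 sqr_ge0.
  by move=> /filter_ex[r Hr]; exists (P + (- r) *: n).
have bP : boundary Om P.
  split => // /interior_subset/polyhedronE/(_ i); rewrite si0 ltxx //.
split => //; have := F0 bP onP.
under eq_bigr do rewrite mxE mulrC -mulrA.
rewrite -mulr_sumr => /eqP; rewrite mulf_eq0 invr_eq0 gt_eqF//= => /eqP.
by rewrite /flux.
Unshelve. all: by end_near. Qed.

(** Either the foot violates a constraint, and [Om] stays away from it, or it lies in an open facet,
    where the flux vanishes and is continuous up to the closure. The radius depends on [p] without
    any uniformity. *)
Lemma generic_flux p (d : R) : generic p -> 0 < d ->
  exists2 r, 0 < r & forall x, `|x - foot p| <= r -> Om (insert k x p) ->
    `|flux (insert k x p)| <= d.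
Proof.
move=> gp d0; set P := insert k (foot p) p.
have [Om0|Om0] := pselect (Om !=set0); last first.
  by exists 1 => // x _ Ox; exfalso; apply: Om0; exists (insert k x p).
suff : \forall y \near P, Om y -> `|flux y| <= d.
  have cl : (fun x : R => insert k x p) x @[x --> foot p] --> P by exact: continuous_insert.
  move=> /cl/nbhs_ballP[r /= r0 H]; exists (r / 2); first by rewrite divr_gt0.
  move=> x xr; apply: H; rewrite /ball/= distrC (le_lt_trans xr)//.
  by rewrite ltr_pdivrMr// ltr_pMr// ltr1n.
have si0 : slack a b i P = 0 by rewrite slack_foot subrr mulr0.
have [sge|/existsNP[j /negP]] := pselect (forall j, 0 <= slack a b j P); last first.
  rewrite -ltNge => sj; have /cvgr_lt/(_ _ sj) := @continuous_slack _ _ a b j P.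
  by apply: filterS => y sy /polyhedronE/(_ j); rewrite ltNge (ltW sy).
have [cP fP] := facet_flux0 Om0 si0 sge gp.
have H : \forall y \near P, closure Om y -> `|flux P - flux y| <= d.
  by have /subspace_continuousP/(_ _ cP)/cvgrPdist_le/(_ _ d0) := flux_within.
apply: filterS H => y Hy Oy.
by have := Hy (subset_closure Oy); rewrite fP sub0r normrN.
Qed.

End Strip.

(** * The strip integrals tend to zero *)

Section StripLimit.
Variables (R : realType) (N : nat) (a : 'I_N -> 'rV[R]_3) (b : 'I_N -> R).
Local Notation mR := (measurableTypeR R).
Local Notation la := (@lebesgue_measure R).
Let Om := polyhedron a b.
Hypothesis bO : bounded_set Om.
Variable F : 'I_3 -> 'rV[R]_3 -> R.
Hypothesis cF : forall k, {within closure Om, continuous (F k)}.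
Hypothesis F0 : forall x n, boundary Om x -> outward_unit_normal Om x n ->
  \sum_k F k x * n 0 k = 0.
Variable i : 'I_N.

Lemma flux_bounded : exists2 C, 0 <= C & forall x, Om x -> `|flux a F i x| <= C.
Proof.
have [C HC] := bounded_on_closure bO (flux_within (i := i) cF).
exists `|C| => // x Ox; apply: le_trans (ler_norm C).
exact/HC/subset_closure.
Qed.

(** Slicing along an axis transversal to the face gives line integrals that are bounded uniformly in
    [n] and tend to [0] on generic lines, so dominated convergence applies. *)
Lemma strip_flux_cvg0 :
  (\int[vol R]_q (strip_flux a b F i n.+1%:R (row3 q))%:E)%E @[n --> \oo] --> 0%E.
Proof.
(* If [a i] is zero there is no face plane and the flux is zero; otherwise some axis [k] is
   transversal to the plane. *)
have [ai0|/forallPn[k aik]] := boolP [forall k, a i 0 k == 0].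
  apply: cvg_near_cst; apply: filterE => n; apply: integral0_eq => q _.
  rewrite /strip_flux patchE /flux; case: ifP => // _.
  by rewrite big1 ?normr0 ?mulr0// => l _; rewrite (eqP (forallP ai0 l)) mul0r.
have [C C0 HC] := flux_bounded; have [M M0 OM] := bounded_polyhedron_coord bO.
pose A := `|a i 0 k|; have A0 : 0 < A by rewrite normr_gt0.
pose J n p := (\int[la]_x (strip_flux a b F i n.+1%:R (insert k x p))%:E)%E.
have mJ n : measurable_fun [set: (mR * mR)%type] (J n).
  apply: (measurable_slice k (f := fun x => (strip_flux a b F i n.+1%:R x)%:E)).
    by apply: measurable_strip_flux.
  by move=> x; rewrite lee_fin strip_flux_ge0.
have J0 n p : (0 <= J n p)%E.
  by apply: integral_ge0 => x _; rewrite lee_fin strip_flux_ge0.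
have -> : (fun n => \int[vol R]_q (strip_flux a b F i n.+1%:R (row3 q))%:E)%E =
    (fun n => \int[@area R]_p J n p)%E.
  apply/funext => n.
  apply: (slice_tonelli k (f := fun x => (strip_flux a b F i n.+1%:R x)%:E)).
    by apply: measurable_strip_flux.
  by move=> x; rewrite lee_fin strip_flux_ge0.
pose I : set mR := `[- M, M]%classic.
have mI : measurable I by exact: measurable_itv.
have mII : measurable (I `*` I) by exact: measurableX.
(* The constant is that of [strip_slice_le] with [d = C]; lines with [p] outside the square miss
   [Om]. *)
pose g p : \bar R := ((4 * C / A) * \1_(I `*` I) p)%:E.
have fII : (@area R (I `*` I) < +oo)%E.
  have -> : @area R (I `*` I) = (la I * la I)%E.
    exact (@product_measure1E _ _ _ _ R la la _ _ mI mI).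
  rewrite /I lebesgue_measure_itv /=; case: ifPn => _; last by rewrite mul0e.
  by rewrite -EFinB -EFinM ltry.
have ig : (@area R).-integrable [set: (mR * mR)%type] g.
  rewrite /g; under eq_fun do rewrite EFinM.
  apply: integrableZl => //; apply/integrableP; split.
    by apply/measurable_EFinP; exact: measurable_indic.
  under eq_integral do rewrite gee0_abs ?lee_fin//.
  by rewrite integral_indic// setIT.
have Jg n p : (J n p <= g p)%E.
  rewrite /g indicE; have [Ip|nIp] := boolP (p \in I `*` I).
    rewrite mulr1; apply: strip_slice_le => // x _ Ox.
    exact: HC.
  rewrite mulr0 /J integral0_eq// => x _.
  rewrite /strip_flux patchE memNset// => -[/OM Ox _].
  move/negP: nIp; apply; rewrite inE; split; rewrite /I /= in_itv /=.
    have := Ox (k + 1); rewrite mxE ifF; last by case: (k) => [[|[|[|//]]] ?].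
    by rewrite eqxx ltr_norml => /andP[/ltW-> /ltW->].
  have := Ox (k + 1 + 1); rewrite mxE ifF; last by case: (k) => [[|[|[|//]]] ?].
  rewrite ifF; last by case: (k) => [[|[|[|//]]] ?].
  by rewrite ltr_norml => /andP[/ltW-> /ltW->].
have Jcvg p : generic a b i k p -> J n p @[n --> \oo] --> 0%E.
  move=> gp; apply/fine_cvgP; split.
    apply: filterE => n; rewrite fin_numE gt_eqF ?(lt_le_trans _ (J0 n p)) ?ltNy0//=.
    by rewrite lt_eqF// (le_lt_trans (Jg n p))// ltry.
  apply/cvgrPdist_le => e e0.
  (* This is the value of [d] for which the bound [4 * d / A] equals [e]. *)
  have d0 : 0 < e * A / 4 by rewrite divr_gt0// mulr_gt0.
  have [r r0 Hr] := generic_flux cF F0 aik gp d0.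
  near=> n.
  have fJ : J n p \is a fin_num by rewrite ge0_fin_numE// (le_lt_trans (Jg n p))// ltry.
  rewrite sub0r normrN ger0_norm ?fine_ge0// -lee_fin fineK//.
  apply: (@le_trans _ _ (4 * (e * A / 4) / A)%:E).
    apply: strip_slice_le => //; first exact: ltW.
    move=> x xr; apply: Hr; apply: (le_trans xr).
    rewrite ler_pdivrMr ?mulr_gt0//.
    rewrite -/A mulrCA -ler_pdivrMr ?mulr_gt0//.
    apply: (@le_trans _ _ n%:R); last by rewrite ler_nat.
    by near: n; exact: nbhs_infty_ger.
  rewrite lee_fin le_eqVlt; apply/orP; left; apply/eqP.
  by field; rewrite gt_eqF.
have [|||||_ _] := @dominated_convergence _ _ _ (@area R) setT measurableT J (cst 0%E) g.
- exact: mJ.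
- exact: measurable_cst.
- have FF : Filter (almost_everywhere (@area R)) by exact: ae_filter_ringOfSetsType.
  by apply: (@filterS _ _ FF) (ae_generic b aik) => p gp _; exact: Jcvg.
- exact: ig.
- by apply: aeW => p n _; rewrite gee0_abs.
by rewrite integral0.
Unshelve. all: by end_near. Qed.

End StripLimit.

(** * Continuity relative to a set *)

Section ContinuityWithin.
Variables (R : realType) (T : topologicalType) (A : set T).
Implicit Types f g : T -> R.

Lemma within_cst (c : R) : {within A, continuous (fun=> c : R)}.
Proof. by apply: continuous_subspaceT => x; exact: cst_continuous. Qed.

Lemma within_add f g : {within A, continuous f} -> {within A, continuous g} ->
  {within A, continuous (fun x => f x + g x)}.
Proof. by move=> cf cg; exact: within_continuousD. Qed.

Lemma within_opp f : {within A, continuous f} -> {within A, continuous (fun x => - f x)}.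
Proof.
move=> /subspace_continuousP cf; apply/subspace_continuousP => x Ax.
by apply: cvgN; exact: cf.
Qed.

Lemma within_mul f g : {within A, continuous f} -> {within A, continuous g} ->
  {within A, continuous (fun x => f x * g x)}.
Proof.
move=> /subspace_continuousP cf /subspace_continuousP cg.
by apply/subspace_continuousP => x Ax; apply: cvgM; [exact: cf|exact: cg].
Qed.

Lemma within_sum n (f : 'I_n -> T -> R) : (forall i, {within A, continuous (f i)}) ->
  {within A, continuous (fun x => \sum_i f i x)}.
Proof.
move=> cf; apply/subspace_continuousP => x Ax.
apply: cvg_big => [|i _]; first exact: add_continuous.
by have /subspace_continuousP H := @cf i; exact: H.
Qed.

Lemma within_eq f g : (forall x, A x -> f x = g x) -> {within A, continuous f} ->
  {within A, continuous g}.
Proof.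
move=> fg; apply: subspace_eq_continuous => x; rewrite inE => Ax.
by rewrite /from_subspace fg.
Qed.

End ContinuityWithin.

Lemma Rintegral_sum d (T : measurableType d) (R : realType)
    (mu : {measure set T -> \bar R}) (D : set T) n (f : 'I_n -> T -> R) :
  measurable D -> (forall i, mu.-integrable D (EFin \o f i)) ->
  \int[mu]_(x in D) (\sum_i f i x) = \sum_i \int[mu]_(x in D) f i x.
Proof.
move=> mD fi; rewrite /Rintegral.
under eq_integral do rewrite -sumEFin.
rewrite integral_sum// (eq_bigr (fun i => (fine (\int[mu]_(x in D) (f i x)%:E))%:E)%E).
  by rewrite sumEFin.
by move=> i _; rewrite fineK//; exact: integrable_fin_num (fi i).
Qed.

(** * The divergence theorem for fields without normal component *)

Section ZeroFlux.
Variables (R : realType) (N : nat) (a : 'I_N -> 'rV[R]_3) (b : 'I_N -> R).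
Let Om := polyhedron a b.
Let D := @row3 R @^-1` Om.
Hypothesis bO : bounded_set Om.

Lemma measurable_polyhedron :
  measurable (D : set (measurableTypeR R * measurableTypeR R * measurableTypeR R)%type).
Proof. by apply: measurable_row3_open; exact: open_polyhedron. Qed.

Lemma integrable_closure (f : 'rV[R]_3 -> R) : {within closure Om, continuous f} ->
  (vol R).-integrable D (EFin \o (fun q => f (row3 q))).
Proof.
move=> cf; have [C HC] := bounded_on_closure bO cf.
apply: (integrable_polyhedron bO (C := C)); first exact: continuous_closure_in.
by move=> x Ox; exact/HC/subset_closure.
Qed.

Variables F G : 'I_3 -> 'rV[R]_3 -> R.
Hypothesis cF : forall k, {within closure Om, continuous (F k)}.
Hypothesis cG : forall k, {within closure Om, continuous (G k)}.
Hypothesis dF : forall k x, Om x -> is_derive x (delta_mx 0 k) (F k) (G k x).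
Hypothesis F0 : forall x n, boundary Om x -> outward_unit_normal Om x n ->
  \sum_k F k x * n 0 k = 0.

(** Summing [integral_dcutF] over the axes gives an integration by parts without boundary term. *)
Lemma integral_cutoff_div (L : R) : 0 < L ->
  \int[vol R]_(q in D) (cutoff a b L (row3 q) * \sum_k G k (row3 q)) =
  - \int[vol R]_(q in D) (\sum_k dcutoff a b L (delta_mx 0 k) (row3 q) * F k (row3 q)).
Proof.
move=> L0; have mD := measurable_polyhedron.
have cc : {within closure Om, continuous (cutoff a b L)}.
  by apply: continuous_subspaceT; exact: continuous_cutoff.
have cd v : {within closure Om, continuous (dcutoff a b L v)}.
  by apply: continuous_subspaceT; exact: continuous_dcutoff.
have H k : \int[vol R]_(q in D) (cutoff a b L (row3 q) * G k (row3 q) +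
    dcutoff a b L (delta_mx 0 k) (row3 q) * F k (row3 q)) = 0.
  have E := integral_dcutF bO L0 (@dF k) (continuous_closure_in (@cF k))
    (continuous_closure_in (@cG k)).
  rewrite -[RHS]E [LHS]Rintegral_mkcond; apply: eq_Rintegral => q _.
  rewrite patchE /dcutF; case: asboolP => Oq; first by rewrite mem_set.
  by rewrite memNset.
apply/eqP; rewrite -subr_eq0 opprK; apply/eqP.
rewrite -RintegralD//; last 2 first.
- apply: (integrable_closure (f := fun x => cutoff a b L x * \sum_k G k x)).
  by apply: within_mul => //; exact: within_sum.
- apply: (integrable_closure (f := fun x => \sum_k dcutoff a b L (delta_mx 0 k) x * F k x)).
  by apply: within_sum => k; exact: within_mul.
transitivity (\sum_k \int[vol R]_(q in D) (cutoff a b L (row3 q) * G k (row3 q) +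
    dcutoff a b L (delta_mx 0 k) (row3 q) * F k (row3 q))); last first.
  by rewrite big1.
rewrite -Rintegral_sum//; last first.
  move=> k; apply: (integrable_closure (f := fun x => cutoff a b L x * G k x +
    dcutoff a b L (delta_mx 0 k) x * F k x)).
  by apply: within_add; exact: within_mul.
by apply: eq_Rintegral => q _; rewrite big_split -mulr_sumr.
Qed.

(** Regrouping by faces makes [F] enter through [flux] only. The [8] is [2 * 2 * 2]: two factors
    from differentiating squares, and [excess] at most [2] inside [Om], while [height] is at most
    [1]. Outside the strip [excess] is zero. *)
Lemma dcutoff_le (L : R) x : 0 < L -> Om x ->
  `|\sum_k dcutoff a b L (delta_mx 0 k) x * F k x| <=
  \sum_i 8 * strip_flux a b F i L x.
Proof.
move=> L0 Ox.
have -> : \sum_k dcutoff a b L (delta_mx 0 k) x * F k x =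
    - \sum_i 2 * height a b L x * (2 * excess a b L i x) * L * flux a F i x.
  rewrite /dcutoff /flux.
  under eq_bigr do rewrite mulNr mulr_sumr mulr_suml.
  rewrite sumrN exchange_big /=; congr (- _); apply: eq_bigr => i _.
  rewrite mulr_sumr; apply: eq_bigr => k _.
  by rewrite dot_delta; ring.
rewrite normrN (le_trans (ler_norm_sum _ _ _))// ler_sum// => i _.
have h0 := height_ge0 a b L x; have h1 := height_le1 a b L x.
have e0 : 0 <= excess a b L i x by exact: pos_ge0.
have Lx : 0 < L * slack a b i x by rewrite mulr_gt0//; move/polyhedronE: Ox; exact.
rewrite /strip_flux patchE; case: ifPn => [_|].
  have e2 : excess a b L i x <= 2 by apply: pos_le => //; lra.
  have c0 : 0 <= 2 * height a b L x * (2 * excess a b L i x) * L.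
    by apply: mulr_ge0; [do 2?apply: mulr_ge0 => //; exact: mulr_ge0|exact: ltW].
  rewrite normrM ger0_norm//.
  have bound (H e : R) : 0 <= H -> H <= 1 -> 0 <= e -> e <= 2 -> 2 * H * (2 * e) <= 8.
    by move=> *; nra.
  rewrite -(mulrA (2 * height a b L x * (2 * excess a b L i x)) L).
  apply: ler_wpM2r; first by rewrite mulr_ge0// ltW.
  exact: bound.
rewrite notin_setE => nstrip.
rewrite /excess pos_eq0 ?mulr0 ?mul0r ?normr0//.
by rewrite subr_le0 leNgt; apply/negP => sx; apply: nstrip.
Qed.

(** The cutoff tends to [1] at each point of [Om], so [A n] tends to the wanted integral. By
    [integral_cutoff_div] and [dcutoff_le] it is also bounded by strip integrals, which tend to
    [0]. *)
Theorem integral_div_eq0 : \int[vol R]_(q in D) (\sum_k G k (row3 q)) = 0.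
Proof.
have mD := measurable_polyhedron.
pose h x := \sum_k G k x.
have ch : {within closure Om, continuous h} by exact: within_sum.
pose A n := \int[vol R]_(q in D) (cutoff a b n.+1%:R (row3 q) * h (row3 q)).
have cc L : {within closure Om, continuous (cutoff a b L)}.
  by apply: continuous_subspaceT; exact: continuous_cutoff.
have iA n : (vol R).-integrable D
    (EFin \o (fun q => cutoff a b n.+1%:R (row3 q) * h (row3 q))).
  by apply: (integrable_closure (f := fun x => cutoff a b n.+1%:R x * h x)); exact: within_mul.
have ih := integrable_closure ch.
have Ah : A n @[n --> \oo] --> \int[vol R]_(q in D) h (row3 q).
  apply: fine_cvg; rewrite fineK; last exact: (integrable_fin_num mD ih).
  apply: (@dominated_cvg _ _ _ (vol R) D mD _ _
     (fun q => `|h (row3 q)|%:E)).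
  - by move=> n; have /integrableP[] := iA n.
  - move=> q Dq; apply: cvg_near_cst.
    have : \forall n \near \oo, forall i, 2 <= n.+1%:R * slack a b i (row3 q).
      apply: (@filter_forall _ _ (fun i (n : nat) => 2 <= n.+1%:R * slack a b i (row3 q)) \oo) => i.
      have si : 0 < slack a b i (row3 q) by move/polyhedronE: Dq; exact.
      near=> n; rewrite -ler_pdivrMr//; apply: (@le_trans _ _ n%:R); last by rewrite ler_nat.
      by near: n; exact: nbhs_infty_ger.
    apply: filterS => n Hn.
    by rewrite /cutoff height_eq1// expr1n mul1r.
  - by [].
  - exact: (integrable_norm ih).
  - move=> n q Dq; rewrite /= lee_fin normrM ler_piMl//.
    rewrite /cutoff normrX ger0_norm ?height_ge0// expr_le1// ?height_le1//.
    exact: height_ge0.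
have sfcvg i : \int[vol R]_(q in D) strip_flux a b F i n.+1%:R (row3 q)
    @[n --> \oo] --> (0 : R).
  rewrite (_ : (fun n => _) = fine \o
    (fun n => \int[vol R]_q (strip_flux a b F i n.+1%:R (row3 q))%:E)%E).
    by apply: fine_cvg; exact: strip_flux_cvg0.
  apply/funext => n; rewrite Rintegral_mkcond; congr (fine _); apply: eq_integral => q _.
  rewrite patchE; case: ifPn => // /negP; rewrite inE => nD.
  by rewrite /strip_flux patchE memNset// => -[].
have isf n i : (vol R).-integrable D
    (EFin \o (fun q => 8 * strip_flux a b F i n.+1%:R (row3 q))).
  have [C C0 HC] := flux_bounded bO cF i.
  apply: measurable_bounded_integrable => //; first exact: vol_finite.
    apply: measurable_funM => //; apply: measurable_funTS.
    by apply/measurable_EFinP; apply: measurable_strip_flux.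
  exists (8 * (n.+1%:R * C)); split; first exact: num_real.
  move=> y Cy q Dq; apply: le_trans (ltW Cy).
  rewrite /= normrM ger0_norm// ler_wpM2l// /strip_flux patchE.
  case: ifPn => _; last by rewrite normr0 mulr_ge0.
  by rewrite normrM normr_id ger0_norm// ler_wpM2l//; exact: HC.
have A0 : A n @[n --> \oo] --> (0 : R).
  have Z : \sum_(j < N) 8 * (0 : R) = 0 by rewrite big1// => ? _; rewrite mulr0.
  have S0 : \sum_i 8 * \int[vol R]_(q in D) strip_flux a b F i n.+1%:R (row3 q)
      @[n --> \oo] --> \sum_(j < N) 8 * (0 : R).
    apply: cvg_big => [|j _]; first exact: add_continuous.
    by apply: cvgMl_tmp; exact: sfcvg.
  rewrite Z in S0.
  apply/norm_cvg0P; apply: (squeeze_cvgr _ (cvg_cst 0) S0).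
  apply: filterE => n; rewrite normr_ge0 /= /A integral_cutoff_div// normrN.
  have cdF : {within closure Om, continuous (fun x =>
      \sum_k dcutoff a b n.+1%:R (delta_mx 0 k) x * F k x)}.
    apply: within_sum => k; apply: within_mul => //.
    by apply: continuous_subspaceT; exact: continuous_dcutoff.
  have idF := integrable_closure cdF.
  rewrite (le_trans (le_normr_Rintegral mD idF))//.
  have -> : \sum_i 8 * \int[vol R]_(q in D) strip_flux a b F i n.+1%:R (row3 q) =
     \int[vol R]_(q in D) \sum_i 8 * strip_flux a b F i n.+1%:R (row3 q).
    rewrite Rintegral_sum//; apply: eq_bigr => i _.
    rewrite RintegralZl//; have := isf n i.
    move=> /(integrableZl mD (8^-1)); apply: eq_integrable => // q _.
    by rewrite /= -EFinM mulrA mulVf ?mul1r.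
  apply: le_Rintegral => //.
  - exact: (integrable_norm idF).
  - have := @integrable_sum _ _ _ (vol R) D mD _ (index_enum _) xpredT _ (fun i _ => isf n i).
    by apply: eq_integrable => // q _; rewrite /= sumEFin.
  - by move=> q Dq; exact: dcutoff_le.
exact: (cvg_unique _ Ah A0).
Unshelve. all: by end_near. Qed.

End ZeroFlux.

(** * Integrals over space and time, and the integrated balance *)

Lemma cont_pair (S U V : topologicalType) (f : S -> U) (g : S -> V) (x : S) :
  continuous_at x f -> continuous_at x g -> continuous_at x (fun y => (f y, g y)).
Proof. by move=> cf cg; exact: (cvg_pair cf cg). Qed.

Section SpaceTime.
Variables (R : realType) (N : nat) (a : 'I_N -> 'rV[R]_3) (b : 'I_N -> R) (T : R).
Local Notation mR := (measurableTypeR R).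
Local Notation la := (@lebesgue_measure R).
Local Notation Om := (polyhedron a b).
Local Notation D := (@row3 R @^-1` Om).
Local Notation Q := (cylinder Om T).
Hypothesis bO : bounded_set Om.
Hypothesis T0 : 0 < T.
Local Notation itv := ([set` Interval (BLeft 0%R) (BRight T)]).
Implicit Types (d e f g : 'rV[R]_3 * R -> R).

Lemma open_cylinder : open Q.
Proof.
rewrite openE => -[x t] [/= Ox tT]; exists (Om, `]0, T[%classic) => /=.
  split; first by apply: open_nbhs_nbhs; split => //; exact: open_polyhedron.
  by apply: open_nbhs_nbhs; split; [exact: interval_open|rewrite /= in_itv].
by move=> [y s] [/= Oy]; rewrite in_itv.
Qed.

Lemma closure_cylinderP x t : closure Q (x, t) <-> closure Om x /\ 0 <= t <= T.
Proof.
split=> [cQ|[cx /andP[t0 tT]] B [[B1 B2] /= [nB1 nB2] BB]].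
  split.
    move=> B nB; have [|[y s] /= [[Oy _] [By _]]] := cQ (B `*` setT).
      by exists (B, setT) => //; split => //; exact: filterT.
    by exists y.
  suff : closure itv t.
    by rewrite -(closure_id _).1 /= ?in_itv//; exact: interval_closed.
  move=> B nB; have [|[y s] /= [[_ /andP[s0 sT]] [_ Bs]]] := cQ (setT `*` B).
    by exists (setT, B) => //; split => //; exact: filterT.
  by exists s; split => //; rewrite /= in_itv/= !ltW.
have [y [Oy By]] := cx _ nB1.
have /nbhs_ballP[e /= e0 eB] := nB2.
(* A move of [e' / 4] towards the middle of the interval stays within [e] of [t] and ends strictly
   between [0] and [T]. *)
pose e' := Num.min e T.
have e'0 : 0 < e' by rewrite lt_min e0.
have e'e : e' <= e by rewrite ge_min lexx.
have e'T : e' <= T by rewrite ge_min lexx orbT.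
have [tT2|tT2] := ltP t (T / 2).
  exists (y, t + e' / 4); split; last first.
    by apply: BB; split => //=; apply: eB; rewrite /ball/= opprD addNKr normrN ger0_norm; lra.
  by split => //=; apply/andP; split; lra.
exists (y, t - e' / 4); split; last first.
  by apply: BB; split => //=; apply: eB; rewrite /ball/= opprB addrC subrK ger0_norm; lra.
by split => //=; apply/andP; split; lra.
Qed.

Lemma closure_row3 q : D q -> closure Om (row3 q).
Proof. by move=> Dq; exact: subset_closure. Qed.

Lemma finite_itv : (la itv < +oo)%E.
Proof. by rewrite lebesgue_measure_itv/=; case: ifP; rewrite ?ltry// -EFinB ltry. Qed.

Lemma bounded_on_cylinder f : {within closure Q, continuous f} ->
  exists C, forall z, closure Q z -> `|f z| <= C.
Proof.
move=> cf; have cQ : compact (closure Q).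
  apply: (@subclosed_compact _ _ (closure Om `*` itv)); first exact: closed_closure.
    by apply: compact_setX; [exact: compact_closure_bounded|exact: segment_compact].
  by move=> [x t] /closure_cylinderP[? ?]; split => //=; rewrite in_itv.
have /compact_bounded[C [Cr CK]] := continuous_compact cf cQ.
exists (`|C| + 1) => z Qz; apply: CK; last by exists z.
by rewrite (le_lt_trans (ler_norm C))// ltrDl.
Qed.

Lemma within_comp (S U : topologicalType) (A : set S) (B : set U) (g : S -> U)
    (f : U -> R) : (forall x, A x -> B (g x)) -> (forall x, A x -> {for x, continuous g}) ->
  {within B, continuous f} -> {within A, continuous (fun x => f (g x))}.
Proof.
move=> AB cg /subspace_continuousP cf; apply/subspace_continuousP => x Ax.
apply: (cvg_comp g f (G := within B (nbhs (g x)))); last exact/cf/AB.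
move=> W; rewrite /within/= => HW; have := cg x Ax _ HW.
by rewrite /nbhs/=; apply: filterS => y /= Hy Ay; apply: Hy; exact: AB.
Qed.

Lemma space_slice f t : {within closure Q, continuous f} -> 0 <= t <= T ->
  {within closure Om, continuous (fun x => f (x, t))}.
Proof.
move=> cf t0T; apply: (within_comp (g := fun x => (x, t))) cf => x Ox.
  exact/closure_cylinderP.
by apply: cont_pair; [exact: cvg_id|exact: cst_continuous].
Qed.

Lemma time_slice f x : {within closure Q, continuous f} -> closure Om x ->
  {within itv, continuous (fun t => f (x, t))}.
Proof.
move=> cf Ox; apply: (within_comp (g := fun t => (x, t))) cf => t.
  by rewrite /= in_itv/= => t0T; exact/closure_cylinderP.
by move=> _; apply: cont_pair; [exact: cvg_cst|exact: cvg_id].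
Qed.

Definition space_integral f (t : R) : R := \int[vol R]_(q in D) f (row3 q, t).

Lemma integrable_slice f t : {within closure Q, continuous f} -> 0 <= t <= T ->
  (vol R).-integrable D (EFin \o (fun q => f (row3 q, t))).
Proof.
by move=> cf t0T; exact: (integrable_closure bO (space_slice cf t0T)).
Qed.

Lemma space_integral_cvg f (u : nat -> R) t : {within closure Q, continuous f} ->
  0 <= t <= T -> (forall n, 0 <= u n <= T) -> u @ \oo --> t ->
  space_integral f (u n) @[n --> \oo] --> space_integral f t.
Proof.
move=> cf t0T u0T ut; have mD := measurable_polyhedron a b.
have [C HC] := bounded_on_cylinder cf.
apply: fine_cvg; rewrite fineK; last exact: (integrable_fin_num mD (integrable_slice cf t0T)).
apply: (@dominated_cvg _ _ _ (vol R) D mD _ _ (cst C%:E)).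
- by move=> n; have /integrableP[] := integrable_slice cf (u0T n).
- move=> q Dq; apply: cvg_EFin; first exact: filterE.
  have /subspace_continuousP/(_ t) := time_slice cf (closure_row3 Dq).
  rewrite /= in_itv/= => /(_ t0T) H.
  apply: (cvg_comp u (fun s => f (row3 q, s)) (G := within itv (nbhs t))) H.
  move=> W HW; have HWu : \forall n \near \oo, itv (u n) -> W (u n) by exact: (ut _ HW).
  have : \forall n \near \oo, W (u n).
    by apply: filterS HWu => n; apply; have := u0T n; rewrite /= in_itv.
  exact.
- by [].
- exact (integrable_closure bO (@within_cst _ _ (closure Om) C)).
- move=> n q Dq; rewrite /= lee_fin; apply: HC; apply/closure_cylinderP.
  by split => //; exact: subset_closure.
Qed.

(** Boundary conditions are given at interior times only; continuity in time carries the zero mean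
    to both ends, where the energies are compared. *)
Lemma space_integral_endpoint0 f : {within closure Q, continuous f} ->
  (forall t, 0 < t < T -> space_integral f t = 0) ->
  space_integral f 0 = 0 /\ space_integral f T = 0.
Proof.
(* The shift by two keeps even [v 0] strictly below [T]. *)
move=> cf f0; pose v n : R := T / n.+2%:R.
have vn n : 0 < v n < T.
  by rewrite divr_gt0//= ltr_pdivrMr// ltr_pMr// ltr1n.
have v0 : v @ \oo --> (0 : R).
  rewrite /v -[X in _ --> X](mulr0 T); apply: cvgMl_tmp.
  by have := @cvg_harmonic R; rewrite -cvg_shiftS.
have lim0 u t : 0 <= t <= T -> (forall n, 0 < u n < T) -> u @ \oo --> t ->
    space_integral f t = 0.
  move=> t0T uT ut; have un n : 0 <= u n <= T by have /andP[? ?] := uT n; rewrite !ltW.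
  have H := space_integral_cvg cf t0T un ut.
  apply: (cvg_unique _ H) => //.
  by apply: cvg_near_cst; apply: filterE => n; exact: f0.
split; first by apply: (lim0 v) => //; rewrite lexx ltW.
apply: (lim0 (fun n => T - v n)); rewrite ?lexx ?ltW//.
  by move=> n; have /andP[? ?] := vn n; apply/andP; split; lra.
by rewrite -[X in _ --> X]subr0; apply: cvgB => //; exact: cvg_cst.
Qed.

(** A copy of [vol] that carries the sigma-finite structure required by Fubini in space-time. *)
Definition volume : set (mR * mR * mR)%type -> \bar R := vol R.

HB.instance Definition _ := Measure.on volume.

Lemma sigma_finite_volume : sigma_finite setT volume.
Proof.
have /sigma_finiteP[F [TF ndF Foo]] := sigma_finiteT (@area R).
have /sigma_finiteP[G [TG ndG Goo]] := sigma_finiteT la.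
exists (fun n => F n `*` G n).
  rewrite -setXTT TF TG predeqE => -[x y]; split.
    move=> [/= [n _ Fnx] [k _ Gky]]; exists (maxn n k) => //; split.
    - by move: x Fnx; exact/subsetPset/ndF/leq_maxl.
    - by move: y Gky; exact/subsetPset/ndG/leq_maxr.
  by move=> [n _ []/= ? ?]; split; exists n.
move=> k; have [mF Fk] := Foo k; have [mG Gk] := Goo k.
split; first exact: measurableX.
rewrite [X in (X < _)%E](_ : _ = (@area R (F k) * la (G k))%E).
  by rewrite lte_mul_pinfty// ge0_fin_numE.
exact (@product_measure1E _ _ _ _ R (@area R) la _ _ mF mG).
Qed.

HB.instance Definition _ :=
  Measure_isSigmaFinite.Build _ _ _ volume sigma_finite_volume.

(** Extended by zero, because Fubini is applied on the whole product space. *)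
Definition on_cylinder f : mR * mR * mR * mR -> \bar R :=
  (fun z => (f (row3 z.1, z.2))%:E) \_ (D `*` itv).

Lemma integrable_on_cylinder f : {within closure Q, continuous f} ->
  (volume \x la)%E.-integrable setT (on_cylinder f).
Proof.
move=> cf; have mD := measurable_polyhedron a b.
have mI : measurable (itv : set mR) by exact: measurable_itv.
have mDI : measurable (D `*` itv : set (mR * mR * mR * mR)%type) by exact: measurableX.
apply/integrable_restrict => //; rewrite setTI.
have [C HC] := bounded_on_cylinder cf.
apply: measurable_bounded_integrable => //.
- rewrite [X in (X < _)%E](_ : _ = (volume D * la itv)%E); last first.
    exact (@product_measure1E _ _ _ _ R volume la _ _ mD mI).
  rewrite lte_mul_pinfty//; last exact: finite_itv.
  by rewrite ge0_fin_numE//; exact: vol_finite bO.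
- apply: (@measurable_fun_continuous_in4 R _ (fun z => f (row3 z.1, z.2))) => //.
  apply: (within_comp (g := fun z : R * R * R * R => (row3 z.1, z.2))) cf.
    move=> [q t] /= [Dq]; rewrite in_itv/= => tI.
    by apply/closure_cylinderP; split => //; exact: subset_closure.
  move=> z _; apply: cont_pair; last exact: cvg_snd.
  by apply: (cvg_comp fst (@row3 R)); [exact: cvg_fst|exact: continuous_row3].
- exists C; split; first exact: num_real.
  move=> y Cy [q t] [Dq /=]; rewrite in_itv/= => tI; apply: le_trans (ltW Cy).
  by apply: HC; apply/closure_cylinderP; split => //; exact: subset_closure.
Qed.

Lemma on_cylinder_space f t : 0 <= t <= T ->
  (\int[volume]_q on_cylinder f (q, t) = \int[vol R]_(q in D) (f (row3 q, t))%:E)%E.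
Proof.
move=> tT; rewrite [RHS]integral_mkcond; apply: eq_integral => q _.
rewrite /on_cylinder !patchE; case: ifPn => [|/negP].
  by rewrite inE => -[Dq _]; rewrite mem_set.
by rewrite inE => H; rewrite memNset// => Dq; apply: H; split => //=.
Qed.

Lemma on_cylinder_time f q :
  (\int[la]_t on_cylinder f (q, t) =
   if q \in D then \int[la]_(t in itv) (f (row3 q, t))%:E else 0)%E.
Proof.
case: ifPn => Dq.
  rewrite [RHS]integral_mkcond; apply: eq_integral => t _.
  rewrite /on_cylinder !patchE; congr (if _ then _ else _).
  apply/idP/idP => [/set_mem[_ ?]|/set_mem tI]; first exact: mem_set.
  by apply: mem_set; split => //; exact: set_mem.
apply: integral0_eq => t _; rewrite /on_cylinder patchE memNset// => -[Dq' _].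
by move/negP: Dq; apply; exact: mem_set.
Qed.

(** Measurability in time comes from Fubini, and the bound from compactness of the closed
    cylinder. *)
Lemma integrable_space_integral f : {within closure Q, continuous f} ->
  la.-integrable itv (EFin \o space_integral f).
Proof.
move=> cf; have mF := measurable_fubini_G (integrable_on_cylinder cf).
have mI : measurable (itv : set mR) by exact: measurable_itv.
have mD := measurable_polyhedron a b.
have [C HC] := bounded_on_cylinder cf.
apply: measurable_bounded_integrable => //.
- exact: finite_itv.
- apply/measurable_EFinP; apply: eq_measurable_fun (measurable_funTS mF) => t.
  rewrite inE /= in_itv/= => tT.
  rewrite /fubini_G on_cylinder_space// /space_integral /Rintegral fineK//.
  exact: (integrable_fin_num mD (integrable_slice cf tT)).
- exists (\int[vol R]_(q in D) C); split; first exact: num_real.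
  move=> y Cy t /=; rewrite in_itv/= => tT; apply: le_trans (ltW Cy).
  have ig := integrable_slice cf tT.
  apply: (le_trans (le_normr_Rintegral mD ig)); apply: le_Rintegral => //.
  + exact: (integrable_norm ig).
  + exact (integrable_closure bO (@within_cst _ _ (closure Om) C)).
  + move=> q Dq; apply: HC; apply/closure_cylinderP.
    by split => //; exact: subset_closure.
Qed.

Lemma fubini_cylinder f : {within closure Q, continuous f} ->
  \int[la]_(t in itv) space_integral f t =
  \int[vol R]_(q in D) \int[la]_(t in itv) f (row3 q, t).
Proof.
move=> cf; have ic := integrable_on_cylinder cf.
have F := Fubini ic; rewrite /Rintegral; congr fine.
transitivity (\int[la]_t \int[volume]_q on_cylinder f (q, t))%E.
  rewrite integral_mkcond; apply: eq_integral => t _.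
  rewrite patchE; case: ifPn => [|/negP]; rewrite inE /= in_itv/= => tT.
    rewrite on_cylinder_space// fineK//.
    exact: (integrable_fin_num (measurable_polyhedron a b) (integrable_slice cf tT)).
  rewrite integral0_eq// => q _; rewrite /on_cylinder patchE memNset// => -[_] /=.
  by rewrite in_itv.
rewrite -F [RHS]integral_mkcond; apply: eq_integral => q _.
rewrite on_cylinder_time patchE; case: ifPn => // /set_mem Dq.
rewrite fineK//; apply: integrable_fin_num; first exact: measurable_itv.
apply: continuous_compact_integrable; first exact: segment_compact.
exact: (time_slice cf (closure_row3 Dq)).
Qed.

Lemma is_derive_time f g x t : (forall z, Q z -> is_derive z (bt R) f (g z)) ->
  Om x -> 0 < t < T -> is_derive t 1 (fun s => f (x, s)) (g (x, t)).
Proof.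
move=> df Ox tT; have := is_derive_line (r := t) (z := (x, 0)) (v := bt R) (f := f) (d := g (x, t)).
have E s : s *: bt R + (x, 0) = (x, s).
  by apply/pair_equal_spec; split => /=; rewrite ?scaler0 ?add0r// addr0 [s *: 1]mulr1.
rewrite E => /(_ (df _ _)); rewrite (_ : (fun r => _) = (fun s => f (x, s))).
  by apply; split.
by apply/funext => s; rewrite E.
Qed.

Lemma is_derive_space f (k : 'I_3) x t (l : R) : is_derive (x, t) (bx R k) f l ->
  is_derive x (delta_mx 0 k) (fun y => f (y, t)) l.
Proof.
have E r : r *: bx R k + (x, t) = (r *: delta_mx 0 k + x, t).
  by apply/pair_equal_spec; split => //=; rewrite scaler0 add0r.
have E0 : (0 : R) *: delta_mx 0 k + x = x by rewrite scale0r add0r.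
rewrite -[in X in X -> _]E0 -E => /is_derive_line df.
rewrite -[x in is_derive x]E0; apply/is_derive_lineP.
by rewrite (_ : (fun r => _) = (fun r => f (r *: bx R k + (x, t))))//; apply/funext => r; rewrite E.
Qed.

(** The fundamental theorem of calculus is used on the time segment over each point, followed by
    Fubini; this avoids differentiating under the integral sign. *)
Lemma space_integral_ftc e e' : {within closure Q, continuous e} ->
  {within closure Q, continuous e'} -> (forall z, Q z -> is_derive z (bt R) e (e' z)) ->
  space_integral e T - space_integral e 0 = \int[la]_(t in itv) space_integral e' t.
Proof.
move=> ce ce' de; have mD := measurable_polyhedron a b.
have TT : 0 <= T <= T by rewrite lexx ltW.
have T00 : 0 <= (0 : R) <= T by rewrite lexx ltW.
rewrite fubini_cylinder// /space_integral -RintegralB//; [|exact: integrable_slice..].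
apply: eq_Rintegral => q; rewrite inE => Dq.
have [cq c0 cT] := (continuous_within_itvP _ T0).1 (time_slice ce (closure_row3 Dq)).
rewrite /Rintegral (@continuous_FTC2 R (fun t => e' (row3 q, t)) (fun t => e (row3 q, t)))//.
- exact: (time_slice ce' (closure_row3 Dq)).
- split => // t; rewrite in_itv/= => tT.
  by have [] := is_derive_time de Dq tT.
- move=> t; rewrite in_itv/= => tT; rewrite derive1E.
  by have [] := is_derive_time de Dq tT.
Qed.

(** Continuity up to the closure is included because additivity of the integral and the passage to
    the end times rely on it. *)
Definition zero_mean g := {within closure Q, continuous g} /\
  forall t, 0 < t < T -> space_integral g t = 0.

Lemma zero_mean_div (F G : 'I_3 -> 'rV[R]_3 * R -> R) :
  (forall k, {within closure Q, continuous (F k)}) ->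
  (forall k, {within closure Q, continuous (G k)}) ->
  (forall k z, Q z -> is_derive z (bx R k) (F k) (G k z)) ->
  (forall x n t, boundary Om x -> outward_unit_normal Om x n -> 0 < t < T ->
     \sum_k F k (x, t) * n 0 k = 0) ->
  zero_mean (fun z => \sum_k G k z).
Proof.
move=> cF cG dF F0; split => [|t tT]; first exact: within_sum.
have tT' : 0 <= t <= T by case/andP: tT => ? ?; rewrite !ltW.
apply: (integral_div_eq0 bO (F := fun k x => F k (x, t)) (G := fun k x => G k (x, t))).
- by move=> k; exact: space_slice.
- by move=> k; exact: space_slice.
- by move=> k x Ox; apply: is_derive_space; exact: dF.
- by move=> x n bx on; exact: F0.
Qed.

Lemma zero_mean_add f g : zero_mean f -> zero_mean g -> zero_mean (fun z => f z + g z).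
Proof.
move=> [cf f0] [cg g0]; split => [|t tT]; first exact: within_add.
have tT' : 0 <= t <= T by case/andP: tT => ? ?; rewrite !ltW.
rewrite /space_integral RintegralD; [|exact: measurable_polyhedron|exact: integrable_slice..].
by rewrite -/(space_integral f t) -/(space_integral g t) f0// g0// addr0.
Qed.

Lemma zero_mean_scale f (c : R) : zero_mean f -> zero_mean (fun z => c * f z).
Proof.
move=> [cf f0]; split => [|t tT]; first by apply: within_mul => //; exact: within_cst.
have tT' : 0 <= t <= T by case/andP: tT => ? ?; rewrite !ltW.
rewrite /space_integral RintegralZl; [|exact: measurable_polyhedron|exact: integrable_slice].
by rewrite -/(space_integral f t) f0// mulr0.
Qed.

Lemma zero_mean_eq f g : (forall z, Q z -> f z = g z) ->
  {within closure Q, continuous g} -> zero_mean f -> zero_mean g.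
Proof.
move=> fg cg [cf f0]; split => // t tT; rewrite -(f0 t tT).
by apply: eq_Rintegral => q; rewrite inE => Dq; rewrite fg.
Qed.

(** [z] collects everything that is integrated by parts. The pointwise inequality is integrated in
    space at each interior time, then in time. *)
Lemma energy_balance e e' d f z : {within closure Q, continuous e} ->
  {within closure Q, continuous e'} -> {within closure Q, continuous d} ->
  {within closure Q, continuous f} -> zero_mean z ->
  (forall y, Q y -> is_derive y (bt R) e (e' y)) ->
  (forall y, Q y -> e' y + d y <= f y + z y) ->
  space_integral e T + \int[la]_(t in itv) space_integral d t <=
  \int[la]_(t in itv) space_integral f t + space_integral e 0.
Proof.
move=> ce ce' cd cf [cz z0] de ineq; have mD := measurable_polyhedron a b.
rewrite -lerBlDr addrAC (space_integral_ftc ce ce' de).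
have mI : measurable (itv : set mR) by exact: measurable_itv.
have ie' := integrable_space_integral ce'.
have id := integrable_space_integral cd.
have if_ := integrable_space_integral cf.
rewrite -RintegralD//.
have mo : measurable (`]0, T[%classic : set mR) by exact: measurable_itv.
(* The two end times are null; discarding them leaves the times at which [z] is known to have zero
   mean. *)
have oo (g : R -> R) : la.-integrable itv (EFin \o g) ->
    \int[la]_(t in itv) g t = \int[la]_(t in `]0, T[) g t.
  move=> ig; rewrite -Rintegral_itv_bndo_bndc.
    rewrite -Rintegral_itv_obnd_cbnd//; apply: integrableS ig => //.
    by move=> t /=; rewrite !in_itv/= => /andP[? ?]; rewrite !ltW.
  apply: integrableS ig => //.
  by move=> t /=; rewrite !in_itv/= => /andP[-> ?]; rewrite ltW.
have sub : `]0, T[ `<=` itv.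
  by move=> t /=; rewrite !in_itv/= => /andP[? ?]; rewrite !ltW.
have isum : la.-integrable itv
    (EFin \o (fun t => space_integral e' t + space_integral d t)).
  by have := integrableD mI ie' id; apply: eq_integrable.
rewrite !oo//; apply: le_Rintegral => //.
- exact: integrableS isum.
- exact: integrableS if_.
move=> t; rewrite /= in_itv/= => tT.
have tT' : 0 <= t <= T by case/andP: tT => ? ?; rewrite !ltW.
rewrite -[leRHS]addr0 -(z0 t tT) /space_integral -!RintegralD//; [|exact: integrable_slice..].
apply: le_Rintegral => //.
- by apply: (integrable_slice (f := fun y => e' y + d y)) => //; exact: within_add.
- by apply: (integrable_slice (f := fun y => f y + z y)) => //; exact: within_add.
- by move=> q Dq; exact: ineq.
Qed.

End SpaceTime.

(** * Calculus of partial derivatives up to the boundary *)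

Section PartialDerivatives.
Variables (R : realType) (Q : set ('rV[R]_3 * R)).
Hypothesis oQ : open Q.
Local Notation pt := ('rV[R]_3 * R)%type.
Implicit Types (f g : pt -> R) (v w z : pt).

Definition axis v := v = bt R \/ exists i, v = bx R i.

Lemma axis_bt : axis (bt R). Proof. by left. Qed.

Lemma axis_bx i : axis (bx R i). Proof. by right; exists i. Qed.

Lemma is_derive_add f g v z (df dg : R) : is_derive z v f df -> is_derive z v g dg ->
  is_derive z v (fun y => f y + g y) (df + dg).
Proof. by move=> Hf Hg; exact: (is_deriveD Hf Hg). Qed.

Lemma is_derive_mul f g v z (df dg : R) : is_derive z v f df -> is_derive z v g dg ->
  is_derive z v (fun y => f y * g y) (df * g z + f z * dg).
Proof.
move=> Hf Hg; have := is_deriveM Hf Hg.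
by rewrite (_ : f z *: dg + g z *: df = df * g z + f z * dg)// /GRing.scale /=; ring.
Qed.

Lemma is_derive_bigsum n (f : 'I_n -> pt -> R) v z (df : 'I_n -> R) :
  (forall i, is_derive z v (f i) (df i)) ->
  is_derive z v (fun y => \sum_i f i y) (\sum_i df i).
Proof.
move=> Hf; have := is_derive_sum Hf.
by rewrite (_ : \sum_i f i = fun y => \sum_i f i y)//; apply/funext => y; rewrite fct_sumE.
Qed.

Lemma near_open z : Q z -> \forall y \near z, Q y.
Proof. by move=> Qz; exact: open_nbhs_nbhs. Qed.

Lemma within_closure_proper z : closure Q z -> ProperFilter (within Q (nbhs z)).
Proof.
move=> cz; split; last by typeclasses eauto.
by move=> /cz[y [Qy]]; exact.
Qed.

(** [pd] is a limit along [within Q (nbhs z)], a proper filter for [z] in the closure, so every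
    continuous extension of the derivative coincides with it. The calculus rules reach the boundary
    through this lemma. *)
Lemma pd_closure f g v z : (forall y, Q y -> is_derive y v f (g y)) ->
  {within closure Q, continuous g} -> closure Q z -> pd Q v f z = g z.
Proof.
move=> df /subspace_continuousP cg cz; have PF := within_closure_proper cz.
apply: cvg_lim => //.
have H : g y @[y --> within Q (nbhs z)] --> g z.
  apply: cvg_trans (cg _ cz) => W; rewrite /within/= /nbhs/=.
  by apply: filterS => y Hy Qy; apply: Hy; exact: subset_closure.
apply: cvg_trans H; apply: near_eq_cvg.
have H : \forall y \near z, Q y -> g y = 'D_v f y.
  by apply: filterE => y Qy; have [_ ->] := df y Qy.
exact: H.
Qed.

(** Both the limit and the derivatives inside it look at the open set [Q] only; a field known only
    there can thus be replaced by its formula. *)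
Lemma pd_eq_on f g v : (forall y, Q y -> f y = g y) -> pd Q v f = pd Q v g.
Proof.
move=> fg; apply/funext => z; rewrite /pd; congr (lim _).
have E y : Q y -> 'D_v f y = 'D_v g y.
  by move=> Qy; apply: near_eq_derive; apply: filterS (near_open Qy) => ? /fg.
apply/seteqP; split => W; rewrite /= /within /= /nbhs/=; apply: filterS => y Hy Qy.
  by rewrite -E//; exact: Hy.
by rewrite E//; exact: Hy.
Qed.

Lemma Ck_continuous k f : Ck Q k f -> {within closure Q, continuous f}.
Proof. by case: k => [|k] []. Qed.

Lemma Ck_pd k f v : axis v -> Ck Q k.+1 f -> Ck Q k (pd Q v f).
Proof. by move=> av [_ /(_ v av)[]]. Qed.

Lemma Ck_is_derive k f v z : axis v -> Ck Q k.+1 f -> Q z ->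
  is_derive z v f (pd Q v f z).
Proof. by move=> av [_ /(_ v av)[+ _]] Qz; exact. Qed.

Lemma Ck_pred k f : Ck Q k.+1 f -> Ck Q k f.
Proof.
elim: k f => [|k IH] f; first by case.
by move=> [cf H]; split => // v av; have [dv /IH] := H v av.
Qed.

Lemma continuous_pd k f v : axis v -> Ck Q k.+1 f -> {within closure Q, continuous (pd Q v f)}.
Proof. by move=> av /(Ck_pd av); exact: Ck_continuous. Qed.

Lemma Ck1_intro f (df : pt -> pt -> R) : {within closure Q, continuous f} ->
  (forall v, axis v -> (forall z, Q z -> is_derive z v f (df v z)) /\
     {within closure Q, continuous (df v)}) ->
  Ck Q 1 f.
Proof.
move=> cf H; split=> // v av; have [dv cv] := H v av.
have E z : closure Q z -> df v z = pd Q v f z by move=> cz; rewrite (pd_closure dv).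
split=> [z Qz|]; first by rewrite -E; [exact: dv|exact: subset_closure].
by split=> //; exact: within_eq cv.
Qed.

Lemma Ck1_cst (c : R) : Ck Q 1 (fun=> c).
Proof.
apply: (Ck1_intro (df := fun _ _ => 0)); first exact: within_cst.
by move=> v av; split=> [z Qz|]; [exact: is_derive_cst|exact: within_cst].
Qed.

Lemma pd_cst (c : R) v z : closure Q z -> pd Q v (fun=> c) z = 0.
Proof.
move=> cz; have dc y : Q y -> is_derive y v (fun=> c) 0 by move=> _; exact: is_derive_cst.
exact (pd_closure (f := fun=> c) (g := fun=> 0) dc (@within_cst _ _ (closure Q) 0) cz).
Qed.

Lemma Ck1_add_pd f g : Ck Q 1 f -> Ck Q 1 g -> Ck Q 1 (fun z => f z + g z) /\
  forall v z, axis v -> closure Q z ->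
    pd Q v (fun z => f z + g z) z = pd Q v f z + pd Q v g z.
Proof.
move=> Cf Cg; pose df v z := pd Q v f z + pd Q v g z.
have H v : axis v -> (forall z, Q z -> is_derive z v (fun z => f z + g z) (df v z)) /\
     {within closure Q, continuous (df v)}.
  move=> av; split=> [z Qz|].
    exact: is_derive_add (Ck_is_derive av Cf Qz) (Ck_is_derive av Cg Qz).
  exact: within_add (continuous_pd av Cf) (continuous_pd av Cg).
split; first by apply: Ck1_intro H; exact: within_add (Ck_continuous Cf) (Ck_continuous Cg).
by move=> v z /H[dv cv] cz; exact: pd_closure.
Qed.

Lemma Ck1_mul_pd f g : Ck Q 1 f -> Ck Q 1 g -> Ck Q 1 (fun z => f z * g z) /\
  forall v z, axis v -> closure Q z ->
    pd Q v (fun z => f z * g z) z = pd Q v f z * g z + f z * pd Q v g z.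
Proof.
move=> Cf Cg; pose df v z := pd Q v f z * g z + f z * pd Q v g z.
have H v : axis v -> (forall z, Q z -> is_derive z v (fun z => f z * g z) (df v z)) /\
     {within closure Q, continuous (df v)}.
  move=> av; split=> [z Qz|].
    exact: is_derive_mul (Ck_is_derive av Cf Qz) (Ck_is_derive av Cg Qz).
  apply: within_add; [apply: within_mul (continuous_pd av Cf) (Ck_continuous Cg)|].
  exact: within_mul (Ck_continuous Cf) (continuous_pd av Cg).
split; first by apply: Ck1_intro H; exact: within_mul (Ck_continuous Cf) (Ck_continuous Cg).
by move=> v z /H[dv cv] cz; exact: pd_closure.
Qed.

Lemma Ck1_sum_pd n (f : 'I_n -> pt -> R) : (forall i, Ck Q 1 (f i)) ->
  Ck Q 1 (fun z => \sum_i f i z) /\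
  forall v z, axis v -> closure Q z ->
    pd Q v (fun z => \sum_i f i z) z = \sum_i pd Q v (f i) z.
Proof.
move=> Cf; pose df v z := \sum_i pd Q v (f i) z.
have H v : axis v -> (forall z, Q z -> is_derive z v (fun z => \sum_i f i z) (df v z)) /\
     {within closure Q, continuous (df v)}.
  move=> av; split=> [z Qz|].
    by apply: is_derive_bigsum => i; apply: Ck_is_derive => //; exact: Cf.
  by apply: within_sum => i; apply: continuous_pd => //; exact: Cf.
split.
  by apply: Ck1_intro H; apply: within_sum => i; apply: Ck_continuous; exact: Cf.
by move=> v z /H[dv cv] cz; exact: pd_closure.
Qed.

Lemma Ck1_add f g : Ck Q 1 f -> Ck Q 1 g -> Ck Q 1 (fun z => f z + g z).
Proof. by move=> Cf Cg; have [] := Ck1_add_pd Cf Cg. Qed.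

Lemma Ck1_mul f g : Ck Q 1 f -> Ck Q 1 g -> Ck Q 1 (fun z => f z * g z).
Proof. by move=> Cf Cg; have [] := Ck1_mul_pd Cf Cg. Qed.

Lemma Ck1_sum n (f : 'I_n -> pt -> R) : (forall i, Ck Q 1 (f i)) ->
  Ck Q 1 (fun z => \sum_i f i z).
Proof. by move=> Cf; have [] := Ck1_sum_pd Cf. Qed.

Lemma pd_add f g v z : Ck Q 1 f -> Ck Q 1 g -> axis v -> closure Q z ->
  pd Q v (fun z => f z + g z) z = pd Q v f z + pd Q v g z.
Proof. by move=> Cf Cg; have [_] := Ck1_add_pd Cf Cg; exact. Qed.

Lemma pd_mul f g v z : Ck Q 1 f -> Ck Q 1 g -> axis v -> closure Q z ->
  pd Q v (fun z => f z * g z) z = pd Q v f z * g z + f z * pd Q v g z.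
Proof. by move=> Cf Cg; have [_] := Ck1_mul_pd Cf Cg; exact. Qed.

Lemma pd_sum n (f : 'I_n -> pt -> R) v z : (forall i, Ck Q 1 (f i)) ->
  axis v -> closure Q z ->
  pd Q v (fun z => \sum_i f i z) z = \sum_i pd Q v (f i) z.
Proof. by move=> Cf; have [_] := Ck1_sum_pd Cf; exact. Qed.

Lemma Ck1_opp f : Ck Q 1 f -> Ck Q 1 (fun z => - f z).
Proof.
move=> Cf; rewrite (_ : (fun z => _) = fun z => -1 * f z).
  exact: (Ck1_mul (Ck1_cst (-1)) Cf).
by apply/funext => z; rewrite mulN1r.
Qed.

Lemma pd_opp f v z : Ck Q 1 f -> axis v -> closure Q z ->
  pd Q v (fun z => - f z) z = - pd Q v f z.
Proof.
move=> Cf av cz; rewrite (_ : (fun z => _) = fun z => -1 * f z).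
  by rewrite (pd_mul (Ck1_cst (-1)) Cf av cz) pd_cst// mul0r add0r mulN1r.
by apply/funext => y; rewrite mulN1r.
Qed.

Local Opaque Ck.

Lemma pd_comm f v w z : Ck Q 2 f -> axis v -> axis w -> Q z ->
  pd Q w (pd Q v f) z = pd Q v (pd Q w f) z.
Proof.
move=> Cf av aw Qz.
apply: (schwarz (f := f) (fv := pd Q v f) (fw := pd Q w f) (v := v) (w := w)).
- apply: filterS (near_open Qz) => y Qy; split; apply: Ck_is_derive => //.
  + exact: Cf.
  + exact: Cf.
  + exact: Ck_pd Cf.
  + exact: Ck_pd Cf.
- have := continuous_pd aw (Ck_pd av Cf); move=> /(continuous_subspaceW (@subset_closure _ Q)).
  by rewrite continuous_open_subspace// => H; apply: H; rewrite inE.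
- have := continuous_pd av (Ck_pd aw Cf); move=> /(continuous_subspaceW (@subset_closure _ Q)).
  by rewrite continuous_open_subspace// => H; apply: H; rewrite inE.
Qed.

End PartialDerivatives.

Local Opaque Ck pd.
Arguments axis_bx {R} i.

(** * Integration by parts, as identities between functions of zero mean *)

Section ZeroMeanIdentities.
Variables (R : realType) (N : nat) (a : 'I_N -> 'rV[R]_3) (b : 'I_N -> R) (T : R).
Local Notation Om := (polyhedron a b).
Local Notation Q := (cylinder Om T).
Local Notation pt := ('rV[R]_3 * R)%type.
Local Notation "'d_ k" := (pd Q (bx R k)) (at level 0, k at level 0, format "''d_' k").
Hypothesis bO : bounded_set Om.
Hypothesis T0 : 0 < T.
Implicit Types (f g : pt -> R) (A B : 'I_3 -> pt -> R).

Let oQ : open Q. Proof. exact: open_cylinder. Qed.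

Definition tangential A := forall x n t, boundary Om x -> outward_unit_normal Om x n ->
  0 < t < T -> \sum_k A k (x, t) * n 0 k = 0.

Lemma ord3_cycle : (0 : 'I_3) + 1 + 1 + 1 = 0. Proof. exact: val_inj. Qed.

Lemma zero_mean_flux A : (forall k, Ck Q 1 (A k)) -> tangential A ->
  zero_mean a b T (fun z => \sum_k 'd_k (A k) z).
Proof.
move=> CA tA; apply: (zero_mean_div bO T0 (F := A)) => // k.
- exact: Ck_continuous (CA k).
- by apply: continuous_pd (CA k); exact: axis_bx.
- by move=> z Qz; apply: Ck_is_derive (CA k) Qz; exact: axis_bx.
Qed.

(** For solenoidal [A], [A . grad f] is the divergence of [f A]. This covers transport by [u] as
    well as the orthogonality of [k] to gradients. *)
Lemma zero_mean_transport A f : (forall k, Ck Q 1 (A k)) -> Ck Q 1 f -> tangential A ->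
  (forall z, Q z -> \sum_k 'd_k (A k) z = 0) ->
  zero_mean a b T (fun z => \sum_k A k z * 'd_k f z).
Proof.
move=> CA Cf tA divA.
apply: (zero_mean_eq (f := fun z => \sum_k 'd_k (fun z => A k z * f z) z)).
- move=> z Qz; have cz := subset_closure Qz.
  under eq_bigr => k _ do rewrite (pd_mul (CA k) Cf (axis_bx k) cz).
  by rewrite big_split /= -mulr_suml divA// mul0r add0r.
- apply: within_sum => k; apply: within_mul; first exact: Ck_continuous (CA k).
  by apply: continuous_pd Cf; exact: axis_bx.
- apply: zero_mean_flux => [k|x n t bx on tT]; first exact: Ck1_mul (CA k) Cf.
  under eq_bigr do rewrite mulrAC.
  by rewrite -mulr_suml tA// mul0r.
Qed.

Definition vanishing A := forall x t, boundary Om x -> 0 < t < T -> forall k, A k (x, t) = 0.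

Lemma vanishing_tangential A : vanishing A -> tangential A.
Proof. by move=> vA x n t bx _ tT; rewrite big1// => k _; rewrite vA// mul0r. Qed.

(** The integrand is the divergence of [f grad f], which vanishes on the boundary with [f]. *)
Lemma zero_mean_laplacian f : Ck Q 2 f -> (forall x t, boundary Om x -> 0 < t < T -> f (x, t) = 0) ->
  zero_mean a b T (fun z => f z * (\sum_k 'd_k ('d_k f) z) + \sum_k 'd_k f z ^+ 2).
Proof.
move=> Cf f0; have Cf1 : Ck Q 1 f := Ck_pred Cf.
have Cd k : Ck Q 1 ('d_k f) by apply: Ck_pd Cf; exact: axis_bx.
apply: (zero_mean_eq (f := fun z => \sum_k 'd_k (fun z => f z * 'd_k f z) z)).
- move=> z Qz; have cz := subset_closure Qz.
  under eq_bigr => k _ do rewrite (pd_mul Cf1 (Cd k) (axis_bx k) cz) -expr2.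
  have alg (c : R) (p q : 'I_3 -> R) :
    \sum_k (p k + c * q k) = c * \sum_k q k + \sum_k p k.
    by rewrite big_split /= -mulr_sumr addrC.
  exact: (alg (f z) (fun k => 'd_k f z ^+ 2) (fun k => 'd_k ('d_k f) z)).
- apply: within_add.
    apply: within_mul; first exact: Ck_continuous Cf.
    by apply: within_sum => k; apply: continuous_pd (Cd k); exact: axis_bx.
  by apply: within_sum => k; apply: within_mul; exact: Ck_continuous (Cd k).
- apply: zero_mean_flux => [k|x n t bx on tT]; first exact: Ck1_mul Cf1 (Cd k).
  by rewrite big1// => k _; rewrite f0// !mul0r.
Qed.

Definition curlf A k z := 'd_(k + 1) (A (k + 1 + 1)) z - 'd_(k + 1 + 1) (A (k + 1)) z.
Definition divf A z := \sum_k 'd_k (A k) z.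
Definition crossf A B k z := A (k + 1) z * B (k + 1 + 1) z - A (k + 1 + 1) z * B (k + 1) z.

Lemma Ck1_cross A B : (forall k, Ck Q 1 (A k)) -> (forall k, Ck Q 1 (B k)) ->
  forall k, Ck Q 1 (crossf A B k).
Proof.
move=> CA CB k; exact: Ck1_add (Ck1_mul (CA _) (CB _)) (Ck1_opp (Ck1_mul (CA _) (CB _))).
Qed.

Lemma pd_cross A B k v z : (forall k, Ck Q 1 (A k)) -> (forall k, Ck Q 1 (B k)) ->
  axis v -> closure Q z ->
  pd Q v (crossf A B k) z =
    pd Q v (A (k + 1)) z * B (k + 1 + 1) z + A (k + 1) z * pd Q v (B (k + 1 + 1)) z
    - (pd Q v (A (k + 1 + 1)) z * B (k + 1) z + A (k + 1 + 1) z * pd Q v (B (k + 1)) z).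
Proof.
move=> CA CB av cz; rewrite /crossf.
have C1 := Ck1_mul (CA (k + 1)) (CB (k + 1 + 1)).
have C2 := Ck1_mul (CA (k + 1 + 1)) (CB (k + 1)).
by rewrite (pd_add C1 (Ck1_opp C2) av cz) (pd_opp C2 av cz) !(pd_mul (CA _) (CB _) av cz).
Qed.

(** The algebra of [div (A x B) = B . curl A - A . curl B], with the partial derivatives as
    independent numbers. *)
Lemma sum_div_cross (x y : 'I_3 -> R) (dx dy : 'I_3 -> 'I_3 -> R) :
  \sum_k (dx k (k + 1) * y (k + 1 + 1) + x (k + 1) * dy k (k + 1 + 1)
    - (dx k (k + 1 + 1) * y (k + 1) + x (k + 1 + 1) * dy k (k + 1))) =
  \sum_k y k * (dx (k + 1) (k + 1 + 1) - dx (k + 1 + 1) (k + 1))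
  - \sum_k x k * (dy (k + 1) (k + 1 + 1) - dy (k + 1 + 1) (k + 1)).
Proof.
rewrite !(sum_ord3 0) !ord3_cycle.
(* The indices become variables, so that [ring] treats the values at each of them as atoms. *)
move: (0 + 1 + 1 : 'I_3) (0 + 1 : 'I_3) (0 : 'I_3) => i2 i1 i0; ring.
Qed.

Lemma div_cross A B z : (forall k, Ck Q 1 (A k)) -> (forall k, Ck Q 1 (B k)) -> closure Q z ->
  divf (crossf A B) z = \sum_k B k z * curlf A k z - \sum_k A k z * curlf B k z.
Proof.
move=> CA CB cz; rewrite /divf.
under eq_bigr => k _ do rewrite (pd_cross k CA CB (axis_bx k) cz).
exact: (sum_div_cross (fun k => A k z) (fun k => B k z)
  (fun i k => 'd_i (A k) z) (fun i k => 'd_i (B k) z)).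
Qed.

Lemma continuous_curlf A k : (forall k, Ck Q 1 (A k)) ->
  {within closure Q, continuous (curlf A k)}.
Proof.
by move=> CA; rewrite /curlf; apply: within_add; [|apply: within_opp];
  apply: continuous_pd (CA _); exact: axis_bx.
Qed.

Lemma continuous_divf A : (forall k, Ck Q 1 (A k)) -> {within closure Q, continuous (divf A)}.
Proof.
by move=> CA; apply: within_sum => k; apply: continuous_pd (CA k); exact: axis_bx.
Qed.

(** The integrand is the divergence of [A x B], which vanishes on the boundary with [B]. *)
Lemma zero_mean_curl A B : (forall k, Ck Q 1 (A k)) -> (forall k, Ck Q 1 (B k)) ->
  vanishing B ->
  zero_mean a b T (fun z => \sum_k B k z * curlf A k z - \sum_k A k z * curlf B k z).
Proof.
move=> CA CB vB.
apply: (zero_mean_eq (f := divf (crossf A B))).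
- by move=> z Qz; apply: div_cross => //; exact: subset_closure.
- by apply: within_add; [|apply: within_opp]; apply: within_sum => k; apply: within_mul;
    (exact: continuous_curlf || exact: Ck_continuous).
- apply: zero_mean_flux; first exact: Ck1_cross.
  move=> x n t bx on tT; rewrite big1// => k _.
  by rewrite /crossf !vB// !mulr0 subrr mul0r.
Qed.

Lemma Ck1_curlf A k : (forall k, Ck Q 2 (A k)) -> Ck Q 1 (curlf A k).
Proof.
move=> CA; have C i j : Ck Q 1 ('d_i (A j)) by exact: Ck_pd (axis_bx i) (CA j).
exact: Ck1_add (C _ _) (Ck1_opp (C _ _)).
Qed.

Lemma Ck1_divf A : (forall k, Ck Q 2 (A k)) -> Ck Q 1 (divf A).
Proof. by move=> CA; apply: Ck1_sum => k; exact: Ck_pd (axis_bx k) (CA k). Qed.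

Lemma pd_divf A v z : (forall k, Ck Q 2 (A k)) -> axis v -> closure Q z ->
  pd Q v (divf A) z = \sum_k pd Q v ('d_k (A k)) z.
Proof.
by move=> CA av cz; apply: pd_sum => // k; exact: Ck_pd (axis_bx k) (CA k).
Qed.

Lemma pd_curlf A k v z : (forall k, Ck Q 2 (A k)) -> axis v -> closure Q z ->
  pd Q v (curlf A k) z =
  pd Q v ('d_(k + 1) (A (k + 1 + 1))) z - pd Q v ('d_(k + 1 + 1) (A (k + 1))) z.
Proof.
move=> CA av cz.
have C i j : Ck Q 1 ('d_i (A j)) by exact: Ck_pd (axis_bx i) (CA j).
by rewrite /curlf (pd_add (C _ _) (Ck1_opp (C _ _)) av cz) (pd_opp (C _ _) av cz).
Qed.

(** [p l] stands for [d_k d_l A_l] and [q l] for [d_l d_l A_k]. The numbers [x], [y], [z], [w] are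
    the second derivatives in component [k] of the double curl, where [x] and [w] are mixed ones
    taken in the other order. *)
Lemma curl_curl_alg k (c x y z w : R) (p q : 'I_3 -> R) : p k = q k ->
  p (k + 1) = x -> p (k + 1 + 1) = w -> q (k + 1) = y -> q (k + 1 + 1) = z ->
  (\sum_l p l) * c - c * ((x - y) - (z - w)) = c * \sum_l q l.
Proof. by move=> pq <- <- <- <-; rewrite !(sum_ord3 k) pq; ring. Qed.

(* curl curl A = grad div A - Lap A *)
Lemma zero_mean_curl_div A B : (forall k, Ck Q 2 (A k)) -> (forall k, Ck Q 1 (B k)) ->
  tangential (fun k z => divf A z * B k z - crossf (curlf A) B k z) ->
  zero_mean a b T (fun z => \sum_k B k z * (\sum_l 'd_l ('d_l (A k)) z)
    + \sum_k curlf A k z * curlf B k z + divf A z * divf B z).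
Proof.
move=> CA CB tAB.
have CA1 k : Ck Q 1 (A k) by exact: Ck_pred.
have Cc k : Ck Q 1 (curlf A k) by exact: Ck1_curlf.
have Cd : Ck Q 1 (divf A) by exact: Ck1_divf.
have Cl k l : Ck Q 1 ('d_k (A l)) by exact: Ck_pd (axis_bx k) (CA l).
have CX k : Ck Q 1 (crossf (curlf A) B k) by exact: Ck1_cross Cc CB k.
have CdB k : Ck Q 1 (fun z => divf A z * B k z) by exact: Ck1_mul Cd (CB k).
apply: (zero_mean_eq (f := fun z => \sum_k 'd_k (fun z => divf A z * B k z
    - crossf (curlf A) B k z) z)).
- move=> z Qz; have cz := subset_closure Qz.
  have E k : 'd_k (fun z => divf A z * B k z - crossf (curlf A) B k z) z =
      ('d_k (divf A) z * B k z + divf A z * 'd_k (B k) z) - 'd_k (crossf (curlf A) B k) z.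
    rewrite (pd_add (CdB k) (Ck1_opp (CX k)) (axis_bx k) cz).
    by rewrite (pd_mul Cd (CB k) (axis_bx k) cz) (pd_opp (CX k) (axis_bx k) cz).
  under eq_bigr => k _ do rewrite E.
  (* The analytic input is the symmetry of the mixed second derivatives of [A]. *)
  have H : \sum_k 'd_k (divf A) z * B k z - \sum_k B k z * curlf (curlf A) k z =
      \sum_k B k z * (\sum_l 'd_l ('d_l (A k)) z).
    rewrite -sumrB; apply: eq_bigr => k _.
    have C3 : k + 1 + 1 + 1 = k by case: (k) => [[|[|[|//]]] ?]; exact: val_inj.
    rewrite (pd_divf CA (axis_bx k) cz) {1}/curlf !(pd_curlf _ CA (axis_bx _) cz) !C3.
    apply: (@curl_curl_alg k _ _ _ _ _ (fun l => 'd_k ('d_l (A l)) z)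
      (fun l => 'd_l ('d_l (A k)) z)); [by []| | |by []|by []].
    - exact (pd_comm oQ (CA (k + 1)) (axis_bx (k + 1)) (axis_bx k) Qz).
    - exact (pd_comm oQ (CA (k + 1 + 1)) (axis_bx (k + 1 + 1)) (axis_bx k) Qz).
  have DC : \sum_k 'd_k (crossf (curlf A) B k) z =
    \sum_k B k z * curlf (curlf A) k z - \sum_k curlf A k z * curlf B k z.
    exact: div_cross Cc CB cz.
  have DB : \sum_k divf A z * 'd_k (B k) z = divf A z * divf B z by rewrite mulr_sumr.
  rewrite sumrB DC big_split /= DB -H.
  have alg (x y p q : R) : x + p - (y - q) = x - y + q + p by ring.
  exact: alg.
- apply: within_add; [apply: within_add|].
  + apply: within_sum => k; apply: within_mul; first exact: Ck_continuous.
    apply: within_sum => l; apply: continuous_pd (Cl _ _); exact: axis_bx.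
  + by apply: within_sum => k; apply: within_mul; exact: continuous_curlf.
  + by apply: within_mul; exact: continuous_divf.
- exact (zero_mean_flux (fun k => Ck1_add (CdB k) (Ck1_opp (CX k))) tAB).
Qed.

(** The integrand is the divergence of [(div A) A], the inner sum being [d_k (div A)]. *)
Lemma zero_mean_grad_div A : (forall k, Ck Q 2 (A k)) -> vanishing A ->
  zero_mean a b T (fun z => \sum_k A k z * (\sum_l 'd_k ('d_l (A l)) z) + divf A z ^+ 2).
Proof.
move=> CA vA; have CA1 k : Ck Q 1 (A k) by exact: Ck_pred.
have Cd : Ck Q 1 (divf A) by exact: Ck1_divf.
apply: (zero_mean_eq (f := fun z => \sum_k 'd_k (fun z => A k z * divf A z) z)).
- move=> z Qz; have cz := subset_closure Qz.
  under eq_bigr => k _ do rewrite (pd_mul (CA1 k) Cd (axis_bx k) cz) (pd_divf CA (axis_bx k) cz).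
  have alg (c : R) (p q : 'I_3 -> R) :
    \sum_k (p k * c + q k) = \sum_k q k + (\sum_k p k) * c.
    by rewrite big_split /= -mulr_suml addrC.
  exact: (alg (divf A z) (fun k => 'd_k (A k) z)
    (fun k => A k z * (\sum_l 'd_k ('d_l (A l)) z))).
- apply: within_add; last by apply: within_mul; exact: continuous_divf.
  apply: within_sum => k; apply: within_mul; first exact: Ck_continuous.
  apply: within_sum => l; apply: continuous_pd; [exact: axis_bx|].
  by apply: Ck_pd (CA l); exact: axis_bx.
- apply: zero_mean_flux => [k|x n t bx on tT]; first exact: Ck1_mul (CA1 k) Cd.
  by rewrite big1// => k _; rewrite vA// !mul0r.
Qed.

End ZeroMeanIdentities.

(** * The energy balance at one point of space-time *)

(** All values and derivatives are independent numbers: [UU] stands for [(u . grad) u], [MH] for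
    [(m . grad) h], [LU] for a Laplacian, [G] for [grad div w], and so on. The long sum on the right
    gathers the terms of zero mean. The share [nur] of the viscosity goes through curl and
    divergence, so that with [4 nur w] and the two curl couplings it forms the square of
    [curl u - 2 w]; the share [nu] gives the full gradient. As [curl h = 0] and [div h = - div m],
    testing the diffusion of [m] with [- h] produces the square of [div h]. *)
Lemma pointwise_balance (R : realFieldType) (nu nur mu0 jj c1 c2 sigma kappa0 TT : R)
    (U W M H HA K Ut Wt Mt Ht HAt Kt UU UW UM UH MH LU LW LM P cU cW cM cH G gU gW : 'I_3 -> R)
    (dU dW dM dH : R) :
  0 <= mu0 -> 0 <= kappa0 -> 0 < TT ->
  (forall k, Ut k + UU k - (nu + nur) * LU k + P k = 2 * nur * cW k + mu0 * MH k) ->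
  (forall k, jj * Wt k + jj * UW k - c1 * LW k - c2 * G k + 4 * nur * W k =
     2 * nur * cU k + mu0 * (M (k + 1) * H (k + 1 + 1) - M (k + 1 + 1) * H (k + 1))) ->
  (forall k, Mt k + UM k - sigma * LM k =
     W (k + 1) * M (k + 1 + 1) - W (k + 1 + 1) * M (k + 1) - TT^-1 * (M k - kappa0 * H k)) ->
  (forall k, K k = H k + (M k - HA k)) -> (forall k, Kt k = Ht k + (Mt k - HAt k)) ->
  (forall k, cH k = 0) -> dU = 0 -> dH = - dM ->
  \sum_k M k * UH k = \sum_k U k * MH k ->
  2^-1 * (\sum_k (Ut k * U k + U k * Ut k) + jj * \sum_k (Wt k * W k + W k * Wt k)
          + mu0 * \sum_k (Mt k * M k + M k * Mt k) + mu0 * \sum_k (Ht k * H k + H k * Ht k))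
    + - mu0 * \sum_k (Kt k * H k + K k * Ht k)
  + (nu * \sum_k gU k + c1 * \sum_k gW k + sigma * mu0 * \sum_k cM k * cM k
     + sigma * mu0 * (dM * dM) + sigma * mu0 * (dH * dH) + c2 * (dW * dW)
     + nur * \sum_k (cU k - 2 * W k) * (cU k - 2 * W k) + mu0 / TT * \sum_k M k * M k
     + mu0 / (2 * TT) * (2^-1 + 3 * kappa0) * \sum_k H k * H k)
  <= (TT * mu0 * \sum_k HAt k * HAt k + mu0 / (2 * TT) * (1 + kappa0) * \sum_k HA k * HA k)
  + (- 2^-1 * \sum_k (UU k * U k + U k * UU k)
     + ((- jj / 2) * \sum_k (UW k * W k + W k * UW k)
     + ((- mu0 / 2) * \sum_k (UM k * M k + M k * UM k)
     + (mu0 * \sum_k (UM k * H k + M k * UH k)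
     + (- 1 * \sum_k U k * P k
     + (nu * \sum_k (U k * LU k + gU k)
     + (c1 * \sum_k (W k * LW k + gW k)
     + (nur * (\sum_k U k * LU k + \sum_k cU k * cU k + dU * dU)
     + (c2 * (\sum_k W k * G k + dW ^+ 2)
     + (- (2 * nur) * (\sum_k W k * cU k - \sum_k U k * cW k)
     + (mu0 * (sigma * (\sum_k M k * LM k + \sum_k cM k * cM k + dM * dM))
     + (- mu0 * (sigma * (\sum_k H k * LM k + \sum_k cM k * cH k + dM * dH))
     + (- mu0 * \sum_k K k * Ht k
     + (1 + kappa0) * mu0 / TT * \sum_k K k * H k))))))))))))).
Proof.
move=> mu0_ge0 k0_ge0 TT_gt0 E1 E2 E3 EK EKt cH0 -> -> EMH.
have TT0 : TT != 0 by rewrite gt_eqF.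
have Z1 : \sum_k U k * (Ut k + UU k - (nu + nur) * LU k + P k - (2 * nur * cW k + mu0 * MH k)) = 0.
  by rewrite big1// => k _; rewrite E1 subrr mulr0.
have Z2 : \sum_k W k * (jj * Wt k + jj * UW k - c1 * LW k - c2 * G k + 4 * nur * W k
    - (2 * nur * cU k + mu0 * (M (k + 1) * H (k + 1 + 1) - M (k + 1 + 1) * H (k + 1)))) = 0.
  by rewrite big1// => k _; rewrite E2 subrr mulr0.
have Z3 : \sum_k (M k - H k) * (Mt k + UM k - sigma * LM k - (W (k + 1) * M (k + 1 + 1)
    - W (k + 1 + 1) * M (k + 1) - TT^-1 * (M k - kappa0 * H k))) = 0.
  by rewrite big1// => k _; rewrite E3 subrr mulr0.
(* Young's inequality for [d_t h_a . h], with the weight that yields the forcing coefficient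
   [TT * mu0] and costs [mu0 / (4 TT)] of the [|h|^2] term. *)
have S1 : 0 <= mu0 / (4 * TT) * \sum_k (2 * TT * HAt k - H k) ^+ 2.
  by rewrite mulr_ge0 ?divr_ge0 ?mulr_ge0 ?(ltW TT_gt0)//; apply: sumr_ge0 => k _; exact: sqr_ge0.
(* Young's inequality for [h_a . h]. Since [m . h = k . h - |h|^2 + h_a . h], relaxation provides
   [(1 + 2 kappa0) mu0 / TT] times [|h|^2]. This square costs [(1 + kappa0) mu0 / (2 TT)] of it, and
   with the cost of [S1] the coefficient in the dissipation remains. *)
have S2 : 0 <= (1 + kappa0) * mu0 / (2 * TT) * \sum_k (HA k - H k) ^+ 2.
  rewrite mulr_ge0 ?divr_ge0 ?mulr_ge0 ?addr_ge0 ?(ltW TT_gt0)//.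
  by apply: sumr_ge0 => k _; exact: sqr_ge0.
have Z4 : mu0 * (\sum_k M k * UH k - \sum_k U k * MH k) = 0 by rewrite EMH subrr mulr0.
rewrite -subr_ge0.
(* Right side minus left side equals the two squares plus a combination of the tested equations, all
   zero; a rational identity is left. *)
have alg (x y s z1 z2 z3 z4 : R) : 0 <= s -> z1 = 0 -> z2 = 0 -> z3 = 0 -> z4 = 0 ->
    x - y - s = z4 - z1 - z2 - mu0 * z3 -> 0 <= x - y.
  by move=> ? -> -> -> -> /eqP; rewrite mulr0 !subr0 subr_eq0 => /eqP ->.
apply: (alg _ _ _ _ _ _ _ (addr_ge0 S1 S2) Z1 Z2 Z3 Z4).
rewrite !(sum_ord3 0) !ord3_cycle !EK !EKt !cH0.
move: (0 + 1 + 1 : 'I_3) (0 + 1 : 'I_3) (0 : 'I_3) => i2 i1 i0.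
by field.
Qed.

(** * The energy inequality in terms of densities *)

Lemma is_derive_scale (R : realType) (V : normedModType R) (f : V -> R) v z (df c : R) :
  is_derive z v f df -> is_derive z v (fun y => c * f y) (c * df).
Proof. by move=> d; exact: (is_deriveZ (f := f) c d). Qed.

Definition sumsq (R : realType) (S : Type) (A : 'I_3 -> S -> R) z := \sum_k A k z * A k z.

Section EnergyInequality.
Variables (R : realType) (N : nat) (a : 'I_N -> 'rV[R]_3) (b : 'I_N -> R) (T : R).
Local Notation Om := (polyhedron a b).
Local Notation Q := (cylinder Om T).
Local Notation pt := ('rV[R]_3 * R)%type.
Local Notation "'d_ k" := (pd Q (bx R k)) (at level 0, k at level 0, format "''d_' k").
Local Notation "'dt" := (pd Q (bt R)).
Hypothesis bO : bounded_set Om.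
Hypothesis T0 : 0 < T.

Let oQ : open Q. Proof. exact: open_cylinder. Qed.

Implicit Types (f g : pt -> R) (A B C : 'I_3 -> pt -> R).

Definition advf (A B : 'I_3 -> pt -> R) k z := \sum_i A i z * 'd_i (B k) z.
Definition lapf (f : pt -> R) z := \sum_i 'd_i ('d_i f) z.

Lemma zero_mean_sum n (f : 'I_n -> pt -> R) : (forall i, zero_mean a b T (f i)) ->
  zero_mean a b T (fun z => \sum_i f i z).
Proof.
elim: n f => [|n IHn] f zf.
  apply: (zero_mean_eq (f := fun z => 0 * 0)); first by move=> z _; rewrite big_ord0 mul0r.
    by apply: within_sum => -[].
  apply: zero_mean_scale => //; split; first exact: within_cst.
  by move=> t _; rewrite /space_integral Rintegral_cst ?mul0r//; exact: measurable_polyhedron.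
apply: (zero_mean_eq (f := fun z => (\sum_(i < n) f (widen_ord (leqnSn n) i) z) + f ord_max z)).
- by move=> z _; rewrite big_ord_recr.
- by apply: within_sum => i; exact: (zf i).1.
- by apply: zero_mean_add => //; exact: IHn.
Qed.

Lemma zero_mean_advection A B C : (forall k, Ck Q 1 (A k)) -> (forall k, Ck Q 1 (B k)) ->
  (forall k, Ck Q 1 (C k)) -> tangential a b T A ->
  (forall z, Q z -> divf a b T A z = 0) ->
  zero_mean a b T (fun z => \sum_k (advf A B k z * C k z + B k z * advf A C k z)).
Proof.
move=> CA CB CC tA dA; apply: zero_mean_sum => k.
apply: (zero_mean_eq (f := fun z => \sum_i A i z * 'd_i (fun z => B k z * C k z) z)).
- move=> z Qz; have cz := subset_closure Qz.
  under eq_bigr => i _ do rewrite (pd_mul (CB k) (CC k) (axis_bx i) cz).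
  rewrite /advf mulr_suml mulr_sumr -big_split/=; apply: eq_bigr => i _.
  by rewrite mulrDr mulrA mulrCA.
- apply: within_add; apply: within_mul; try exact: Ck_continuous.
  + apply: within_sum => i; apply: within_mul; first exact: Ck_continuous.
    by apply: continuous_pd (CB k); exact: axis_bx.
  + apply: within_sum => i; apply: within_mul; first exact: Ck_continuous.
    by apply: continuous_pd (CC k); exact: axis_bx.
- by apply: zero_mean_transport => //; apply: Ck1_mul.
Qed.

Variables (nu nur mu0 jj c1 c2 sigma kappa0 TT : R).
Variables (U W M HA : 'I_3 -> pt -> R) (p phi : pt -> R).
Hypotheses (mu0_ge0 : 0 <= mu0) (k0_ge0 : 0 <= kappa0) (TT_gt0 : 0 < TT).
Hypotheses (CHA : forall k, Ck Q 1 (HA k)) (CU : forall k, Ck Q 2 (U k))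
  (CW : forall k, Ck Q 2 (W k)) (CM : forall k, Ck Q 2 (M k)) (Cphi : Ck Q 2 phi)
  (Cp : Ck Q 1 p).
Let H k := 'd_k phi.
Let K k z := H k z + (M k z - HA k z).
Local Notation rot := (curlf a b T).
Local Notation dv := (divf a b T).
Hypothesis divHA : forall z, Q z -> dv HA z = 0.
Hypothesis momentum : forall z k, Q z ->
  'dt (U k) z + advf U U k z - (nu + nur) * lapf (U k) z + 'd_k p z =
  2 * nur * rot W k z + mu0 * advf M H k z.
Hypothesis divU : forall z, Q z -> dv U z = 0.
Hypothesis spin : forall z k, Q z ->
  jj * 'dt (W k) z + jj * advf U W k z - c1 * lapf (W k) z
    - c2 * (\sum_l 'd_k ('d_l (W l)) z) + 4 * nur * W k z =
  2 * nur * rot U k z + mu0 * crossf M H k z.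
Hypothesis magnetization : forall z k, Q z ->
  'dt (M k) z + advf U M k z - sigma * lapf (M k) z =
  crossf W M k z - TT^-1 * (M k z - kappa0 * H k z).
Hypotheses (vU : vanishing a b T U) (vW : vanishing a b T W).
Hypothesis poisson : forall z, Q z -> - lapf phi z = dv M z.
Hypothesis tK : tangential a b T K.
Hypothesis sigma_bc : sigma = 0 \/
  (forall x n t, boundary Om x -> outward_unit_normal Om x n -> 0 < t < T ->
    (forall k : 'I_3, rot M (k + 1) (x, t) * n 0 (k + 1 + 1)
      - rot M (k + 1 + 1) (x, t) * n 0 (k + 1) = 0) /\ dv M (x, t) = 0).

Definition energy_density z :=
  2^-1 * (sumsq U z + jj * sumsq W z + mu0 * sumsq M z + mu0 * sumsq H z).

Definition dissipation_density z :=
  nu * (\sum_k \sum_i 'd_i (U k) z ^+ 2) + c1 * (\sum_k \sum_i 'd_i (W k) z ^+ 2)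
  + sigma * mu0 * sumsq (rot M) z + sigma * mu0 * (dv M z * dv M z)
  + sigma * mu0 * (dv H z * dv H z) + c2 * (dv W z * dv W z)
  + nur * sumsq (fun k z => rot U k z - 2 * W k z) z + mu0 / TT * sumsq M z
  + mu0 / (2 * TT) * (2^-1 + 3 * kappa0) * sumsq H z.

Definition forcing_density z :=
  TT * mu0 * sumsq (fun k => 'dt (HA k)) z
  + mu0 / (2 * TT) * (1 + kappa0) * sumsq HA z.

Let CH k : Ck Q 1 (H k). Proof. exact (Ck_pd (axis_bx k) Cphi). Qed.
Let CU1 k : Ck Q 1 (U k). Proof. exact (Ck_pred (CU k)). Qed.
Let CW1 k : Ck Q 1 (W k). Proof. exact (Ck_pred (CW k)). Qed.
Let CM1 k : Ck Q 1 (M k). Proof. exact (Ck_pred (CM k)). Qed.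
Let CK k : Ck Q 1 (K k).
Proof. exact (Ck1_add (CH k) (Ck1_add (CM1 k) (Ck1_opp (CHA k)))). Qed.

Let divH z : Q z -> dv H z = - dv M z.
Proof. by move=> Qz; rewrite -poisson// opprK. Qed.

Let divK z : Q z -> dv K z = 0.
Proof.
move=> Qz; have cz := subset_closure Qz.
rewrite /divf.
under eq_bigr => k _.
  rewrite (pd_add (CH k) (Ck1_add (CM1 k) (Ck1_opp (CHA k))) (axis_bx k) cz).
  rewrite (pd_add (CM1 k) (Ck1_opp (CHA k)) (axis_bx k) cz).
  rewrite (pd_opp (CHA k) (axis_bx k) cz).
  over.
have alg (x y v : 'I_3 -> R) : \sum_k (x k + (y k - v k)) = \sum_k x k + (\sum_k y k - \sum_k v k).
  by rewrite big_split sumrB.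
transitivity (dv H z + (dv M z - dv HA z)).
  exact (alg (fun k => 'd_k (H k) z) (fun k => 'd_k (M k) z) (fun k => 'd_k (HA k) z)).
by rewrite divHA// divH// subr0 addNr.
Qed.

Let symH z k i : Q z -> 'd_i (H k) z = 'd_k (H i) z.
Proof. by move=> Qz; exact (pd_comm oQ Cphi (axis_bx k) (axis_bx i) Qz). Qed.

Let curlH z k : Q z -> rot H k z = 0.
Proof. by move=> Qz; rewrite /curlf symH// subrr. Qed.

(** The factor [sigma] stays inside so that both alternatives give one statement. With diffusion,
    [div m = 0] and [(curl m x B) . n = - B . (curl m x n) = 0] make the flux field tangential. [B]
    needs one derivative only, which admits [B = H]. *)
Let zero_mean_sigma B : (forall k, Ck Q 1 (B k)) ->
  zero_mean a b T (fun z => sigma * (\sum_k B k z * lapf (M k) z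
    + \sum_k rot M k z * rot B k z + dv M z * dv B z)).
Proof.
move=> CB; case: sigma_bc => [->|bc].
  have C0 : Ck Q 1 (fun=> (0 : R)) by exact: Ck1_cst.
  apply: (zero_mean_eq (f := fun z => \sum_(k < 0) 0)).
  - by move=> z _; rewrite big_ord0 mul0r.
  - have e0 : (fun z => 0) = (fun z => 0 * (\sum_k B k z * lapf (M k) z
      + \sum_k rot M k z * rot B k z + dv M z * dv B z)).
      by apply/funext => z; rewrite mul0r.
    by rewrite -e0; exact: within_cst.
  - by apply: zero_mean_sum => -[].
apply: zero_mean_scale => //; apply: zero_mean_curl_div => // x n t bx on tT.
have [cM0 dM0] := bc x n t bx on tT.
under eq_bigr => k _ do rewrite dM0 mul0r sub0r mulNr.
rewrite sumrN; apply/eqP; rewrite oppr_eq0; apply/eqP.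
have Z : \sum_k B k (x, t) * (rot M (k + 1) (x, t) * n 0 (k + 1 + 1)
      - rot M (k + 1 + 1) (x, t) * n 0 (k + 1)) = 0.
  by rewrite big1// => k _; rewrite cM0 mulr0.
have alg (c y v : 'I_3 -> R) :
    \sum_k (c (k + 1) * y (k + 1 + 1) - c (k + 1 + 1) * y (k + 1)) * v k =
    - \sum_k y k * (c (k + 1) * v (k + 1 + 1) - c (k + 1 + 1) * v (k + 1)).
  rewrite !(sum_ord3 0) !ord3_cycle.
  move: (0 + 1 + 1 : 'I_3) (0 + 1 : 'I_3) (0 : 'I_3) => i2 i1 i0; ring.
rewrite (alg (fun k => rot M k (x, t)) (fun k => B k (x, t)) (fun k => n 0 k)).
by rewrite Z oppr0.
Qed.

Let continuous_sumsq A : (forall k, {within closure Q, continuous (A k)}) ->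
  {within closure Q, continuous (sumsq A)}.
Proof. by move=> cA; apply: within_sum => k; exact: within_mul. Qed.

Let cont_fst A : (forall k, Ck Q 1 (A k)) -> forall k, {within closure Q, continuous (A k)}.
Proof. by move=> CA k; exact (Ck_continuous (CA k)). Qed.

Let cont_pd A v : axis v -> (forall k, Ck Q 1 (A k)) ->
  forall k, {within closure Q, continuous (pd Q v (A k))}.
Proof. by move=> av CA k; exact (continuous_pd av (CA k)). Qed.

Let continuous_scale f (c : R) : {within closure Q, continuous f} ->
  {within closure Q, continuous (fun z => c * f z)}.
Proof. by move=> cf; apply: within_mul => //; exact: within_cst. Qed.

Let continuous_dot A B : (forall k, {within closure Q, continuous (A k)}) ->
  (forall k, {within closure Q, continuous (B k)}) ->
  {within closure Q, continuous (fun z => \sum_k A k z * B k z)}.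
Proof. by move=> cA cB; apply: within_sum => k; exact: within_mul. Qed.

Lemma continuous_energy_density : {within closure Q, continuous energy_density}.
Proof.
apply: continuous_scale; do !apply: within_add; do ?apply: continuous_scale;
  by apply: continuous_sumsq; exact: cont_fst.
Qed.

Lemma continuous_dissipation_density : {within closure Q, continuous dissipation_density}.
Proof.
have cg A : (forall k, Ck Q 1 (A k)) ->
    {within closure Q, continuous (fun z => \sum_k \sum_i 'd_i (A k) z ^+ 2)}.
  move=> CA; apply: within_sum => k; apply: within_sum => i.
  by apply: within_mul; exact: continuous_pd (axis_bx i) (CA k).
have cd A : (forall k, Ck Q 1 (A k)) ->
    {within closure Q, continuous (fun z => dv A z * dv A z)}.
  by move=> CA; apply: within_mul; exact: continuous_divf.
do !apply: within_add; apply: continuous_scale; try solve [exact: cg|exact: cd].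
- by apply: continuous_sumsq => k; exact: continuous_curlf.
- apply: continuous_sumsq => k; apply: within_add; first exact: continuous_curlf.
  by apply: within_opp; apply: continuous_scale; exact: cont_fst.
- by apply: continuous_sumsq; exact: cont_fst.
- by apply: continuous_sumsq; exact: cont_fst.
Qed.

Lemma continuous_forcing_density : {within closure Q, continuous forcing_density}.
Proof.
apply: within_add; apply: continuous_scale; apply: continuous_sumsq.
  by apply: cont_pd => //; exact: axis_bt.
exact: cont_fst.
Qed.

(** The matrix of first derivatives of [h] is symmetric, since [h] is a gradient. *)
Let swapH z : Q z -> \sum_k M k z * advf U H k z = \sum_k U k z * advf M H k z.
Proof.
move=> Qz; rewrite /advf.
under eq_bigr do rewrite mulr_sumr.
under [RHS]eq_bigr do rewrite mulr_sumr.
rewrite exchange_big/=; apply: eq_bigr => k _; apply: eq_bigr => i _.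
by rewrite symH// mulrCA.
Qed.

Let dtK z k : Q z -> 'dt (K k) z = 'dt (H k) z + ('dt (M k) z - 'dt (HA k) z).
Proof.
move=> Qz; have cz := subset_closure Qz; have at_ := axis_bt R.
rewrite (pd_add (CH k) (Ck1_add (CM1 k) (Ck1_opp (CHA k))) at_ cz).
by rewrite (pd_add (CM1 k) (Ck1_opp (CHA k)) at_ cz) (pd_opp (CHA k) at_ cz).
Qed.

Let zK : zero_mean a b T (fun z => \sum_k K k z * H k z).
Proof. exact (zero_mean_transport bO T0 CK (Ck_pred Cphi) tK divK). Qed.

(** [d_t h] is the gradient of [d_t phi], which is still C^1. *)
Let zKt : zero_mean a b T (fun z => \sum_k K k z * 'dt (H k) z).
Proof.
have Ct : Ck Q 1 ('dt phi) by exact (Ck_pd (axis_bt R) Cphi).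
apply: (zero_mean_eq (f := fun z => \sum_k K k z * 'd_k ('dt phi) z)).
- move=> z Qz; have E k : 'd_k ('dt phi) z = 'dt (H k) z.
    exact (pd_comm oQ Cphi (axis_bt R) (axis_bx k) Qz).
  by apply: eq_bigr => k _; exact (congr1 (fun r => K k z * r) (E k)).
- by apply: continuous_dot; [exact: cont_fst|exact: cont_pd (axis_bt R) CH].
- exact (zero_mean_transport bO T0 CK Ct tK divK).
Qed.

Let augmented z := energy_density z + - mu0 * \sum_k K k z * H k z.

Let augmented_dt z :=
  2^-1 * (\sum_k ('dt (U k) z * U k z + U k z * 'dt (U k) z)
    + jj * \sum_k ('dt (W k) z * W k z + W k z * 'dt (W k) z)
    + mu0 * \sum_k ('dt (M k) z * M k z + M k z * 'dt (M k) z)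
    + mu0 * \sum_k ('dt (H k) z * H k z + H k z * 'dt (H k) z))
  + - mu0 * \sum_k ('dt (K k) z * H k z + K k z * 'dt (H k) z).

Let is_derive_augmented z : Q z -> is_derive z (bt R) augmented (augmented_dt z).
Proof.
move=> Qz.
have dS A B : (forall k, Ck Q 1 (A k)) -> (forall k, Ck Q 1 (B k)) ->
    is_derive z (bt R) (fun z => \sum_k A k z * B k z)
      (\sum_k ('dt (A k) z * B k z + A k z * 'dt (B k) z)).
  move=> CA CB; apply: is_derive_bigsum => k; apply: is_derive_mul.
    exact (Ck_is_derive (axis_bt R) (CA k) Qz).
  exact (Ck_is_derive (axis_bt R) (CB k) Qz).
apply: is_derive_add; last by apply: is_derive_scale; exact: dS.
apply: is_derive_scale; do !apply: is_derive_add; do ?apply: is_derive_scale; exact: dS.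
Qed.

Let continuous_augmented : {within closure Q, continuous augmented}.
Proof.
apply: within_add; first exact: continuous_energy_density.
by apply: continuous_scale; exact: zK.1.
Qed.

Let continuous_augmented_dt : {within closure Q, continuous augmented_dt}.
Proof.
have cS A B : (forall k, Ck Q 1 (A k)) -> (forall k, Ck Q 1 (B k)) ->
    {within closure Q, continuous
      (fun z => \sum_k ('dt (A k) z * B k z + A k z * 'dt (B k) z))}.
  move=> CA CB; apply: within_sum => k; apply: within_add; apply: within_mul.
  - exact (continuous_pd (axis_bt R) (CA k)).
  - exact: cont_fst.
  - exact: cont_fst.
  - exact (continuous_pd (axis_bt R) (CB k)).
apply: within_add; apply: continuous_scale; last exact: cS.
do !apply: within_add; do ?apply: continuous_scale; exact: cS.
Qed.

Let space_integral_augmented t : t = 0 \/ t = T ->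
  space_integral a b augmented t = space_integral a b energy_density t.
Proof.
move=> tE; have tT : 0 <= t <= T by case: tE => ->; rewrite lexx ltW.
have [cK zK0] := zero_mean_scale bO T0 (- mu0) zK.
have [K0 KT] := space_integral_endpoint0 bO T0 cK zK0.
rewrite /space_integral /augmented RintegralD; last 3 first.
- exact: measurable_polyhedron.
- exact (integrable_slice bO T0 continuous_energy_density tT).
- exact (integrable_slice bO T0 cK tT).
rewrite -/(space_integral a b (fun z => - mu0 * \sum_k K k z * H k z) t).
by case: tE => ->; rewrite ?K0 ?KT addr0.
Qed.

Theorem energy_inequality :
  space_integral a b energy_density T
    + \int[@lebesgue_measure R]_(t in `[0, T]) space_integral a b dissipation_density t
  <= \int[@lebesgue_measure R]_(t in `[0, T]) space_integral a b forcing_density t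
    + space_integral a b energy_density 0.
Proof.
have tU := vanishing_tangential vU.
have zero_mean_lap A : (forall k, Ck Q 2 (A k)) -> vanishing a b T A ->
    zero_mean a b T (fun z => \sum_k (A k z * lapf (A k) z + \sum_i 'd_i (A k) z ^+ 2)).
  move=> CA vA; apply: zero_mean_sum => k; apply: (zero_mean_laplacian bO T0 (CA k)) => x t bx tT.
  exact: vA.
rewrite -!space_integral_augmented; [|by left|by right].
have Z1 := zero_mean_advection CU1 CU1 CU1 tU divU.
have Z2 := zero_mean_advection CU1 CW1 CW1 tU divU.
have Z3 := zero_mean_advection CU1 CM1 CM1 tU divU.
have Z4 := zero_mean_advection CU1 CM1 CH tU divU.
have Z5 := zero_mean_transport bO T0 CU1 Cp tU divU.
have Z6 := zero_mean_lap _ CU vU.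
have Z7 := zero_mean_lap _ CW vW.
have Z8 : zero_mean a b T (fun z => \sum_k U k z * lapf (U k) z
    + \sum_k rot U k z * rot U k z + dv U z * dv U z).
  apply: (zero_mean_curl_div bO T0 CU CU1) => x n t bx on tT.
  by rewrite big1// => k _; rewrite /crossf !vU// !mulr0 subrr subr0 mul0r.
have Z9 := zero_mean_grad_div bO T0 CW vW.
have Z10 := zero_mean_curl bO T0 CU1 CW1 vW.
have Z11 := zero_mean_sigma CM1.
have Z12 := zero_mean_sigma CH.
have zs f c (zf : zero_mean a b T f) := zero_mean_scale bO T0 c zf.
have za f g (zf : zero_mean a b T f) (zg : zero_mean a b T g) := zero_mean_add bO T0 zf zg.
(* The weights are those of [pointwise_balance]. The halves are due to [zero_mean_advection] with
   two equal fields, whose integrand is twice [(u . grad) B . B]. *)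
have ZZ := za _ _ (zs _ (- 2^-1) Z1) (za _ _ (zs _ (- jj / 2) Z2) (za _ _ (zs _ (- mu0 / 2) Z3)
  (za _ _ (zs _ mu0 Z4) (za _ _ (zs _ (- 1) Z5) (za _ _ (zs _ nu Z6) (za _ _ (zs _ c1 Z7)
  (za _ _ (zs _ nur Z8) (za _ _ (zs _ c2 Z9) (za _ _ (zs _ (- (2 * nur)) Z10)
  (za _ _ (zs _ mu0 Z11) (za _ _ (zs _ (- mu0) Z12) (za _ _ (zs _ (- mu0) zKt)
  (zs _ ((1 + kappa0) * mu0 / TT) zK))))))))))))).
apply: (energy_balance bO T0 continuous_augmented continuous_augmented_dt
  continuous_dissipation_density continuous_forcing_density ZZ (@is_derive_augmented)) => z Qz.
have B := @pointwise_balance R nu nur mu0 jj c1 c2 sigma kappa0 TT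
  (fun k => U k z) (fun k => W k z) (fun k => M k z) (fun k => H k z) (fun k => HA k z)
  (fun k => K k z) (fun k => 'dt (U k) z) (fun k => 'dt (W k) z) (fun k => 'dt (M k) z)
  (fun k => 'dt (H k) z) (fun k => 'dt (HA k) z) (fun k => 'dt (K k) z)
  (fun k => advf U U k z) (fun k => advf U W k z) (fun k => advf U M k z)
  (fun k => advf U H k z) (fun k => advf M H k z) (fun k => lapf (U k) z)
  (fun k => lapf (W k) z) (fun k => lapf (M k) z) (fun k => 'd_k p z)
  (fun k => rot U k z) (fun k => rot W k z) (fun k => rot M k z) (fun k => rot H k z)
  (fun k => \sum_l 'd_k ('d_l (W l)) z) (fun k => \sum_i 'd_i (U k) z ^+ 2)
  (fun k => \sum_i 'd_i (W k) z ^+ 2) (dv U z) (dv W z) (dv M z) (dv H z)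
  mu0_ge0 k0_ge0 TT_gt0 (fun k => @momentum z k Qz) (fun k => @spin z k Qz)
  (fun k => @magnetization z k Qz) (fun k => erefl) (fun k => @dtK z k Qz)
  (fun k => @curlH z k Qz) (@divU z Qz) (@divH z Qz) (@swapH z Qz).
exact B.
Qed.

End EnergyInequality.

(** * Norms as integrals of densities, and the translation to components *)

Section NormsAsIntegrals.
Variables (R : realType) (N : nat) (a : 'I_N -> 'rV[R]_3) (b : 'I_N -> R) (T : R).
Local Notation Om := (polyhedron a b).
Local Notation Q := (cylinder Om T).
Local Notation pt := ('rV[R]_3 * R)%type.
Hypothesis bO : bounded_set Om.
Hypothesis T0 : 0 < T.
Variable t : R.
Hypothesis tT : 0 <= t <= T.
Implicit Types (f g : pt -> R) (A : 'I_3 -> pt -> R).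

(** Continuity travels with the value because linearity of the integral needs it; a density is then
    integrated by a term that follows its shape. *)
Definition has_integral f v := {within closure Q, continuous f} /\ space_integral a b f t = v.

Lemma has_integral_add f g v v' : has_integral f v -> has_integral g v' ->
  has_integral (fun z => f z + g z) (v + v').
Proof.
move=> [cf <-] [cg <-]; split; first exact: within_add.
rewrite /space_integral RintegralD//; first exact: measurable_polyhedron.
- exact (integrable_slice bO T0 cf tT).
- exact (integrable_slice bO T0 cg tT).
Qed.

Lemma has_integral_scale f v (c : R) : has_integral f v ->
  has_integral (fun z => c * f z) (c * v).
Proof.
move=> [cf <-]; split; first by apply: within_mul => //; exact: within_cst.
rewrite /space_integral RintegralZl//; first exact: measurable_polyhedron.
exact (integrable_slice bO T0 cf tT).
Qed.

Lemma closure_cylinder_row3 q : (@row3 R @^-1` Om) q -> closure Q (row3 q, t).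
Proof. by move=> Dq; apply/(closure_cylinderP a b T0); split => //; exact: closure_row3. Qed.

Lemma has_integral_L2norm f (F : pt -> R) : {within closure Q, continuous f} ->
  (forall z, closure Q z -> F z = f z) ->
  has_integral (fun z => f z * f z) (L2norm Om (fun x => F (x, t)) ^+ 2).
Proof.
move=> cf Ff; split; first exact: within_mul.
rewrite /L2norm sqr_sqrtr; last by apply: Rintegral_ge0 => q _; exact: sqr_ge0.
by apply: eq_Rintegral => q; rewrite inE => Dq; rewrite Ff ?expr2//; exact: closure_cylinder_row3.
Qed.

Lemma has_integral_mxnorm m n (f : pt -> R) (F : pt -> 'M[R]_(m, n)) :
  {within closure Q, continuous f} ->
  (forall z, closure Q z -> f z = \sum_i \sum_j F z i j ^+ 2) ->
  has_integral f (vL2norm Om (fun x => F (x, t)) ^+ 2).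
Proof.
move=> cf Ff; split => //.
rewrite /vL2norm /L2norm sqr_sqrtr; last by apply: Rintegral_ge0 => q _; exact: sqr_ge0.
apply: eq_Rintegral => q; rewrite inE => Dq; rewrite Ff; last exact: closure_cylinder_row3.
by rewrite /enorm sqr_sqrtr//; apply: sumr_ge0 => i _; apply: sumr_ge0 => j _; exact: sqr_ge0.
Qed.

Lemma has_integral_sumsq A (F : pt -> 'rV[R]_3) :
  (forall k, {within closure Q, continuous (A k)}) ->
  (forall z k, closure Q z -> F z 0 k = A k z) ->
  has_integral (sumsq A) (vL2norm Om (fun x => F (x, t)) ^+ 2).
Proof.
move=> cA FA; apply: has_integral_mxnorm.
  by apply: within_sum => k; exact: within_mul.
by move=> z Qz; rewrite big_ord1; apply: eq_bigr => k _; rewrite FA.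
Qed.

End NormsAsIntegrals.

Lemma cross_eq0 (R : realType) (x n : 'rV[R]_3) (k : 'I_3) : cross x n = 0 ->
  x 0 (k + 1) * n 0 (k + 1 + 1) - x 0 (k + 1 + 1) * n 0 (k + 1) = 0.
Proof. by move=> /(congr1 (fun v : 'rV[R]_3 => v 0 k)); rewrite !mxE. Qed.
Theorem proposition3p1 (R : realType) (Om : set 'rV[R]_3) (tF : R)
  (nu nur mu0 jj c1 c2 sigma kappa0 TT : R)
  (ha u w m h : 'rV[R]_3 * R -> 'rV[R]_3) (p phi : 'rV[R]_3 * R -> R)
  (u0 w0 m0 : 'rV[R]_3 -> 'rV[R]_3) :
  let Q := cylinder Om tF in
  convex_polyhedron Om -> bounded_set Om -> Om !=set0 ->
  0 < tF ->
  0 <= nu -> 0 <= nur -> 0 <= mu0 -> 0 <= jj -> 0 <= c1 -> 0 <= c2 ->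
  0 <= sigma -> 0 <= kappa0 -> 0 < TT ->
  (* the applied field is smooth and harmonic *)
  (forall k, vCk Q k ha) ->
  (forall x t, Om x -> 0 <= t <= tF ->
     curl Q ha (x, t) = 0 /\ div Q ha (x, t) = 0) ->
  (* regularity of the solution *)
  vCk Q 2 u -> vCk Q 2 w -> vCk Q 2 m -> Ck Q 2 phi -> Ck Q 1 p ->
  (* the evolution equations in Om x (0, tF] *)
  (forall x t, Om x -> 0 < t <= tF ->
     dt Q u (x, t) + adv Q u u (x, t) - (nu + nur) *: vlap Q u (x, t)
       + grad Q p (x, t)
     = (2 * nur) *: curl Q w (x, t) + mu0 *: adv Q m h (x, t)) ->
  (forall x t, Om x -> 0 < t <= tF -> div Q u (x, t) = 0) ->
  (forall x t, Om x -> 0 < t <= tF ->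
     jj *: dt Q w (x, t) + jj *: adv Q u w (x, t) - c1 *: vlap Q w (x, t)
       - c2 *: grad Q (div Q w) (x, t) + (4 * nur) *: w (x, t)
     = (2 * nur) *: curl Q u (x, t) + mu0 *: cross (m (x, t)) (h (x, t))) ->
  (forall x t, Om x -> 0 < t <= tF ->
     dt Q m (x, t) + adv Q u m (x, t) - sigma *: vlap Q m (x, t)
     = cross (w (x, t)) (m (x, t))
       - TT^-1 *: (m (x, t) - kappa0 *: h (x, t))) ->
  (* initial and boundary conditions *)
  (forall x, Om x -> u (x, 0) = u0 x /\ w (x, 0) = w0 x /\ m (x, 0) = m0 x) ->
  (forall x t, boundary Om x -> 0 < t < tF ->
     u (x, t) = 0 /\ w (x, t) = 0) ->
  (* the magnetic field *)
  (forall z, closure Q z -> h z = grad Q phi z) ->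
  (forall x t, Om x -> 0 <= t <= tF -> - lap Q phi (x, t) = div Q m (x, t)) ->
  (forall x n t, boundary Om x -> outward_unit_normal Om x n ->
     0 <= t <= tF ->
     dot (grad Q phi (x, t)) n = dot (ha (x, t) - m (x, t)) n) ->
  (* either no diffusion, or diffusion and boundary conditions on m *)
  (sigma = 0 \/
   (0 < sigma /\
    (forall x n t, boundary Om x -> outward_unit_normal Om x n ->
       0 < t < tF -> cross (curl Q m (x, t)) n = 0) /\
    (forall x t, boundary Om x -> 0 < t < tF -> div Q m (x, t) = 0))) ->
  energy Om jj mu0 u w m h tF
    + \int[@lebesgue_measure R]_(s in `[0, tF])
        dissipation Om Q nu nur mu0 c1 c2 sigma kappa0 TT u w m h s
  <= \int[@lebesgue_measure R]_(s in `[0, tF])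
        forcing Om Q mu0 kappa0 TT ha s
     + energy Om jj mu0 u w m h 0.
Proof.
move=> Q [N [a [b OmE]]] bO _ T0 _ _ mu0_ge0 _ _ _ _ k0_ge0 TT_gt0 Cha harm Cu Cw Cm Cphi Cp
  momentum divu spin magnetization _ bc hphi poisson hbc sigma_bc.
have {}OmE : Om = polyhedron a b := OmE; subst Om.
have oQ : open Q by exact: open_cylinder.
pose H k := pd Q (bx R k) phi.
have hE z k : closure Q z -> h z 0 k = H k z by move=> cz; rewrite hphi// mxE.
(* [h] is given as the gradient of [phi] on the closure of [Q] only, but [pd] sees nothing outside
   [Q]. *)
have hpd v k : pd Q v (component h k) = pd Q v (H k).
  by apply: pd_eq_on => // y Qy; rewrite /component hE//; exact: subset_closure.
have CH k : Ck Q 1 (H k) by exact (Ck_pd (axis_bx k) Cphi).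
have Cpred v : vCk Q 2 v -> forall k, Ck Q 1 (component v k).
  by move=> Cv k; exact (Ck_pred (Cv k)).
have inQ x t : Q (x, t) -> polyhedron a b x /\ 0 < t < tF by [].
have lec t : 0 < t < tF -> 0 < t <= tF by case/andP => -> /ltW ->.
have lecc t : 0 < t < tF -> 0 <= t <= tF by case/andP => /ltW -> /ltW ->.
have divHA z : Q z -> divf a b tF (component ha) z = 0.
  by case: z => x t /inQ[Ox tT]; have [_] := harm x t Ox (lecc t tT).
have momentum' z k : Q z ->
    pd Q (bt R) (component u k) z + advf a b tF (component u) (component u) k z
      - (nu + nur) * lapf a b tF (component u k) z + pd Q (bx R k) p z
    = 2 * nur * curlf a b tF (component w) k z + mu0 * advf a b tF (component m) H k z.
  case: z => x t Qz; have [Ox tT] := inQ x t Qz.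
  have := congr1 (fun v : 'rV_3 => v 0 k) (momentum x t Ox (lec t tT)); rewrite !mxE => E.
  rewrite /advf; under [X in _ = _ + _ * X]eq_bigr do rewrite -hpd.
  exact E.
have divU z : Q z -> divf a b tF (component u) z = 0.
  by case: z => x t /inQ[Ox tT]; exact (divu x t Ox (lec t tT)).
have spin' z k : Q z ->
    jj * pd Q (bt R) (component w k) z + jj * advf a b tF (component u) (component w) k z
      - c1 * lapf a b tF (component w k) z
      - c2 * (\sum_l pd Q (bx R k) (pd Q (bx R l) (component w l)) z)
      + 4 * nur * component w k z
    = 2 * nur * curlf a b tF (component u) k z + mu0 * crossf (component m) H k z.
  case: z => x t Qz; have [Ox tT] := inQ x t Qz; have cz := subset_closure Qz.
  have := congr1 (fun v : 'rV_3 => v 0 k) (spin x t Ox (lec t tT)); rewrite !mxE !hE// => E.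
  rewrite -(pd_divf (a := a) (b := b) (T := tF) Cw (axis_bx k) cz); exact E.
have magnetization' z k : Q z ->
    pd Q (bt R) (component m k) z + advf a b tF (component u) (component m) k z
      - sigma * lapf a b tF (component m k) z
    = crossf (component w) (component m) k z - TT^-1 * (component m k z - kappa0 * H k z).
  case: z => x t Qz; have [Ox tT] := inQ x t Qz; have cz := subset_closure Qz.
  have := congr1 (fun v : 'rV_3 => v 0 k) (magnetization x t Ox (lec t tT)).
  rewrite !mxE hE// => E; exact E.
have vU : vanishing a b tF (component u).
  by move=> x t bx tT k; have [u0' _] := bc x t bx tT; rewrite /component u0' mxE.
have vW : vanishing a b tF (component w).
  by move=> x t bx tT k; have [_ w0'] := bc x t bx tT; rewrite /component w0' mxE.
have poisson' z : Q z -> - lapf a b tF phi z = divf a b tF (component m) z.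
  by case: z => x t /inQ[Ox tT]; exact (poisson x t Ox (lecc t tT)).
(* The Neumann condition on [phi], read as [k . n = 0]. *)
have tK : tangential a b tF (fun k z => H k z + (component m k z - component ha k z)).
  move=> x n t bx on tT; have := hbc x n t bx on (lecc t tT).
  rewrite /dot => /eqP; rewrite -subr_eq0 => /eqP E.
  rewrite -[RHS]E -sumrB; apply: eq_bigr => k _; rewrite !mxE /component /H; ring.
have sigma_bc' : sigma = 0 \/
  (forall x n t, boundary (polyhedron a b) x -> outward_unit_normal (polyhedron a b) x n ->
    0 < t < tF ->
    (forall k : 'I_3, curlf a b tF (component m) (k + 1) (x, t) * n 0 (k + 1 + 1)
      - curlf a b tF (component m) (k + 1 + 1) (x, t) * n 0 (k + 1) = 0)
    /\ divf a b tF (component m) (x, t) = 0).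
  case: sigma_bc => [->|[_ [cm0 dm0]]]; [by left|right => x n t bx on tT].
  split=> [k|]; last exact (dm0 x t bx tT).
  by have := cross_eq0 k (cm0 x n t bx on tT); rewrite !mxE.
have main := energy_inequality bO T0 mu0_ge0 k0_ge0 TT_gt0 (fun k => Cha 1%N k) Cu Cw Cm Cphi Cp
  divHA momentum' divU spin' magnetization' vU vW poisson' tK sigma_bc'.
have cc v (Cv : forall k, Ck Q 1 (component v k)) k := Ck_continuous (Cv k).
have Cu1 := Cpred _ Cu; have Cw1 := Cpred _ Cw; have Cm1 := Cpred _ Cm.
have cH k := Ck_continuous (CH k).
have vec t (tT : 0 <= t <= tF) v (Cv : forall k, Ck Q 1 (component v k)) :=
  has_integral_sumsq T0 tT (cc v Cv) (F := v) (fun _ _ _ => erefl).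
have hint t (tT : 0 <= t <= tF) := has_integral_sumsq T0 tT cH (F := h) hE.
have ad t (tT : 0 <= t <= tF) f g x y := @has_integral_add _ _ a b tF bO T0 t tT f g x y.
have sc t (tT : 0 <= t <= tF) c f x := @has_integral_scale _ _ a b tF bO T0 t tT f x c.
have enE t : 0 <= t <= tF -> space_integral a b
    (energy_density a b tF mu0 jj (component u) (component w) (component m) phi) t
    = energy (polyhedron a b) jj mu0 u w m h t.
  move=> tT.
  exact (sc t tT 2^-1 _ _ (ad t tT _ _ _ _ (ad t tT _ _ _ _ (ad t tT _ _ _ _
    (vec t tT u Cu1) (sc t tT jj _ _ (vec t tT w Cw1))) (sc t tT mu0 _ _ (vec t tT m Cm1)))
    (sc t tT mu0 _ _ (hint t tT)))).2.
have foE t : 0 <= t <= tF -> space_integral a b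
    (forcing_density a b tF mu0 kappa0 TT (component ha)) t
    = forcing (polyhedron a b) Q mu0 kappa0 TT ha t.
  move=> tT; have cdt k : {within closure Q, continuous (pd Q (bt R) (component ha k))}.
    exact (continuous_pd (axis_bt R) (Cha 1%N k)).
  have dtha : has_integral a b tF t (sumsq (fun k => pd Q (bt R) (component ha k)))
      (vL2norm (polyhedron a b) (fun x => dt Q ha (x, t)) ^+ 2).
    by apply: (has_integral_sumsq T0 tT cdt) => z k _; rewrite mxE.
  exact (ad t tT _ _ _ _ (sc t tT _ _ _ dtha) (sc t tT _ _ _ (vec t tT ha (Cha 1%N)))).2.
have diE t : 0 <= t <= tF -> space_integral a b
    (dissipation_density a b tF nu nur mu0 c1 c2 sigma kappa0 TT
      (component u) (component w) (component m) phi) t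
    = dissipation (polyhedron a b) Q nu nur mu0 c1 c2 sigma kappa0 TT u w m h t.
  move=> tT.
  have gradE v : (forall k, Ck Q 1 (component v k)) ->
      has_integral a b tF t (fun z => \sum_k \sum_i pd Q (bx R i) (component v k) z ^+ 2)
        (vL2norm (polyhedron a b) (fun x => vgrad Q v (x, t)) ^+ 2).
    move=> Cv; apply: (has_integral_mxnorm T0 tT).
      apply: within_sum => k; apply: within_sum => i.
      by apply: within_mul; exact (continuous_pd (axis_bx i) (Cv k)).
    (* Rows of [vgrad] are indexed by the derivative, whereas the density sums over components
       first. *)
    move=> z _; rewrite exchange_big; apply: eq_bigr => i _; apply: eq_bigr => k _.
    by rewrite mxE.
  have curlE v : (forall k, Ck Q 1 (component v k)) ->
      has_integral a b tF t (sumsq (curlf a b tF (component v)))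
        (vL2norm (polyhedron a b) (fun x => curl Q v (x, t)) ^+ 2).
    move=> Cv; apply: (has_integral_sumsq T0 tT (F := curl Q v)) => [k|z k _];
      first exact (continuous_curlf Cv).
    by rewrite mxE.
  have divE v : (forall k, Ck Q 1 (component v k)) ->
      has_integral a b tF t (fun z => divf a b tF (component v) z * divf a b tF (component v) z)
        (L2norm (polyhedron a b) (fun x => div Q v (x, t)) ^+ 2).
    by move=> Cv; exact (has_integral_L2norm T0 tT (continuous_divf Cv) (fun _ _ => erefl)).
  have divhE : has_integral a b tF t (fun z => divf a b tF H z * divf a b tF H z)
        (L2norm (polyhedron a b) (fun x => div Q h (x, t)) ^+ 2).
    apply: (has_integral_L2norm T0 tT (continuous_divf CH)) => z _.
    by apply: eq_bigr => k _; rewrite hpd.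
  have slip : has_integral a b tF t
      (sumsq (fun k z => curlf a b tF (component u) k z - 2 * component w k z))
      (vL2norm (polyhedron a b) (fun x => curl Q u (x, t) - 2 *: w (x, t)) ^+ 2).
    apply: (has_integral_sumsq T0 tT (F := fun z => curl Q u z - 2 *: w z)) => [k|z k _].
      apply: within_add; first exact (continuous_curlf Cu1).
      apply: within_opp; apply: within_mul; first exact: within_cst.
      exact (cc w Cw1 k).
    by rewrite !mxE.
  exact (ad t tT _ _ _ _ (ad t tT _ _ _ _ (ad t tT _ _ _ _ (ad t tT _ _ _ _
    (ad t tT _ _ _ _ (ad t tT _ _ _ _ (ad t tT _ _ _ _ (ad t tT _ _ _ _
      (sc t tT _ _ _ (gradE u Cu1)) (sc t tT _ _ _ (gradE w Cw1)))
      (sc t tT _ _ _ (curlE m Cm1))) (sc t tT _ _ _ (divE m Cm1)))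
      (sc t tT _ _ _ divhE)) (sc t tT _ _ _ (divE w Cw1))) (sc t tT _ _ _ slip))
      (sc t tT _ _ _ (vec t tT m Cm1))) (sc t tT _ _ _ (hint t tT))).2.
have l0 : 0 <= (0 : R) <= tF by rewrite lexx ltW.
have lT : 0 <= tF <= tF by rewrite lexx ltW.
move: main; rewrite (enE 0 l0) (enE tF lT).
have inT (D : R -> R) (F : R -> R) : (forall t, 0 <= t <= tF -> D t = F t) ->
    \int[@lebesgue_measure R]_(t in `[0, tF]) D t = \int[@lebesgue_measure R]_(t in `[0, tF]) F t.
  by move=> DF; apply: eq_Rintegral => t; rewrite inE /= in_itv; exact: DF.
by rewrite (inT _ _ diE) (inT _ _ foE).
Qed.
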